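(* Let $(X,\mu)$ be a differentiability space. Let $\{x_i\}\subset X$ be a countable dense set and define seminorms on $TX$ as follows: $\|v\|_1=\sup_i|du_i(v)|$, where $u_i(x)=d_X(x,x_i)$; $\|\cdot\|_2$ is the essential supremum of the seminorms $v\mapsto|du(v)|$ where $u$ ranges over all distance functions $u=d_X(\cdot,x)$, $x\in X$; $\|\cdot\|_3$ is the essential supremum of the seminorms $v\mapsto|df(v)|$ where $f$ ranges over all $1$-Lipschitz functions $f:X\to\mathbb R$; and $\|\cdot\|_4=\|\cdot\|_{\mathrm{Lip}}^*$ is the norm on $TX$ dual to the norm on $T^*X$ induced by the pointwise upper Lipschitz constant. Then $\|\cdot\|_1,\|\cdot\|_2,\|\cdot\|_3,\|\cdot\|_4$ agree on the fibre $T_xX$ for $\mu$-a.e. $x\in X$. In particular they are all norms (a.e.), and $\|\cdot\|_1$ is, up to $\mu$-null sets, independent of the choice of the countable dense subset.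
   Context: Differentiability spaces. $X$ is a complete separable metric space with metric $d_X$, and $\mu$ is a Radon measure on $X$. For a Lipschitz $f:X\to\mathbb R$, $\operatorname{Lip}f(x)=\limsup_{r\searrow0}\sup\{|f(y)-f(x)|/r:d_X(x,y)\le r\}$. Finitely many Lipschitz functions are dependent at $x$ if some nontrivial linear combination $v$ of them satisfies $\operatorname{Lip}v(x)=0$; otherwise they are independent at $x$. An $n$-dimensional chart ($n\ge1$) is a pair $(U,\phi)$ with $U\subset X$ Borel, $\mu(U)>0$, $\phi=(\phi^1,\dots,\phi^n):X\to\mathbb R^n$ Lipschitz, such that $\phi^1,\dots,\phi^n$ are independent at $\mu$-a.e. $x\in U$, and for every Lipschitz $f:X\to\mathbb R$ the tuple $(\phi^1,\dots,\phi^n,f)$ is dependent at $\mu$-a.e. $x\in U$; thus there are $\mu$-a.e. unique Borel functions $\partial f/\partial\phi^i$ on $U$ with $f(x)=f(x_0)+\sum_i\frac{\partial f}{\partial\phi^i}(x_0)(\phi^i(x)-\phi^i(x_0))+o(d_X(x,x_0))$ for $\mu$-a.e. $x_0\in U$ ($f$ is differentiable at $x_0$ with respect to $\phi$). $(X,\mu)$ is a differentiability space if there is a countable collection (atlas) of charts $\{(U_\alpha,\phi_\alpha)\}$ with $\mu(X\setminus\bigcup_\alpha U_\alpha)=0$; an atlas is fixed such that at each point of $U_\alpha\cap U_\beta$ the components of $\phi_\alpha$ are differentiable with respect to $\phi_\beta$. The cotangent bundle $T^*X$ is the measurable vector bundle whose fibre over $x\in U_\alpha$ has basis $d\phi_\alpha^i(x)$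 (transition maps given by the partial derivatives of the charts), $df(x)=\sum_i\frac{\partial f}{\partial\phi_\alpha^i}(x)\,d\phi_\alpha^i(x)$, and $TX$ is the dual bundle. The norm on $T^*X$ is $\|\sum_ia_i\,d\phi^i_\alpha(x)\|_{\mathrm{Lip}}=\operatorname{Lip}(\sum_ia_i\phi_\alpha^i)(x)$ (a norm for a.e. $x$; $\|df\|_{\mathrm{Lip}}=\operatorname{Lip}f$ a.e.), and $\|\cdot\|^*_{\mathrm{Lip}}$ is its dual norm on $TX$. Bundles, sections and seminorms are identified if they agree $\mu$-a.e. Essential supremum: given a (possibly uncountable) family $\{\|\cdot\|_\omega\}_{\omega\in\Omega}$ of measurable seminorms on $TX$, its essential supremum is the $\mu$-a.e. unique measurable generalized seminorm $\|\cdot\|_\Omega$ such that $\|\sigma\|_\Omega\ge\|\sigma\|_\omega$ $\mu$-a.e. for each $\omega$ and each measurable section $\sigma$, and such that any other generalized seminorm with this property is $\ge\|\cdot\|_\Omega$ $\mu$-a.e. (a generalized seminorm may also take, on a fibre, the value $+\infty$ on all nonzero vectors). *)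

(* Defs.v *)
From HB Require Import structures.
From mathcomp Require Import all_boot all_order all_algebra.
From mathcomp Require Import all_classical all_reals all_analysis.
From mathcomp Require Import measurable_realfun.

Set Implicit Arguments.
Unset Strict Implicit.
Unset Printing Implicit Defensive.

Import Order.TTheory GRing.Theory Num.Theory.
Import numFieldNormedType.Exports.

Local Open Scope classical_set_scope.
Local Open Scope ring_scope.

(* Pointedness, i.e. X nonempty, is what measurableType requires. *)
#[short(type="completePMetricType")]
HB.structure Definition CompletePMetric (R : numDomainType) :=
  { X of Metric R X & Complete X & Pointed X }.

Definition separable (T : topologicalType) : Prop :=
  exists2 D : set T, countable D & dense D.

Notation borel X := (g_sigma_algebraType (@open X)).

Section radon.
Context {R : realType} {X : completePMetricType R}.
Variable mu : {measure set (borel X) -> \bar R}.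
Local Open Scope ereal_scope.

Definition locally_finite : Prop :=
  forall x : X, exists2 V : set X, open_nbhs x V & mu V < +oo.

Definition compact_inner_regular : Prop :=
  forall B : set (borel X), measurable B ->
    mu B = ereal_sup [set mu K | K in [set K : set X | compact K /\ K `<=` B]].

Definition radon : Prop := locally_finite /\ compact_inner_regular.

End radon.

Section lipschitz_functions.
Context {R : realType} {X : completePMetricType R}.

Definition lipschitz_with (k : R) (f : X -> R) : Prop :=
  forall x y, `|f x - f y| <= k * mdist x y.

Definition lipschitz_fun (f : X -> R) : Prop := exists k, lipschitz_with k f.

Definition Lip (f : X -> R) (x : X) : \bar R :=
  limf_esup (fun r : R =>
    ereal_sup [set (`|f y - f x| / r)%:E | y in [set y | mdist x y <= r]]) 0^'+.

End lipschitz_functions.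

(* Covectors are rows, vectors are columns. *)
Definition pairing {R : realType} {n : nat} (a : 'rV[R]_n) (v : 'cV[R]_n) : R :=
  \sum_i a 0 i * v i 0.

Section charts.
Context {R : realType} {X : completePMetricType R}.

Definition lincomb n (a : 'rV[R]_n) (phi : X -> 'cV[R]_n) : X -> R :=
  fun y => pairing a (phi y).

Definition dependent_at n (phi : X -> 'cV[R]_n) (x : X) : Prop :=
  exists2 a : 'rV[R]_n, a != 0 & Lip (lincomb a phi) x = 0%E.

Definition independent_at n (phi : X -> 'cV[R]_n) (x : X) : Prop :=
  ~ dependent_at phi x.

Definition adjoin n (phi : X -> 'cV[R]_n) (f : X -> R) : X -> 'cV[R]_(n + 1) :=
  fun y => col_mx (phi y) (f y)%:M.

Definition is_chart (mu : {measure set (borel X) -> \bar R})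
    n (U : set X) (phi : X -> 'cV[R]_n) : Prop :=
  [/\ (1 <= n)%N,
      measurable (U : set (borel X)) /\ (0 < mu U)%E,
      forall i, lipschitz_fun (fun y => phi y i 0),
      \forall x \ae mu, U x -> independent_at phi x &
      forall f, lipschitz_fun f ->
        \forall x \ae mu, U x -> dependent_at (adjoin phi f) x].

Definition is_differential n (phi : X -> 'cV[R]_n) (f : X -> R) (x0 : X)
    (a : 'rV[R]_n) : Prop :=
  (fun x => f x - (f x0 + pairing a (phi x - phi x0)))
    =o_x0 (fun x => mdist x x0).

Definition differentiable_wrt n (phi : X -> 'cV[R]_n) (f : X -> R) (x0 : X)
    : Prop :=
  exists a, is_differential phi f x0 a.

(* The row of partial derivatives of f with respect to phi.  It is unique where
   phi is independent; elsewhere the value is arbitrary, and it is 0 if f is not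
   differentiable. *)
Definition partials n (phi : X -> 'cV[R]_n) (f : X -> R) (x0 : X) : 'rV[R]_n :=
  xget 0 [set a | is_differential phi f x0 a].

End charts.

Record chart_family (R : realType) (X : completePMetricType R) := ChartFamily {
  chart_idx : countType ;
  chart_dim : chart_idx -> nat ;
  chart_dom : chart_idx -> set X ;
  chart_map : forall al : chart_idx, X -> 'cV[R]_(chart_dim al)
}.
Arguments chart_dim {R X A} al : rename.
Arguments chart_dom {R X A} al _ : rename.
Arguments chart_map {R X A} al _ : rename.

Section atlases.
Context {R : realType} {X : completePMetricType R}.
Variables (mu : {measure set (borel X) -> \bar R}) (A : chart_family X).

Definition is_atlas : Prop :=
  (forall al : chart_idx A, is_chart mu (chart_dom al) (chart_map al)) /\
  mu.-negligible (~` \bigcup_(al : chart_idx A) chart_dom al).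

Definition compatible_atlas : Prop :=
  forall (al be : chart_idx A) x, chart_dom al x -> chart_dom be x ->
    forall i, differentiable_wrt (chart_map be) (fun y => chart_map al y i 0) x.

End atlases.

(* The bundles are given by their local trivializations over the domains
   chart_dom al and their transition maps: over x in chart_dom al, a covector is
   the row of its coefficients on the basis dphi_al^i(x) of T*_xX, and a vector
   is the column of its coefficients on the dual basis of T_xX.  A section, or a
   function on TX, is the family of its local expressions, which have to
   correspond to each other under the transition maps. *)
Section bundles.
Context {R : realType} {X : completePMetricType R}.
Variables (mu : {measure set (borel X) -> \bar R}) (A : chart_family X).

(* As dphi_be^j = sum_i (partial phi_be^j / partial phi_al^i) dphi_al^i, this
   matrix maps vectors from al- to be-coordinates by left multiplication, and
   covectors from be- to al-coordinates by right multiplication. *)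
Definition transition (al be : chart_idx A) (x : X)
    : 'M[R]_(chart_dim be, chart_dim al) :=
  \matrix_(j, i) partials (chart_map al) (fun y => chart_map be y j 0) x 0 i.

Definition differential (f : X -> R) (al : chart_idx A) (x : X)
    : 'rV[R]_(chart_dim al) :=
  partials (chart_map al) f x.

(* Objects on X are identified when they agree almost everywhere, so
   "measurable" means "almost everywhere equal to a Borel function". *)
Definition ae_measurable d (T : measurableType d) (U : set X) (f : X -> T)
    : Prop :=
  exists2 g : borel X -> T, measurable_fun (U : set (borel X)) g &
    \forall x \ae mu, U x -> f x = g x.

Definition TX_field := forall al : chart_idx A, X -> 'cV[R]_(chart_dim al).

Definition measurable_section (s : TX_field) : Prop :=
  (forall al i, ae_measurable (chart_dom al) (fun x => s al x i 0)) /\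
  (forall al be, \forall x \ae mu, chart_dom al x -> chart_dom be x ->
     s be x = transition al be x *m s al x).

Definition TX_fun :=
  forall al : chart_idx A, X -> 'cV[R]_(chart_dim al) -> \bar R.

Definition is_seminorm n (p : 'cV[R]_n -> \bar R) : Prop :=
  [/\ forall v, (0 <= p v < +oo)%E,
      forall c v, p (c *: v) = (`|c|%:E * p v)%E &
      forall v w, (p (v + w)%R <= p v + p w)%E].

Definition is_norm n (p : 'cV[R]_n -> \bar R) : Prop :=
  is_seminorm p /\ forall v, p v = 0%E -> v = 0.

Definition is_generalized_seminorm n (p : 'cV[R]_n -> \bar R) : Prop :=
  is_seminorm p \/ (p 0 = 0%E /\ forall v, v != 0 -> p v = +oo%E).

Definition measurable_generalized_seminorm (N : TX_fun) : Prop :=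
  [/\ forall al, \forall x \ae mu, chart_dom al x ->
        is_generalized_seminorm (N al x),
      forall al be, \forall x \ae mu, chart_dom al x -> chart_dom be x ->
        forall v, N be x (transition al be x *m v) = N al x v &
      forall s, measurable_section s ->
        forall al, ae_measurable (chart_dom al) (fun x => N al x (s al x))].

Definition dominates (F : set TX_fun) (N : TX_fun) : Prop :=
  forall M, F M -> forall s, measurable_section s ->
    forall al, \forall x \ae mu, chart_dom al x ->
      (M al x (s al x) <= N al x (s al x))%E.

Definition is_essential_supremum (F : set TX_fun) (N : TX_fun) : Prop :=
  [/\ measurable_generalized_seminorm N,
      dominates F N &
      forall N', measurable_generalized_seminorm N' -> dominates F N' ->
        forall al, \forall x \ae mu, chart_dom al x ->
          forall v, (N al x v <= N' al x v)%E].

Definition abs_differential (f : X -> R) : TX_fun :=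
  fun al x v => `|pairing (differential f al x) v|%:E.

Definition dist_to (y : X) : X -> R := fun x => mdist x y.

Definition dense_distance_seminorm (D : set X) : TX_fun :=
  fun al x v => ereal_sup [set abs_differential (dist_to y) x v | y in D].

Definition distance_seminorms : set TX_fun :=
  [set abs_differential (dist_to y) | y in [set: X]].

Definition lipschitz1_seminorms : set TX_fun :=
  [set abs_differential f | f in [set f | lipschitz_with 1 f]].

Definition Lip_norm (al : chart_idx A) (x : X) (a : 'rV[R]_(chart_dim al))
    : \bar R :=
  Lip (lincomb a (chart_map al)) x.

Definition dual_Lip_norm : TX_fun :=
  fun al x v => ereal_sup
    [set `|pairing a v|%:E | a in [set a | (Lip_norm x a <= 1)%E]].

End bundles.

Arguments dense_distance_seminorm {R X} A D al x v.
Arguments dual_Lip_norm {R X} A al x v.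
Arguments distance_seminorms {R X} A.
Arguments lipschitz1_seminorms {R X} A.

(* Main.v *)
(* Clearly N1 <= N4, so the point is that a covector [a] with [Lip a <= 1] cannot
   be separated, by a vector [v], from the differentials of the distance functions
   on a set of positive measure.  If it were, there would be a compact set K and
   1-Lipschitz functions e_k converging to f = a . phi uniformly on K (minima of
   translates of distance functions), with differentials staying away from [a]; by
   convexity their differentials may be taken to converge in L^2(K).  Summing
   (-1)^k (e_k - f) along a sparse subsequence gives a function that is Lipschitz
   on a set of positive measure: the differentials of the partial sums stay
   bounded, and each new term is invisible on the scales where the previous partial
   sum is already almost affine.  By the separation of scales, the differential of
   the sum is almost that of every partial sum, although consecutive partial sums
   have differentials that differ by at least a constant: a contradiction.
   The same construction applied to truncations of the distance to a set S shows
   that almost every point of S is a point of non-porosity, which makes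
   differentials local. *)
Require Import Defs.
From mathcomp Require Import all_boot all_order all_algebra.
From mathcomp Require Import all_classical all_reals all_analysis.
From mathcomp Require Import measurable_realfun.
From mathcomp Require Import ring lra.

Set Implicit Arguments.
Unset Strict Implicit.
Unset Printing Implicit Defensive.

Import Order.TTheory GRing.Theory Num.Theory.
Import numFieldNormedType.Exports.

Local Open Scope classical_set_scope.
Local Open Scope ring_scope.

(** * The pairing of covectors and vectors, and the maximum norm *)

Section pairing_theory.
Context {R : realType}.

(** A Radon measure on a metric space need not satisfy a density theorem. Non-porosity takes the
    place of density points: through it a minimum of two functions inherits a slope bound from both.
    The limit of the alternating series is Lipschitz only on a subset of K, so it is extended from
    there, and non-porosity again allows its differential to be read off at points of that subset. A
    covector can be recognized at a given scale only if some point lies at a suitable distance in a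
    suitable direction. Hence each partial sum carries two radii: below the outer one it is almost
    affine, and above the inner one every covector is already visible. Later terms are small
    compared with the inner radius. Radii uniform in the point are bought by discarding sets of
    summably small measure. Each term of the series must be arbitrarily close to f, at a precision
    known only when its turn comes. The convexity argument therefore produces nested classes of
    functions with nearby differentials rather than one convergent sequence. Null sets depend on the
    covector, the vector and the slope, so the separation is carried out for rational data. *)

Lemma pairingDl n (a b : 'rV[R]_n) v : pairing (a + b) v = pairing a v + pairing b v.
Proof. by rewrite /pairing -big_split; apply: eq_bigr => i _; rewrite mxE mulrDl. Qed.

Lemma pairingZl n c (a : 'rV[R]_n) v : pairing (c *: a) v = c * pairing a v.
Proof. by rewrite /pairing mulr_sumr; apply: eq_bigr => i _; rewrite mxE mulrA. Qed.

Lemma pairingNl n (a : 'rV[R]_n) v : pairing (- a) v = - pairing a v.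
Proof. by rewrite -scaleN1r pairingZl mulN1r. Qed.

Lemma pairingBl n (a b : 'rV[R]_n) v : pairing (a - b) v = pairing a v - pairing b v.
Proof. by rewrite pairingDl pairingNl. Qed.

Lemma pairing0l n (v : 'cV[R]_n) : pairing 0 v = 0.
Proof. by rewrite -(scale0r 0) pairingZl mul0r. Qed.

Lemma pairingDr n (a : 'rV[R]_n) v w : pairing a (v + w) = pairing a v + pairing a w.
Proof. by rewrite /pairing -big_split; apply: eq_bigr => i _; rewrite mxE mulrDr. Qed.

Lemma pairingZr n c (a : 'rV[R]_n) v : pairing a (c *: v) = c * pairing a v.
Proof. by rewrite /pairing mulr_sumr; apply: eq_bigr => i _; rewrite mxE mulrCA. Qed.

Lemma pairingNr n (a : 'rV[R]_n) v : pairing a (- v) = - pairing a v.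
Proof. by rewrite -scaleN1r pairingZr mulN1r. Qed.

Lemma pairingBr n (a : 'rV[R]_n) v w : pairing a (v - w) = pairing a v - pairing a w.
Proof. by rewrite pairingDr pairingNr. Qed.

Lemma pairingE n (a : 'rV[R]_n) v : pairing a v = (a *m v) 0 0.
Proof. by rewrite mxE. Qed.

Lemma pairing_mulmx m n (a : 'rV[R]_m) (T : 'M[R]_(m, n)) v :
  pairing (a *m T) v = pairing a (T *m v).
Proof. by rewrite !pairingE mulmxA. Qed.

Lemma pairing_delta n (i : 'I_n) (v : 'cV[R]_n) : pairing (delta_mx 0 i) v = v i 0.
Proof.
rewrite /pairing (bigD1 i)//= big1 ?addr0 ?mxE ?eqxx ?mul1r// => j ji.
by rewrite mxE (negbTE ji) andbF mul0r.
Qed.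

Lemma mx_norm_coord m n (A : 'M[R]_(m, n)) i j : `|A i j| <= `|A|.
Proof.
rewrite /Num.norm/= mx_normrE.
exact: (le_bigmax _ (fun ij : 'I_m * 'I_n => `|A ij.1 ij.2|) (i, j)).
Qed.

Lemma mx_norm_leP m n (A : 'M[R]_(m, n)) c : 0 <= c ->
  (forall i j, `|A i j| <= c) -> `|A| <= c.
Proof.
move=> c0 Ac; rewrite /Num.norm/= mx_normrE.
by apply/bigmax_leP; split=> // -[i j] _; exact: Ac.
Qed.

Lemma pairing_le n (a : 'rV[R]_n) v : `|pairing a v| <= n%:R * `|a| * `|v|.
Proof.
rewrite (le_trans (ler_norm_sum _ _ _))//.
have -> : n%:R * `|a| * `|v| = \sum_(i < n) `|a| * `|v|.
  by rewrite sumr_const card_ord -mulrA mulr_natl.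
apply: ler_sum => i _; rewrite normrM ler_pM//; exact: mx_norm_coord.
Qed.

End pairing_theory.

(** * Local Lipschitz constants at a point *)

Section local_lipschitz.
Context {R : realType} {X : completePMetricType R}.

Definition locLip (g : X -> R) (c rho : R) (x : X) : Prop :=
  forall y, mdist x y < rho -> `|g y - g x| <= c * mdist x y.

Definition flat_at (g : X -> R) (x : X) : Prop :=
  forall e, 0 < e -> exists2 rho, 0 < rho & locLip g e rho x.

Lemma locLip_le g c c' rho rho' x : c <= c' -> rho' <= rho ->
  locLip g c rho x -> locLip g c' rho' x.
Proof.
move=> cc rr H y xy; rewrite (le_trans (H y _)) ?(lt_le_trans xy)//.
by rewrite ler_wpM2r// mdist_ge0.
Qed.

Lemma locLipD g h c d rho x : locLip g c rho x -> locLip h d rho x ->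
  locLip (fun y => g y + h y) (c + d) rho x.
Proof.
move=> G H y xy; rewrite opprD addrACA mulrDl (le_trans (ler_normD _ _))//.
by rewrite lerD// ?G ?H.
Qed.

Lemma locLipZ g k c rho x : locLip g c rho x ->
  locLip (fun y => k * g y) (`|k| * c) rho x.
Proof. by move=> G y xy; rewrite -mulrBr normrM -mulrA ler_wpM2l// G. Qed.

Lemma locLip_lipschitz k g rho x : lipschitz_with k g -> locLip g k rho x.
Proof. by move=> G y _; rewrite metric_sym; exact: G. Qed.

Lemma flatD g h x : flat_at g x -> flat_at h x -> flat_at (fun y => g y + h y) x.
Proof.
move=> G H e e0; have e2 : 0 < e / 2 by rewrite divr_gt0.
have [r r0 Gr] := G _ e2; have [s s0 Hs] := H _ e2.
exists (Num.min r s); first by rewrite lt_min r0.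
rewrite [e]splitr; apply: locLipD.
- by apply: locLip_le Gr => //; rewrite ge_min lexx.
- by apply: locLip_le Hs => //; rewrite ge_min lexx orbT.
Qed.

Lemma flatZ g k x : flat_at g x -> flat_at (fun y => k * g y) x.
Proof.
move=> G e e0; have k0 : 0 < `|k| + 1 by rewrite ltr_wpDl.
have [r r0 Gr] := G (e / (`|k| + 1)) (divr_gt0 e0 k0).
exists r => //; apply: locLip_le (locLipZ k Gr) => //.
by rewrite mulrCA ger_pMr// ler_pdivrMr// mul1r lerDl.
Qed.

Lemma Lip_lt g c x : (Lip g x < c%:E)%E -> exists2 rho, 0 < rho & locLip g c rho x.
Proof.
rewrite /Lip limf_esupE => /ereal_inf_lt[_ [V V0 <-] Vc].
have /(@nbhs_ballP R R^o)[rho /= rho0 rV] : nbhs (0:R)^'+ V by [].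
exists rho => // y xy.
have [->|xNy] := eqVneq y x; first by rewrite subrr normr0 mdistxx mulr0.
have d0 : 0 < mdist x y by rewrite mdist_gt0 eq_sym.
(* The radius [r = mdist x y] turns the quotient in [Lip] into the difference quotient at [y]. *)
have Vd : V (mdist x y).
  by apply: rV => //; rewrite /ball/= sub0r normrN gtr0_norm.
rewrite -ler_pdivrMr// -lee_fin ltW//.
apply: le_lt_trans Vc; apply: le_ereal_sup_tmp => /=.
exists (ereal_sup [set (`|g z - g x| / mdist x y)%:E | z in [set z | mdist x z <= mdist x y]]).
  by exists (mdist x y).
by apply: ereal_sup_ubound => /=; exists y.
Qed.

Lemma locLip_Lip g c rho x : 0 <= c -> 0 < rho -> locLip g c rho x -> (Lip g x <= c%:E)%E.
Proof.
move=> c0 rho0 G; rewrite /Lip limf_esupE.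
apply: ge_ereal_inf => /=; eexists.
  exists [set r | 0 < r < rho] => //.
  apply/(@nbhs_ballP R R^o); exists rho => //= r; rewrite /ball/= sub0r normrN => rr r0.
  by rewrite r0/= (le_lt_trans (ler_norm _)).
apply: ge_ereal_sup => _ [r /andP[r0 rr] <-].
apply: ge_ereal_sup => _ [y /= yr <-]; rewrite lee_fin ler_pdivrMr//.
by rewrite (le_trans (G _ _)) ?(le_lt_trans yr)// ler_wpM2l.
Qed.

Lemma Lip_ge0 (g : X -> R) x : (0 <= Lip g x)%E.
Proof.
rewrite /Lip limf_esupE; apply: le_ereal_inf_tmp => _ [V V0 <-].
have /(@nbhs_ballP R R^o)[rho /= rho0 rV] : nbhs (0:R)^'+ V by [].
have Vr : V (rho / 2).
  by apply: rV; rewrite ?divr_gt0// /ball/= sub0r normrN gtr0_norm ?divr_gt0//; lra.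
apply: le_ereal_sup_tmp; eexists; first by exists (rho / 2).
apply: ereal_sup_ubound => /=; exists x => //=; first by rewrite mdistxx ltW ?divr_gt0.
by rewrite subrr normr0 mul0r.
Qed.

Lemma Lip0P (g : X -> R) x : Lip g x = 0%E <-> flat_at g x.
Proof.
split=> [L0 e e0|G]; first by apply: Lip_lt; rewrite L0 lte_fin.
apply/eqP; rewrite eq_le Lip_ge0 andbT.
apply/lee_addgt0Pr => e e0; rewrite add0e.
by have [r r0 Gr] := G _ e0; apply: locLip_Lip Gr => //; exact: ltW.
Qed.

End local_lipschitz.

(** * Differentials with respect to an independent map *)

Section chart_calculus.
Context {R : realType} {X : completePMetricType R}.
Implicit Types (x y : X) (f g : X -> R).

Lemma lincombB n (a b : 'rV[R]_n) (phi : X -> 'cV[R]_n) y z :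
  lincomb (a - b) phi y - lincomb (a - b) phi z =
  (lincomb a phi y - lincomb a phi z) - (lincomb b phi y - lincomb b phi z).
Proof. by rewrite /lincomb !pairingBl; ring. Qed.

(** The affine remainder at [x] is the increment of [f - lincomb a phi], so differentiability
    becomes flatness, a condition stable under sums and multiples. *)
Lemma differentialP n (phi : X -> 'cV[R]_n) f x a :
  is_differential phi f x a <-> flat_at (fun y => f y - lincomb a phi y) x.
Proof.
have E y : f y - (f x + pairing a (phi y - phi x)) =
    f y - lincomb a phi y - (f x - lincomb a phi x).
  by rewrite /lincomb pairingBr; ring.
split=> [/eqoP H e e0|H].
  have /nbhs_ballP[r r0 rH] := H _ e0; exists r => // y xy.
  rewrite -E; have /= := rH y; rewrite ballEmdist/= => /(_ xy).
  by rewrite metric_sym [`|mdist _ _|]ger0_norm// mdist_ge0.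
apply/eqoP => e e0; have [r r0 rH] := H _ e0.
apply/nbhs_ballP; exists r => //= y; rewrite ballEmdist/= => xy.
rewrite E [`|mdist _ _|]ger0_norm ?mdist_ge0// metric_sym.
exact: rH.
Qed.

Definition map_lipschitz n (L : R) (phi : X -> 'cV[R]_n) : Prop :=
  forall a x y, `|pairing a (phi y - phi x)| <= L * `|a| * mdist x y.

Lemma map_lipschitzP n (phi : X -> 'cV[R]_n) :
  (forall i, lipschitz_fun (fun y => phi y i 0)) ->
  exists2 L, 0 < L & map_lipschitz L phi.
Proof.
move=> /= lphi; pose k i : R := xget 0 [set k | lipschitz_with k (fun y => phi y i 0)].
have kP i : lipschitz_with (k i) (fun y => phi y i 0)
  by apply: (@xgetPex _ 0 [set k | lipschitz_with k (fun y => phi y i 0)]); exact: lphi.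
(* On a one-point space the chosen constants [k i] may be negative, hence the absolute values; the
   [1] makes the bound positive. *)
exists (1 + \sum_i `|k i|); first by rewrite ltr_wpDr// sumr_ge0.
move=> a x y; rewrite /pairing (le_trans (ler_norm_sum _ _ _))//.
rewrite -mulrA mulrDl mul1r ler_wpDl ?mulr_ge0 ?mdist_ge0//.
rewrite mulr_suml; apply: ler_sum => i _; rewrite !mxE normrM mulrCA.
rewrite ler_pM ?mx_norm_coord//.
rewrite (le_trans (kP i y x))// metric_sym ler_wpM2r ?mdist_ge0//.
exact: ler_norm.
Qed.

Lemma lincomb_lipschitz n L (phi : X -> 'cV[R]_n) a :
  map_lipschitz L phi -> lipschitz_with (L * `|a|) (lincomb a phi).
Proof. by move=> H x y; rewrite /lincomb -pairingBr metric_sym; exact: H. Qed.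

(* This says [kap * `|a| <= Lip (lincomb a phi) x]; the condition [0 <= c] only
   matters at isolated points, where every [c] is a local Lipschitz constant. *)
Definition indepK n (kap : R) (phi : X -> 'cV[R]_n) x : Prop :=
  forall a c rho, 0 <= c -> 0 < rho -> locLip (lincomb a phi) c rho x ->
    kap * `|a| <= c.

Lemma indepK_Lip n kap (phi : X -> 'cV[R]_n) x a :
  indepK kap phi x -> ((kap * `|a|)%:E <= Lip (lincomb a phi) x)%E.
Proof.
move=> I; rewrite leNgt; apply/negP => H.
have L0 := Lip_ge0 (lincomb a phi) x.
have Lfin : Lip (lincomb a phi) x \is a fin_num.
  by rewrite ge0_fin_numE// (lt_trans H)// ltry.
pose l := fine (Lip (lincomb a phi) x).
have lE : Lip (lincomb a phi) x = l%:E by rewrite /l fineK.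
have l0 : 0 <= l by rewrite -lee_fin -lE.
have lk : l < kap * `|a| by rewrite -lte_fin -lE.
have [|r r0 Hr] := @Lip_lt _ _ (lincomb a phi) ((l + kap * `|a|) / 2) x.
  by rewrite lE lte_fin; lra.
have := I _ _ _ _ r0 Hr; lra.
Qed.

(* By compactness of the unit sphere. *)
Lemma independent_indepK n L (phi : X -> 'cV[R]_n) x :
  map_lipschitz L phi -> independent_at phi x ->
  exists2 kap, 0 < kap & indepK kap phi x.
Proof.
move=> phiL ind.
pose ub (a : 'rV[R]_n) : set R := [set c | 0 <= c /\ exists2 rho, 0 < rho & locLip (lincomb a phi) c rho x].
have ub_L a : ub a (`|L| * `|a|).
  split; first by rewrite mulr_ge0.
  exists 1 => // y _; rewrite /lincomb -pairingBr (le_trans (phiL _ _ _))//.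
  by rewrite ler_wpM2r ?mdist_ge0// ler_wpM2r// ler_norm.
(* [l a] is [Lip (lincomb a phi) x] as a real number; [lD] makes it Lipschitz in [a], so that it
   attains its minimum on the sphere. *)
pose l a := inf (ub a).
have ub_inf a : has_inf (ub a) by split; [by exists (`|L| * `|a|) | by exists 0 => c []].
have l0 a : 0 <= l a by apply: lb_le_inf; [by exists (`|L| * `|a|) | by move=> c []].
have lD a b : l a <= l b + `|L| * `|a - b|.
  apply/ler_addgt0Pr => e e0.
  have [c [c0 [r r0 Hr]] cl] := inf_adherent e0 (ub_inf b).
  rewrite -/(l b) in cl.
  suff : ub a (c + `|L| * `|a - b|).
    move=> /(ge_inf (ub_inf a).2)/le_trans; apply; lra.
  have [_ [r' r'0 Hr']] := ub_L (a - b).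
  split; first by rewrite addr_ge0// mulr_ge0.
  exists (Num.min r r'); first by rewrite lt_min r0.
  move=> y; rewrite lt_min => /andP[yr yr'].
  have -> : lincomb a phi y - lincomb a phi x =
     (lincomb b phi y - lincomb b phi x) +
     (lincomb (a - b) phi y - lincomb (a - b) phi x) by rewrite lincombB; ring.
  by rewrite mulrDl (le_trans (ler_normD _ _))// lerD ?Hr ?Hr'.
pose S := [set a : 'rV[R]_n | `|a| = 1].
have lcont : continuous l.
  move=> a; apply/(@cvgrPdist_le _ _ _ _ (nbhs_filter a)) => e e0.
  have d0 : 0 < e / (`|L| + 1) by rewrite divr_gt0// ltr_wpDl.
  near=> b.
  have ab : `|a - b| <= e / (`|L| + 1).
    near: b; apply/nbhs_ballP; exists (e / (`|L| + 1)) => //= b.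
    by rewrite mx_norm_ball /ball_/= => /ltW.
  have abe : `|L| * `|a - b| <= e.
    have : (`|L| + 1) * `|a - b| <= e by rewrite mulrC -ler_pdivlMr// ltr_wpDl.
    by have := normr_ge0 (a - b); lra.
  have H1 := lD a b; have H2 := lD b a; rewrite distrC in H2.
  by rewrite ler_norml; apply/andP; split; lra.
(* The sphere is empty when [n = 0], and then every covector vanishes. *)
have [S0|/set0P S0] := eqVneq S set0.
  exists 1 => // a c rho c0 _ _; suff -> : a = 0 by rewrite normr0 mulr0.
  apply/eqP/negPn/negP => aN0.
  suff : S (`|a|^-1 *: a) by rewrite S0.
  by rewrite /S/= normrZ normfV normr_id mulVf// normr_eq0.
have Sc : compact S.
  apply: bounded_closed_compact.
    by exists 1; split=> // r r1 a; rewrite /S/= => ->; exact: ltW.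
  have -> : S = (fun a : 'rV[R]_n => `|a|) @^-1` [set 1] by [].
  by apply: preimage_closed; [move=> a _; exact: norm_continuous | exact: closed_eq].
have [a0 Sa0 a0min] := EVT_min_rV S0 Sc (continuous_subspaceT lcont).
have la0 : 0 < l a0.
  rewrite lt_neqAle l0 andbT eq_sym; apply/eqP => la0.
  move: Sa0; rewrite inE /S/= => Sa0.
  apply: ind; exists a0; first by rewrite -normr_eq0 Sa0 oner_neq0.
  apply/Lip0P => e e0.
  have [c [c0 [r r0 Hr]] cl] := inf_adherent e0 (ub_inf a0).
  exists r => //; apply: locLip_le Hr => //.
  by rewrite -/(l a0) la0 add0r in cl; exact: ltW.
exists (l a0) => // a c rho c0 rho0 H.
have [->|aN0] := eqVneq a 0; first by rewrite normr0 mulr0.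
have na : 0 < `|a| by rewrite normr_gt0.
rewrite -ler_pdivlMr//.
apply: (le_trans (a0min (`|a|^-1 *: a) _)).
  by rewrite inE /S/= normrZ normfV normr_id mulVf// normr_eq0.
apply: ge_inf; first exact: (ub_inf _).2.
split; first by rewrite divr_ge0.
exists rho => // y xy; rewrite /lincomb !pairingZl -mulrBr normrM normfV normr_id.
by rewrite mulrC [c / _ * _]mulrAC ler_pM2r ?invr_gt0// H.
Unshelve. all: by end_near. Qed.

(** The combination with coefficients [a - b] is the difference of two remainders, and the one of
    [a] is flat. The estimate is quantitative: an approximation [b] good only up to [c] still
    determines the differential up to [c / kap], which is how covectors found at one scale are
    compared with true differentials. *)
Lemma indepK_uniq n kap (phi : X -> 'cV[R]_n) f x a b c rho : 0 <= c -> 0 < rho ->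
  indepK kap phi x -> flat_at (fun y => f y - lincomb a phi y) x ->
  locLip (fun y => f y - lincomb b phi y) c rho x -> kap * `|a - b| <= c.
Proof.
move=> c0 r0 I fa fb; apply/ler_addgt0Pr => e e0.
have [s s0 fs] := fa _ e0.
apply: (I _ _ (Num.min rho s)); rewrite ?lt_min ?r0 ?s0 ?addr_ge0 ?(ltW e0)//.
move=> y; rewrite lt_min => /andP[yr ys].
have -> : lincomb (a - b) phi y - lincomb (a - b) phi x =
  (f y - lincomb b phi y - (f x - lincomb b phi x)) -
  (f y - lincomb a phi y - (f x - lincomb a phi x)).
  by rewrite lincombB; ring.
by rewrite mulrDl (le_trans (ler_normB _ _))// lerD ?fb ?fs.
Qed.

(** Differentiability with the particular row selected by [partials]; by [flat_diff_at] any witness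
    suffices. *)
Definition diff_at n (phi : X -> 'cV[R]_n) f x : Prop :=
  flat_at (fun y => f y - lincomb (partials phi f x) phi y) x.

Definition indep n (phi : X -> 'cV[R]_n) x : Prop :=
  exists2 kap, 0 < kap & indepK kap phi x.

Lemma flat_diff_at n (phi : X -> 'cV[R]_n) f x a :
  flat_at (fun y => f y - lincomb a phi y) x -> diff_at phi f x.
Proof.
move=> H; apply/differentialP; apply: (@xgetPex _ 0 [set a | is_differential phi f x a]).
by exists a; exact/differentialP.
Qed.

Lemma partials_eq n (phi : X -> 'cV[R]_n) f x a : indep phi x ->
  flat_at (fun y => f y - lincomb a phi y) x -> partials phi f x = a.
Proof.
move=> [k k0 I] H; have H' := flat_diff_at H.
apply/eqP; rewrite -subr_eq0 -normr_eq0 eq_le normr_ge0 andbT.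
rewrite -(ler_pM2l k0) mulr0; apply/ler_addgt0Pr => e e0; rewrite add0r.
have [r r0 Hr] := H _ e0; exact: (indepK_uniq (ltW e0) r0 I H' Hr).
Qed.

Lemma partialsD n (phi : X -> 'cV[R]_n) f g x : indep phi x ->
  diff_at phi f x -> diff_at phi g x ->
  diff_at phi (fun y => f y + g y) x /\
  partials phi (fun y => f y + g y) x = partials phi f x + partials phi g x.
Proof.
move=> I F G; have H : flat_at (fun y => f y + g y -
    lincomb (partials phi f x + partials phi g x) phi y) x.
  have := flatD F G; congr (flat_at _ x); apply/funext => y.
  by rewrite /lincomb pairingDl; ring.
by split; [exact: flat_diff_at H | exact: partials_eq].
Qed.

Lemma partialsZ n (phi : X -> 'cV[R]_n) k f x : indep phi x ->
  diff_at phi f x ->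
  diff_at phi (fun y => k * f y) x /\
  partials phi (fun y => k * f y) x = k *: partials phi f x.
Proof.
move=> I F; have H : flat_at (fun y => k * f y -
    lincomb (k *: partials phi f x) phi y) x.
  have := flatZ k F; congr (flat_at _ x); apply/funext => y.
  by rewrite /lincomb pairingZl; ring.
by split; [exact: flat_diff_at H | exact: partials_eq].
Qed.

Lemma flat_cst (c : R) x : flat_at (fun=> c) x.
Proof.
by move=> e e0; exists 1 => // y _; rewrite subrr normr0 mulr_ge0 ?mdist_ge0 ?ltW.
Qed.

Lemma partials_lincomb n (phi : X -> 'cV[R]_n) a x : indep phi x ->
  diff_at phi (lincomb a phi) x /\ partials phi (lincomb a phi) x = a.
Proof.
move=> I; have H : flat_at (fun y => lincomb a phi y - lincomb a phi y) x.
  by have := flat_cst 0 x; congr (flat_at _ x); apply/funext => y; rewrite subrr.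
by split; [exact: flat_diff_at H | exact: partials_eq].
Qed.

(** Comparison of [f] with the zero covector. For 1-Lipschitz functions it bounds the differential
    by [1 / kap]. *)
Lemma partials_le n kap (phi : X -> 'cV[R]_n) f x c rho : 0 <= c -> 0 < rho ->
  indepK kap phi x -> diff_at phi f x -> locLip f c rho x ->
  kap * `|partials phi f x| <= c.
Proof.
move=> c0 r0 I D F; rewrite -[partials _ _ _]subr0.
apply: (indepK_uniq c0 r0 I D) => y xy.
by rewrite /lincomb !pairing0l !subr0 F.
Qed.

Lemma partials_flatB n (phi : X -> 'cV[R]_n) f g x : indep phi x ->
  diff_at phi f x -> flat_at (fun y => g y - f y) x ->
  diff_at phi g x /\ partials phi g x = partials phi f x.
Proof.
move=> I F gf; have H : flat_at (fun y => g y - lincomb (partials phi f x) phi y) x.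
  by have := flatD gf F; congr (flat_at _ x); apply/funext => y; ring.
by split; [exact: flat_diff_at H | exact: partials_eq].
Qed.

Lemma partials_chain m n L (phi : X -> 'cV[R]_m) (psi : X -> 'cV[R]_n) f x :
  map_lipschitz L psi -> indep phi x ->
  (forall j, diff_at phi (fun y => psi y j 0) x) -> diff_at psi f x ->
  let T := \matrix_(j, i) partials phi (fun y => psi y j 0) x 0 i in
  diff_at phi f x /\ partials phi f x = partials psi f x *m T.
Proof.
move=> psiL I psiD F T; set b := partials psi f x.
have H0 (s : seq 'I_n) : flat_at (fun y =>
    \sum_(j <- s) (b 0 j * (psi y j 0 - lincomb (partials phi (fun y => psi y j 0) x) phi y))) x.
  elim: s => [|j s IHs].
    by have := flat_cst 0 x; congr (flat_at _ x); apply/funext => y; rewrite big_nil.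
  have := flatD (flatZ (b 0 j) (psiD j)) IHs.
  by congr (flat_at _ x); apply/funext => y; rewrite big_cons.
have H : flat_at (fun y => f y - lincomb (b *m T) phi y) x.
  have := flatD F (H0 (index_enum _)); congr (flat_at _ x); apply/funext => y.
  rewrite -/b -addrA; congr (_ + _).
  under eq_bigr do rewrite mulrBr.
  rewrite big_split/= sumrN /lincomb -/(pairing b (psi y)) addKr; congr (- _).
  rewrite pairing_mulmx /pairing; apply: eq_bigr => j _; congr (_ * _).
  by rewrite !mxE; apply: eq_bigr => i _; rewrite !mxE.
by split; [exact: flat_diff_at H | exact: partials_eq].
Qed.

End chart_calculus.

(** * Borel sets described by local Lipschitz conditions *)

Section borel_sets.
Context {R : realType} {X : completePMetricType R}.
Implicit Types (x y : X) (f g : X -> R).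

Lemma open_borel (V : set X) : open V -> measurable (V : set (borel X)).
Proof. exact: sub_sigma_algebra. Qed.

Lemma closed_borel (V : set X) : closed V -> measurable (V : set (borel X)).
Proof.
by move=> cV; rewrite -[V]setCK; apply: measurableC; apply: open_borel; exact/closed_openC.
Qed.

Lemma lipschitz_continuous f : lipschitz_fun f -> continuous f.
Proof.
move=> [k fk] x; apply/(@cvgrPdist_le _ _ _ _ (nbhs_filter x)) => e e0.
have k1 : 0 < `|k| + 1 by rewrite ltr_wpDl.
apply/nbhs_ballP; exists (e / (`|k| + 1)); first by rewrite /= divr_gt0.
move=> y; rewrite ballEmdist/= => xy; rewrite (le_trans (fk _ _))//.
rewrite (@le_trans _ _ ((`|k| + 1) * mdist x y))//.
  by rewrite ler_wpM2r ?mdist_ge0// (le_trans (ler_norm _))// lerDl.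
by rewrite mulrC -ler_pdivlMr// ltW.
Qed.

Lemma mdist_lipschitz y : lipschitz_with 1 (fun x => mdist x y).
Proof.
move=> x z; have := metric_triangle x z y; have := metric_triangle z x y.
rewrite [mdist z x]metric_sym mul1r ler_norml => H1 H2.
by apply/andP; split; lra.
Qed.

Lemma mdist_continuous y : continuous (fun x => mdist x y).
Proof. by apply: lipschitz_continuous; exists 1; exact: mdist_lipschitz. Qed.

Lemma open_lt_fun f g : continuous f -> continuous g -> open [set x | f x < g x].
Proof.
move=> cf cg.
have -> : [set x | f x < g x] = (fun x => g x - f x) @^-1` [set r | 0 < r].
  by apply/seteqP; split=> x /=; rewrite subr_gt0.
by apply: open_comp; [move=> x _; apply: cvgB; [exact: cg|exact: cf] | exact: open_gt].
Qed.

Lemma not_locLipP g c rho x :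
  ~ locLip g c rho x <-> exists2 y, mdist x y < rho & c * mdist x y < `|g y - g x|.
Proof.
split=> [/existsNP[y /not_implyP[xy /negP]]|[y xy H] /(_ _ xy)].
  by rewrite -ltNge; exists y.
by rewrite leNgt H.
Qed.

(** For fixed [y] every condition is strict and continuous in [x], so the set is a union of open
    sets over [y]. *)
Lemma open_annulus g c (rho' rho : R) : lipschitz_fun g ->
  open [set x | exists y, [/\ rho' < mdist x y, mdist x y < rho &
                           c * mdist x y < `|g y - g x|]].
Proof.
move=> lg; have -> : [set x | exists y, [/\ rho' < mdist x y, mdist x y < rho &
                           c * mdist x y < `|g y - g x|]] =
  \bigcup_y ([set x | rho' < mdist x y] `&` [set x | mdist x y < rho] `&`
             [set x | c * mdist x y < `|g y - g x|]).
  apply/seteqP; split=> [x [y [? ? ?]]|x [y _ [[? ?] ?]]]; first by exists y.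
  by exists y.
apply: bigcup_open => y _; apply: openI; first apply: openI.
- by apply: open_lt_fun; [move=> ?; exact: cvg_cst | exact: mdist_continuous].
- by apply: open_lt_fun; [exact: mdist_continuous | move=> ?; exact: cvg_cst].
apply: open_lt_fun => x.
  by apply: cvgMl_tmp; exact: mdist_continuous.
by apply: cvg_norm; apply: cvgB; [exact: cvg_cst | exact: lipschitz_continuous].
Qed.

Lemma closed_locLip g c rho : lipschitz_fun g -> closed [set x | locLip g c rho x].
Proof.
move=> lg; rewrite -[X in closed X]setCK; apply: open_closedC.
(* The inner radius [-1] imposes nothing, which turns the annulus into a ball. *)
have -> : ~` [set x | locLip g c rho x] =
    [set x | exists y, [/\ -1 < mdist x y, mdist x y < rho &
                           c * mdist x y < `|g y - g x|]].
  apply/seteqP; split=> x; first by move=> /not_locLipP[y xy H]; exists y; split=> //; rewrite (lt_le_trans _ (mdist_ge0 _ _)).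
  by move=> [y [_ xy H]]; apply/not_locLipP; exists y.
exact: open_annulus.
Qed.

Lemma lipschitz_funD f g : lipschitz_fun f -> lipschitz_fun g ->
  lipschitz_fun (fun x => f x + g x).
Proof.
move=> [k fk] [l gl]; exists (k + l) => x y.
by rewrite opprD addrACA mulrDl (le_trans (ler_normD _ _))// lerD.
Qed.

Lemma lipschitz_funZ k f : lipschitz_fun f -> lipschitz_fun (fun x => k * f x).
Proof.
move=> [l fl]; exists (`|k| * l) => x y.
by rewrite -mulrBr normrM -mulrA ler_wpM2l.
Qed.

Lemma lipschitz_funB f g : lipschitz_fun f -> lipschitz_fun g ->
  lipschitz_fun (fun x => f x - g x).
Proof.
move=> lf lg; have := lipschitz_funD lf (lipschitz_funZ (-1) lg).
by congr lipschitz_fun; apply/funext => x; rewrite mulN1r.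
Qed.

Lemma lipschitz_fun_lincomb n L (phi : X -> 'cV[R]_n) a :
  map_lipschitz L phi -> lipschitz_fun (lincomb a phi).
Proof. by move=> H; eexists; exact: lincomb_lipschitz H. Qed.

Lemma rat_row_dense n (a : 'rV[R]_n) e : 0 < e ->
  exists q : 'rV[rat]_n, `|a - map_mx ratr q| <= e.
Proof.
move=> e0.
have H i : exists q : rat, `|a 0 i - ratr q| <= e.
  have [|q] := @rat_in_itvoo R (a 0 i) (a 0 i + e); first by rewrite ltrDl.
  rewrite in_itv/= => /andP[q1 q2]; exists q.
  by rewrite ler_norml; apply/andP; split; lra.
have [q qP] := choice H; exists (\row_i q i).
apply: mx_norm_leP; first exact: ltW.
by move=> i j; rewrite !mxE ord1.
Qed.

Lemma rat_col_dense n (v : 'cV[R]_n) e : 0 < e ->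
  exists q : 'cV[rat]_n, `|v - map_mx ratr q| <= e.
Proof.
move=> e0; have [q qP] := rat_row_dense v^T e0; exists q^T.
apply: mx_norm_leP => [|i j]; first exact: ltW.
rewrite ord1 (le_trans _ qP)// (le_trans _ (mx_norm_coord _ 0 i))//.
by rewrite !mxE.
Qed.

Lemma inv_nat_lt (e : R) : 0 < e -> exists m : nat, m.+1%:R^-1 < e.
Proof.
move=> e0; have [m _ /(_ m (leqnn m))] := near_infty_natSinv_lt (PosNum e0).
by exists m.
Qed.

Lemma borel_ex (I : countType) (P : I -> set X) :
  (forall i, measurable (P i : set (borel X))) ->
  measurable ([set x | exists i, P i x] : set (borel X)).
Proof.
move=> mP; have -> : [set x | exists i, P i x] = \bigcup_i P i.
  by apply/seteqP; split=> [x [i Pi]|x [i _ Pi]]; exists i.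
by apply: countable_bigcupT_measurable => //; exact: countableP.
Qed.

Lemma borel_all (I : countType) (P : I -> set X) :
  (forall i, measurable (P i : set (borel X))) ->
  measurable ([set x | forall i, P i x] : set (borel X)).
Proof.
move=> mP; have -> : [set x | forall i, P i x] = ~` [set x | exists i, (~` P i) x].
  apply/seteqP; split=> [x Px|x Px i]; first by move=> [i nP]; apply: nP; exact: Px.
  by case: (pselect (P i x)) => // nP; exfalso; apply: Px; exists i.
by apply: measurableC; apply: borel_ex => i; exact: measurableC.
Qed.

Lemma borel_and (b : bool) (P : set X) : measurable (P : set (borel X)) ->
  measurable ([set x | b -> P x] : set (borel X)).
Proof.
move=> mP; case: b.
  by rewrite (_ : mkset _ = P)//; apply/seteqP; split=> x Px; [exact: Px|move=> _].
by rewrite (_ : mkset _ = setT)//; apply/seteqP; split=> x.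
Qed.

(** A Borel substitute for [indepK kap phi]: only rational rows and radii [1 / (m + 1)] are tested.
    For a Lipschitz map and positive [kap] it implies [indepK kap phi], and it follows from [indepK]
    with a larger constant. *)
Definition indep_set n (phi : X -> 'cV[R]_n) (kap : R) : set X :=
  [set x | forall (q : 'rV[rat]_n) (m : nat), q != 0 ->
    ~ locLip (lincomb (map_mx ratr q) phi)
        (kap * `|map_mx ratr q : 'rV[R]_n|) m.+1%:R^-1 x].

Lemma measurable_indep_set n L (phi : X -> 'cV[R]_n) kap :
  map_lipschitz L phi -> measurable (indep_set phi kap : set (borel X)).
Proof.
move=> phiL; apply: borel_all => q; apply: borel_all => m; apply: borel_and.
apply: measurableC; apply: closed_borel.
by apply: closed_locLip; exact: lipschitz_fun_lincomb phiL.
Qed.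

Lemma map_ratr_eq0 n (q : 'rV[rat]_n) : ((map_mx ratr q : 'rV[R]_n) == 0) = (q == 0).
Proof.
apply/eqP/eqP => [/rowP H|->]; last by apply/rowP => i; rewrite !mxE raddf0.
by apply/rowP => i; have /eqP := H i; rewrite !mxE fmorph_eq0 => /eqP.
Qed.

Lemma indep_set_indepK n L (phi : X -> 'cV[R]_n) kap x : 0 < kap -> 0 < L ->
  map_lipschitz L phi -> indep_set phi kap x -> indepK kap phi x.
Proof.
move=> k0 L0 phiL I a c rho c0 rho0 H; apply/ler_addgt0Pr => e e0.
have Lk : 0 < L + kap by rewrite addr_gt0.
have [q qa] := rat_row_dense a (divr_gt0 e0 Lk).
move: qa; rewrite ler_pdivlMr// => qa.
set b : 'rV[R]_n := map_mx ratr q in qa *.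
have ab : `|a| <= `|b| + `|a - b|.
  by rewrite -[X in `|X| <= _](subrK b) addrC ler_normD.
have [q0|qN0] := eqVneq q 0.
  have b0 : b = 0 by apply/eqP; rewrite map_ratr_eq0 q0.
  move: qa; rewrite b0 subr0 mulrDr mulrC [`|a| * kap]mulrC.
  by have := normr_ge0 a; nra.
have [m mr] := inv_nat_lt rho0.
have /not_locLipP[y yr] := I _ m qN0.
rewrite -/b => Hy.
have := phiL (a - b) x y; rewrite pairingBr -!/(lincomb _ _ _) lincombB => H1.
have {H} := H y (lt_trans yr mr).
have := mdist_ge0 x y; set d := mdist x y in Hy H1 *.
set u := lincomb a phi y - _; move: Hy H1; set v := lincomb b phi y - _.
rewrite -/u => Hy H1 d0 Hu.
have H3 : `|v| <= (c + L * `|a - b|) * d.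
  have : `|v| <= `|u| + `|u - v|.
    by rewrite -[X in `|X| <= _](subKr u) ler_normB.
  by rewrite mulrDl; lra.
have d1 : 0 < d.
  rewrite lt_neqAle d0 andbT; apply/eqP => dE.
  by move: Hy; rewrite -dE mulr0 normr_gt0 => v0; move: H3; rewrite -dE mulr0 normr_le0 (negbTE v0).
have : kap * `|b| < c + L * `|a - b|.
  by rewrite -(ltr_pM2r d1) (lt_le_trans Hy).
have := ler_wpM2l (ltW k0) ab; rewrite mulrDr.
by move: qa; rewrite mulrDr ![`|a - b| * _]mulrC; lra.
Qed.

Lemma indep_indep_set n (phi : X -> 'cV[R]_n) x : indep phi x ->
  exists m : nat, indep_set phi m.+1%:R^-1 x.
Proof.
move=> [kap k0 I]; have [m mk] := inv_nat_lt k0; exists m => q p q0 H.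
have b0 : 0 < `|map_mx ratr q : 'rV[R]_n| by rewrite normr_gt0 map_ratr_eq0.
have c0 : 0 <= m.+1%:R^-1 * `|map_mx ratr q : 'rV[R]_n| by rewrite mulr_ge0// ltW.
have p0 : 0 < (p.+1%:R^-1 : R) by rewrite invr_gt0.
by have := I _ _ _ c0 p0 H; rewrite ler_pM2r// leNgt mk.
Qed.

End borel_sets.

(** * Existence and measurability of differentials in a chart *)

Section chart_measurability.
Context {R : realType} {X : completePMetricType R}.
Variable mu : {measure set (borel X) -> \bar R}.
Implicit Types (f g : X -> R).

(* [filterS] does not apply to predicates on [X], since the filter lives on the
   alias [borel X]. *)
Lemma ae_S (P Q : X -> Prop) : (forall x, P x -> Q x) ->
  (\forall x \ae mu, P x) -> \forall x \ae mu, Q x.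
Proof. by move=> PQ; exact: (@filterS _ _ (ae_filter_ringOfSetsType mu)). Qed.

Lemma ae_S2 (P Q S : X -> Prop) : (forall x, P x -> Q x -> S x) ->
  (\forall x \ae mu, P x) -> (\forall x \ae mu, Q x) -> \forall x \ae mu, S x.
Proof. by move=> PQ; exact: (@filterS2 _ _ (ae_filter_ringOfSetsType mu)). Qed.

Lemma ae_S3 (P Q S T : X -> Prop) : (forall x, P x -> Q x -> S x -> T x) ->
  (\forall x \ae mu, P x) -> (\forall x \ae mu, Q x) -> (\forall x \ae mu, S x) ->
  \forall x \ae mu, T x.
Proof. by move=> PQ; exact: (@filterS3 _ _ (ae_filter_ringOfSetsType mu)). Qed.

Lemma ae_all (I : countType) (P : I -> X -> Prop) :
  (forall i, \forall x \ae mu, P i x) -> \forall x \ae mu, forall i, P i x.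
Proof.
move=> aP; have H : \forall x \ae mu, forall k : nat,
    if (unpickle k : option I) is Some i then P i x else True.
  by apply: ae_foralln => k; case: unpickle => [i|]; [exact: aP|exact: aeW].
by apply: ae_S H => x Hx i; have := Hx (pickle i); rewrite pickleK.
Qed.

Lemma negligible_ae (P : X -> Prop) :
  (\forall x \ae mu, P x) -> exists2 N : set (borel X), measurable N /\ mu N = 0%E &
    forall x, ~ N x -> P x.
Proof.
by move=> [N [mN N0 H]]; exists N => // x Nx; apply: contrapT => Px; apply/Nx/H.
Qed.

Lemma borel_and3 (b : bool) (P Q : set X) :
  measurable (P : set (borel X)) -> measurable (Q : set (borel X)) ->
  measurable ([set x | [/\ P x, b & Q x]] : set (borel X)).
Proof.
move=> mP mQ; case: b.
  have -> : [set x | [/\ P x, true & Q x]] = P `&` Q.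
    by apply/seteqP; split=> x [].
  exact: measurableI.
by have -> : [set x | [/\ P x, false & Q x]] = set0 by apply/seteqP; split=> x [].
Qed.

Section one_chart.
Context (n : nat) (U : set X) (phi : X -> 'cV[R]_n).
Hypothesis chart : is_chart mu U phi.

Lemma chart_lipschitz : exists2 L, 0 < L & map_lipschitz L phi.
Proof. by case: chart => _ _ /map_lipschitzP. Qed.

Lemma ae_indep : \forall x \ae mu, U x -> indep phi x.
Proof.
have [L _ phiL] := chart_lipschitz.
case: chart => _ _ _ + _; apply: ae_S => x H Ux.
exact: independent_indepK phiL (H Ux).
Qed.

(** A dependence between [phi] and [f] has a nonzero coefficient [c] on [f], since otherwise [phi]
    itself would be dependent; solving for [f] gives the differential [- c^-1 *: b]. *)
Lemma ae_diff_at f : lipschitz_fun f ->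
  \forall x \ae mu, U x -> indep phi x /\ diff_at phi f x.
Proof.
move=> lf; case: chart => _ _ _ _ /(_ _ lf) H; apply: ae_S2 ae_indep H => x + + Ux.
move=> /(_ Ux) I /(_ Ux)[a aN0 /Lip0P fa]; split=> //.
pose b := lsubmx a; pose c := a 0 (rshift n ord0).
have E y : lincomb a (adjoin phi f) y = lincomb b phi y + c * f y.
  rewrite /lincomb /adjoin /pairing big_split_ord/= big_ord1; congr (_ + _).
    by apply: eq_bigr => i _; rewrite col_mxEu mxE.
  by rewrite col_mxEd mxE mulr1n.
have fl : flat_at (fun y => lincomb b phi y + c * f y) x.
  by move: fa; congr (flat_at _ x); apply/funext.
have cN0 : c != 0.
  apply/eqP => c0; have [k k0 Ik] := I.
  have {}fl : flat_at (lincomb b phi) x.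
    by move: fl; congr (flat_at _ x); apply/funext => y; rewrite c0 mul0r addr0.
  have b0 : b = 0.
    apply/eqP; rewrite -normr_eq0 eq_le normr_ge0 andbT -(ler_pM2l k0) mulr0.
    apply/ler_addgt0Pr => e e0; rewrite add0r.
    by have [r r0 Hr] := fl _ e0; apply: Ik Hr => //; exact: ltW.
  move/eqP: aN0; apply; apply/rowP => i; rewrite mxE; case: (split_ordP i) => j ->.
    by have /rowP/(_ j) := b0; rewrite !mxE.
  by rewrite ord1.
apply: (@flat_diff_at _ _ _ _ _ _ (- c^-1 *: b)).
have := flatZ c^-1 fl; congr (flat_at _ x); apply/funext => y.
by rewrite /lincomb pairingZl; field.
Qed.

(* Whether a partial derivative exceeds [c] is decided by countably many affine
   approximations, because a chart is quantitatively independent. *)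
Lemma partials_gtP f L m c i x : 0 < L -> map_lipschitz L phi ->
  indep_set phi m.+1%:R^-1 x -> diff_at phi f x ->
  (c < partials phi f x 0 i <-> exists (q : 'rV[rat]_n) (j k : nat),
    [/\ c < (map_mx ratr q : 'rV[R]_n) 0 i - m.+1%:R / j.+1%:R &
     locLip (fun y => f y - lincomb (map_mx ratr q) phi y) j.+1%:R^-1 k.+1%:R^-1 x]).
Proof.
move=> L0 phiL Im D; have m0 : 0 < (m.+1%:R^-1 : R) by rewrite invr_gt0.
have I := indep_set_indepK m0 L0 phiL Im.
split=> [ci|[q [j [k [cq Hq]]]]]; last first.
  (* An affine approximation up to [1 / (j + 1)] fixes the row up to [(m + 1) / (j + 1)], the
     independence constant being [1 / (m + 1)]. *)
  have := indepK_uniq _ _ I D Hq; rewrite !invr_ge0 !invr_gt0 => /(_ (ler0n _ _) (ltr0Sn _ _)).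
  rewrite mulrC ler_pdivrMr// [j.+1%:R^-1 * _]mulrC => H.
  have := le_trans (mx_norm_coord _ 0 i) H; rewrite !mxE ler_norml => /andP[H1 H2].
  by move: cq H1; rewrite !mxE; move: (_ / _) => t cq H1; lra.
set d := partials phi f x 0 i - c; have d0 : 0 < d by rewrite subr_gt0.
(* Half of the excess [d] pays for the error [(m + 1) / (j + 1)], the other half for rounding the
   row. *)
have e0 : 0 < d / (2 * m.+1%:R) by rewrite divr_gt0// mulr_gt0.
have [j je] := inv_nat_lt e0.
have j0 : 0 < (j.+1%:R^-1 : R) by rewrite invr_gt0.
have j20 : 0 < (j.+1%:R^-1 / 2 : R) by rewrite divr_gt0.
(* The second bound keeps the effect of rounding on the local Lipschitz constant below half of
   [1 / (j + 1)]. *)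
have t0 : 0 < Num.min (d / 2) (j.+1%:R^-1 / 2 / L).
  by rewrite lt_min !divr_gt0.
have [q qP] := rat_row_dense (partials phi f x) t0.
have [r r0 Hr] := D _ j20; have [k kr] := inv_nat_lt r0.
exists q, j, k; split.
  have := le_trans (mx_norm_coord _ 0 i) qP; rewrite le_min => /andP[+ _].
  rewrite !mxE ler_norml => /andP[_ H].
  have : m.+1%:R / j.+1%:R < d / 2.
    by move: je; rewrite invfM mulrA ltr_pdivlMr// mulrC.
  by rewrite /d in H *; move: (m.+1%:R / _) => t; lra.
move=> y xy.
have -> : f y - lincomb (map_mx ratr q) phi y - (f x - lincomb (map_mx ratr q) phi x) =
  (f y - lincomb (partials phi f x) phi y - (f x - lincomb (partials phi f x) phi x)) +
  (lincomb (partials phi f x - map_mx ratr q) phi y - lincomb (partials phi f x - map_mx ratr q) phi x).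
  by rewrite lincombB; ring.
rewrite (le_trans (ler_normD _ _))// [X in _ <= X * _]splitr mulrDl lerD//.
  by apply: Hr; exact: lt_trans kr.
rewrite /lincomb -pairingBr (le_trans (phiL _ _ _))// ler_wpM2r ?mdist_ge0//.
by move: qP; rewrite le_min => /andP[_]; rewrite ler_pdivlMr// mulrC.
Qed.

(** The values of [partials] are controlled only where the differential exists and is unique, so
    they are kept on [G], which is [U] without a Borel null set, and replaced by 0 elsewhere. The
    superlevel sets are then given by [partials_gtP]. *)
Lemma measurable_partials f : lipschitz_fun f ->
  exists2 D : X -> 'rV[R]_n,
    forall i, measurable_fun setT (fun x : borel X => D x 0 i) &
    \forall x \ae mu, U x -> [/\ indep phi x, diff_at phi f x & partials phi f x = D x].
Proof.
move=> lf; have [L L0 phiL] := chart_lipschitz.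
have mU : measurable (U : set (borel X)) by case: chart => _ [].
have [N [mN N0] NP] := negligible_ae (ae_diff_at lf).
pose G := U `\` N; have mG : measurable (G : set (borel X)) by exact: measurableD.
have GP x : G x -> indep phi x /\ diff_at phi f x by move=> [Ux /NP]; exact.
exists (fun x => if x \in G then partials phi f x else 0); last first.
  have : \forall x \ae mu, ~ N x by exists N; split=> // x /= /contrapT.
  apply: ae_S => x Nx Ux; have Gx : G x by [].
  by have [? ?] := GP _ Gx; rewrite mem_set.
move=> i; apply: (measurability _ (RGenOInfty.measurableE R)).
move=> _ [_ [c ->] <-]; rewrite setTI.
pose T := [set x | exists (m : nat) (q : 'rV[rat]_n) (j k : nat),
   [/\ indep_set phi m.+1%:R^-1 x, c < (map_mx ratr q : 'rV[R]_n) 0 i - m.+1%:R / j.+1%:R &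
     locLip (fun y => f y - lincomb (map_mx ratr q) phi y) j.+1%:R^-1 k.+1%:R^-1 x]].
have mT : measurable (T : set (borel X)).
  apply: borel_ex => m; apply: borel_ex => q; apply: borel_ex => j; apply: borel_ex => k.
  apply: (@borel_and3 _ (indep_set phi m.+1%:R^-1)
     (locLip (fun y => f y - lincomb (map_mx ratr q) phi y) j.+1%:R^-1 k.+1%:R^-1)).
    exact: measurable_indep_set phiL.
  apply: closed_borel; apply: closed_locLip; apply: lipschitz_funB => //.
  exact: lipschitz_fun_lincomb phiL.
have -> : (fun x : X => (if x \in G then partials phi f x else 0) 0 i) @^-1` `]c, +oo[%classic =
    (G `&` T) `|` (if c < 0 then ~` G else set0).
  apply/seteqP; split=> [x|x [[Gx Tx]|]] /=; rewrite in_itv/= andbT.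
  - case: ifPn => [/set_mem Gx ci|/negP Gx].
      left; split=> //; have [I D] := GP _ Gx.
      have [m Im] := indep_indep_set I.
      by have [/(_ ci)[q [j [k [? ?]]]] _] := partials_gtP c i L0 phiL Im D; exists m, q, j, k.
    by rewrite mxE => ->; right => Gx'; apply: Gx; exact: mem_set.
  - rewrite mem_set//; have [I D] := GP _ Gx.
    case: Tx => m [q [j [k [Im cq Hq]]]].
    by have [_ ->//] := partials_gtP c i L0 phiL Im D; exists q, j, k.
  - by case: ifPn => // c0 /= nG; rewrite memNset// mxE.
apply: measurableU; first exact: measurableI.
by case: ifP => // _; exact: measurableC.
Qed.

End one_chart.
End chart_measurability.

(** * Scales at which a function is affine and covectors are visible *)

Section scales.
Context {R : realType} {X : completePMetricType R}.
Variable mu : {measure set (borel X) -> \bar R}.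
Implicit Types (f g H : X -> R).

(** A grid of mesh [1 / (m + 1)] in the cube, which is the unit ball of the maximum norm. It leaves
    finitely many directions to test, hence one positive inner radius for all of them. *)
Lemma unit_ball_net n (th : R) : 0 < th -> exists s : seq 'rV[R]_n,
  forall a, `|a| <= 1 -> exists2 i : 'I_(size s), True & `|a - nth 0 s i| <= th.
Proof.
move=> th0; have [m mth] := inv_nat_lt th0.
have M0 : 0 < m.+1%:R :> R by [].
pose row (F : {ffun 'I_n -> 'I_(2 * m.+1).+1}) : 'rV[R]_n :=
  \row_i ((F i : nat)%:R / m.+1%:R - 1).
exists [seq row F | F <- enum {: {ffun 'I_n -> 'I_(2 * m.+1).+1}}] => a a1.
have aP i : -1 <= a 0 i <= 1 by rewrite -ler_norml (le_trans (mx_norm_coord _ _ _)).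
pose t i := Num.truncn ((a 0 i + 1) * m.+1%:R).
have tP i : (t i)%:R <= (a 0 i + 1) * m.+1%:R < (t i).+1%:R.
  by apply: truncn_itv; rewrite mulr_ge0//; have /andP[] := aP i; lra.
have tlt i : (t i < (2 * m.+1).+1)%N.
  rewrite ltnS -(ler_nat R); have /andP[/le_trans -> //] := tP i.
  by rewrite natrM ler_pM2r//; have /andP[] := aP i; lra.
pose F := [ffun i => Ordinal (tlt i)].
have Fs : row F \in [seq row F | F <- enum {: {ffun 'I_n -> 'I_(2 * m.+1).+1}}].
  by apply: map_f; rewrite mem_enum.
have idx := Fs; rewrite -index_mem in idx.
exists (Ordinal idx) => //; rewrite nth_index//.
apply: mx_norm_leP => [|k i]; first exact: ltW.
rewrite ord1 !mxE ffunE/= (le_trans _ (ltW mth))//.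
have /andP[t1 t2] := tP i.
have -> : a 0 i - ((t i)%:R / m.+1%:R - 1) = ((a 0 i + 1) * m.+1%:R - (t i)%:R) / m.+1%:R.
  by rewrite mulrBl mulfK ?gt_eqF//; move: (_ / _) => ?; ring.
rewrite normrM ger0_norm ?subr_ge0// gtr0_norm ?invr_gt0//.
by rewrite ler_pdivrMr// mulVf ?gt_eqF// lerBlDr [1 + _]addrC natr1 ltW.
Qed.

(** Continuity of the measure from above. It turns a scale depending on the point into a single
    scale valid outside a set of small measure. *)
Lemma exhaust (K : set (borel X)) (A : nat -> set (borel X)) (d : R) :
  measurable K -> (mu K < +oo)%E -> (forall m, measurable (A m)) ->
  (forall m, A m `<=` A m.+1) -> (\forall x \ae mu, K x -> exists m, A m x) ->
  0 < d -> exists m, (mu (K `\` A m) < d%:E)%E.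
Proof.
move=> mK Kfin mA Amono KA d0.
have AmonoS : {homo A : m p / (m <= p)%N >-> m `<=` p}.
  by move=> m p; apply: (homo_leq (@subset_refl _) (@subset_trans _) Amono).
have mB m : measurable (K `\` A m) by exact: measurableD.
have cv : (mu \o (fun m => K `\` A m)) x @[x --> \oo] --> mu (\bigcap_m (K `\` A m)).
  apply: nonincreasing_cvg_mu => //.
  - by rewrite (le_lt_trans _ Kfin)// le_measure ?inE// => x [].
  - exact: bigcapT_measurable.
  - by move=> m p mp; apply/subsetPset => x [Kx nA]; split=> // /(AmonoS _ _ mp).
have z : mu (\bigcap_m (K `\` A m)) = 0%E.
  apply: (measure_negligible _ _); first exact: bigcapT_measurable.
  apply: negligibleS KA => x /= H; have [Kx _] := H 0 I.
  by move=> /(_ Kx)[m Am]; have [_] := H m I.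
move: cv; rewrite z => /fine_cvgP[Bfin] /cvgrPdist_lt/(_ _ d0) B.
have [m _ /(_ m (leqnn m))] := filterI Bfin B.
move=> [/= mfin]; rewrite sub0r normrN ger0_norm ?fine_ge0// => md.
by exists m; rewrite -(fineK mfin) lte_fin.
Qed.

Section one_chart.
Context (n : nat) (U : set X) (phi : X -> 'cV[R]_n).
Hypothesis chart : is_chart mu U phi.

(** Perturbations of size [eps * rho'] cannot hide the differential of [H], because every covector
    is visible at some distance above [rho']. The outer bound is [rho / 2] because [y] will be moved
    to a point [z] with [mdist x z <= 2 * mdist x y], which must stay in the range where [H] is
    almost affine. *)
Definition good_scale (kap : R) H (eps rho' rho : R) (x : X) : Prop :=
  (exists b, locLip (fun y => H y - lincomb b phi y) eps rho x) /\
  (forall b, b != 0 -> exists y, [/\ rho' < mdist x y, mdist x y < rho / 2 &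
     kap / 2 * `|b| * mdist x y <= `|lincomb b phi y - lincomb b phi x|]).

(** Almost everywhere differentiability made uniform. Half of [eps] goes to the remainder and half
    to the use of rational covectors, which makes the sets [A m] Borel. *)
Lemma affine_scale (K : set (borel X)) H (eps d rho0 : R) :
  measurable K -> (mu K < +oo)%E -> K `<=` U -> lipschitz_fun H ->
  0 < eps -> 0 < d -> 0 < rho0 ->
  exists rho, exists Z : set (borel X), [/\ 0 < rho <= rho0, measurable Z, (mu Z < d%:E)%E &
    forall x, K x -> ~ Z x -> exists b, locLip (fun y => H y - lincomb b phi y) eps rho x].
Proof.
move=> mK Kfin KU lH e0 d0 r0; have [L L0 phiL] := chart_lipschitz chart.
pose r (m : nat) : R := Num.min m.+1%:R^-1 rho0.
pose A (m : nat) : set (borel X) :=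
  [set x | exists q : 'rV[rat]_n, locLip (fun y => H y - lincomb (map_mx ratr q) phi y) eps (r m) x].
have mA m : measurable (A m).
  apply: borel_ex => q; apply: closed_borel; apply: closed_locLip; apply: lipschitz_funB => //.
  exact: lipschitz_fun_lincomb phiL.
have [||m mm] := exhaust mK Kfin mA _ _ d0.
- move=> m x [q Hq]; exists q; apply: locLip_le Hq => //.
  rewrite /r le_min !ge_min lexx orbT andbT; apply/orP; left.
  by rewrite lef_pV2 ?posrE// ler_nat.
- apply: ae_S (ae_diff_at chart lH) => x + Kx => /(_ (KU _ Kx))[I D].
  have e20 : 0 < eps / 2 by rewrite divr_gt0.
  have [s s0 Hs] := D _ e20.
  have [q qP] := rat_row_dense (partials phi H x) (divr_gt0 e20 L0).
  have [m ms] := inv_nat_lt s0; exists m, q => y xy.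
  have -> : H y - lincomb (map_mx ratr q) phi y - (H x - lincomb (map_mx ratr q) phi x) =
  (H y - lincomb (partials phi H x) phi y - (H x - lincomb (partials phi H x) phi x)) +
  (lincomb (partials phi H x - map_mx ratr q) phi y - lincomb (partials phi H x - map_mx ratr q) phi x).
    by rewrite lincombB; ring.
  rewrite (le_trans (ler_normD _ _))// [X in _ <= X * _]splitr mulrDl lerD//.
    by apply: Hs; rewrite (lt_le_trans xy)// /r ge_min (ltW ms).
  rewrite /lincomb -pairingBr (le_trans (phiL _ _ _))// ler_wpM2r ?mdist_ge0//.
  by move: qP; rewrite ler_pdivlMr// mulrC.
- exists (r m), (K `\` A m); split=> //.
  + by rewrite /r lt_min invr_gt0 r0 ltr0Sn ge_min lexx orbT.
  + exact: measurableD.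
  + move=> x Kx nZ; have : A m x by apply: contrapT => nA; apply: nZ.
    by move=> [q Hq]; eexists; exact: Hq.
Qed.

(** Independence yields for each direction a detecting point at some positive distance. A finite net
    of directions makes the inner radius uniform in [b], and exhaustion makes it uniform in [x]. *)
Lemma detecting_scale kap (K : set (borel X)) (d rho : R) : 0 < kap ->
  measurable K -> (mu K < +oo)%E -> (forall x, K x -> indepK kap phi x) ->
  0 < d -> 0 < rho ->
  exists rho', exists Z : set (borel X), [/\ 0 < rho' < rho, measurable Z, (mu Z < d%:E)%E &
    forall x, K x -> ~ Z x -> forall b, b != 0 -> exists y, [/\ rho' < mdist x y, mdist x y < rho &
     kap / 2 * `|b| * mdist x y <= `|lincomb b phi y - lincomb b phi x|]].
Proof.
move=> k0 mK Kfin KI d0 r0; have [L L0 phiL] := chart_lipschitz chart.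
have Lk0 : 0 < L + kap by rewrite addr_gt0.
(* The bound [1 / 2] keeps the net vector nonzero. The other one limits the loss, [L] from moving
   the covector and at most [kap] from the change of its norm, to [kap / 4], so that [3 / 4 * kap]
   drops to no less than [kap / 2]. *)
have th0 : 0 < Num.min (1 / 2) (kap / (4 * (L + kap))).
  by rewrite lt_min !divr_gt0// mulr_gt0.
have [s sP] := @unit_ball_net n _ th0.
pose A (m : nat) : set (borel X) :=
  [set x | forall i : 'I_(size s), nth 0 s i != 0 -> exists y, [/\ m.+1%:R^-1 < mdist x y, mdist x y < rho &
     (3 / 4 * kap * `|nth 0 s i|) * mdist x y < `|lincomb (nth 0 s i) phi y - lincomb (nth 0 s i) phi x|]].
have mA m : measurable (A m).
  apply: borel_all => i; apply: borel_and; apply: open_borel; apply: open_annulus.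
  exact: lipschitz_fun_lincomb phiL.
have Amono m : A m `<=` A m.+1.
  move=> x Ax i /(Ax i)[y [y1 y2 y3]]; exists y; split=> //.
  by rewrite (le_lt_trans _ y1)// lef_pV2 ?posrE// ler_nat.
have KA x : K x -> exists m, A m x.
  move=> Kx.
  have H (i : 'I_(size s)) : exists m : nat, nth 0 s i != 0 -> exists y, [/\ m.+1%:R^-1 < mdist x y, mdist x y < rho &
     (3 / 4 * kap * `|nth 0 s i|) * mdist x y < `|lincomb (nth 0 s i) phi y - lincomb (nth 0 s i) phi x|].
    have [q0|qN0] := eqVneq (nth 0 s i) 0; first by exists 0%N.
    have q0 : 0 < `|nth 0 s i| by rewrite normr_gt0.
    have : ~ locLip (lincomb (nth 0 s i) phi) (3 / 4 * kap * `|nth 0 s i|) rho x.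
      move=> /(KI x Kx _ _ _ _ r0).
      have c0 : 0 <= 3 / 4 * kap * `|nth 0 s i| by rewrite !mulr_ge0 ?ltW// divr_gt0.
      by move=> /(_ c0); rewrite ler_pM2r// => ?; lra.
    move=> /not_locLipP[y yr Hy].
    have y0 : 0 < mdist x y.
      rewrite lt_neqAle mdist_ge0 andbT; apply/eqP => /esym/mdist_positivity xy.
      by move: Hy; rewrite xy mdistxx mulr0 subrr normr0 ltxx.
    by have [m my] := inv_nat_lt y0; exists m => _; exists y.
  have [m mP] := choice H; exists (\max_i m i)%N => i /mP[y [y1 y2 y3]].
  exists y; split=> //; rewrite (le_lt_trans _ y1)// lef_pV2 ?posrE// ler_nat.
  by rewrite ltnS leq_bigmax.
have [m mm] := exhaust mK Kfin mA Amono (aeW mu KA) d0.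
have p0 : 0 < (m.+1%:R^-1 : R) by rewrite invr_gt0.
exists (Num.min m.+1%:R^-1 (rho / 2)), (K `\` A m); split=> //.
- by rewrite lt_min p0 divr_gt0//= gt_min; apply/orP; right; lra.
- exact: measurableD.
move=> x Kx nZ b b0; have Ax : A m x by apply: contrapT => nA; apply: nZ.
have nb : 0 < `|b| by rewrite normr_gt0.
have [|i _ bi] := sP (`|b|^-1 *: b).
  by rewrite normrZ normfV normr_id mulVf// gt_eqF.
set c := `|b|^-1 *: b in bi; set q := nth 0 s i in bi.
have nc : `|c| = 1 by rewrite normrZ normfV normr_id mulVf// gt_eqF.
move: bi; rewrite le_min => /andP[b1 b2].
have q1 : 1 - `|c - q| <= `|q|.
  by rewrite -nc lerBlDr -[X in `|X| <= _](subrK q) addrC ler_normD.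
have qN0 : q != 0 by rewrite -normr_gt0; lra.
have [y [y1 y2 y3]] := Ax i qN0; exists y; split=> //.
  by rewrite (le_lt_trans _ y1)// ge_min lexx.
rewrite -/q in y3.
have := phiL (c - q) x y; rewrite pairingBr -!/(lincomb _ _ _) lincombB => H1.
have -> : lincomb b phi y - lincomb b phi x = `|b| * (lincomb c phi y - lincomb c phi x).
  by rewrite /lincomb !pairingZl -mulrBr mulrA mulfV ?gt_eqF// mul1r.
rewrite normrM normr_id [_ * `|b| * _]mulrAC [_ * `|b|]mulrC ler_pM2l//.
move: H1 y3; set u := lincomb c phi y - _; set v := lincomb q phi y - _ => H1 y3.
have H2 : `|v| <= `|u| + `|u - v| by rewrite -[X in `|X| <= _](subKr u) ler_normB.
have H3 : (3 / 4 * kap) * (1 - `|c - q|) * mdist x y <= 3 / 4 * kap * `|q| * mdist x y.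
  by rewrite ler_wpM2r ?mdist_ge0// ler_wpM2l// mulr_ge0 ?divr_ge0// ltW.
have H4 : (L + kap) * `|c - q| * mdist x y <= kap / 4 * mdist x y.
  rewrite ler_wpM2r ?mdist_ge0// mulrC -ler_pdivlMr//.
  by rewrite (le_trans b2)// invfM mulrA.
have H5 : 0 <= kap * `|c - q| * mdist x y by rewrite !mulr_ge0 ?mdist_ge0 ?(ltW k0).
by move: H1 y3 H2 H3 H4 H5; lra.
Qed.

Lemma good_scale_exists kap (K : set (borel X)) H (eps d rho0 : R) : 0 < kap ->
  measurable K -> (mu K < +oo)%E -> K `<=` U -> (forall x, K x -> indepK kap phi x) ->
  lipschitz_fun H -> 0 < eps -> 0 < d -> 0 < rho0 ->
  exists rho, exists rho', exists Z : set (borel X),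
    [/\ 0 < rho' < rho, rho <= rho0, measurable Z, (mu Z < d%:E)%E &
    forall x, K x -> ~ Z x -> good_scale kap H eps rho' rho x].
Proof.
move=> k0 mK Kfin KU KI lH e0 d0 r0; have d20 : 0 < d / 2 by rewrite divr_gt0.
have [rho [Z [/andP[rho_0 rho1] mZ Zd HZ]]] := affine_scale mK Kfin KU lH e0 d20 r0.
have rho20 : 0 < rho / 2 by rewrite divr_gt0.
have [rho' [Z' [/andP[rr1 rr2] mZ' Zd' HZ']]] := detecting_scale k0 mK Kfin KI d20 rho20.
exists rho, rho', (Z `|` Z'); split=> //.
- by rewrite rr1/=; lra.
- exact: measurableU.
- rewrite (le_lt_trans (measureU2 _ _ _))// [d]splitr EFinD lteD//.
- move=> x Kx nZ; split.
    by apply: HZ => // Zx; apply: nZ; left.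
  by apply: HZ' => // Zx; apply: nZ; right.
Qed.

End one_chart.
End scales.

(** * Sequences of functions with separated scales *)

Section multiscale.
Context {R : realType} {X : completePMetricType R}.
Variable mu : {measure set (borel X) -> \bar R}.

Lemma measure_bigcup_small (Z : nat -> set (borel X)) (d : R) : 0 <= d ->
  (forall k, measurable (Z k)) -> (forall k, (mu (Z k) <= (d / (2 ^ k.+1)%:R)%:E)%E) ->
  (mu (\bigcup_k Z k) <= d%:E)%E.
Proof.
move=> d0 mZ Zd.
have mU : measurable (\bigcup_k Z k) by exact: bigcupT_measurable.
rewrite (le_trans (measure_sigma_subadditive mu mZ mU (@subset_refl _ _)))//.
by rewrite (le_trans _ (epsilon_trick0 xpredT d0))// lee_nneseries.
Qed.

Definition eps_ (k : nat) : R := (2 ^+ k)^-1.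

Lemma eps_gt0 k : 0 < eps_ k. Proof. by rewrite invr_gt0 exprn_gt0. Qed.

Lemma eps_le1 k : eps_ k <= 1.
Proof. by rewrite invf_le1 ?exprn_gt0// exprn_ege1// ler1n. Qed.

Lemma epsS k : eps_ k.+1 = eps_ k / 2.
Proof. by rewrite /eps_ exprS invfM mulrC. Qed.

Lemma eps_le i j : (i <= j)%N -> eps_ j <= eps_ i.
Proof. by move=> ij; rewrite lef_pV2 ?posrE ?exprn_gt0// ler_weXn2l// ler1n. Qed.

Lemma eps_small (e : R) : 0 < e -> exists k0, forall k, (k0 <= k)%N -> eps_ k <= e.
Proof.
move=> e0; have [m me] := inv_nat_lt e0; exists m.+1 => k mk.
rewrite (le_trans (eps_le mk))// (le_trans _ (ltW me))//.
rewrite lef_pV2 ?posrE ?exprn_gt0// -natrX ler_nat.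
exact/ltnW/ltn_expl.
Qed.

(** The intervals of radius [b k] around [u k] are nested, and the supremum of their left endpoints
    lies in all of them. *)
Lemma nested_limit (u b : nat -> R) :
  (forall k, 0 <= b k) -> (forall k, b k.+1 <= b k / 2) ->
  (forall k, `|u k.+1 - u k| <= b k / 2) ->
  forall k, `|sup [set u j - b j | j in [set: nat]] - u k| <= b k.
Proof.
move=> b0 bS uS.
have H k m : `|u (k + m)%N - u k| <= b k - b (k + m)%N.
  elim: m => [|m IH]; first by rewrite addn0 !subrr normr0.
  rewrite addnS -[u _.+1](subrK (u (k + m)%N)) -addrA (le_trans (ler_normD _ _))//.
  by have := uS (k + m)%N; have := bS (k + m)%N; lra.
have lo j k : u j - b j <= u k + b k.
  have [jk|/ltnW kj] := leqP j k.
    have := H j (k - j)%N; rewrite subnKC// ler_norml => /andP[+ _].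
    by have := b0 k; lra.
  have := H k (j - k)%N; rewrite subnKC// ler_norml => /andP[_].
  by have := b0 j; lra.
move=> k; have hs : has_sup [set u j - b j | j in [set: nat]].
  by split; [exists (u 0%N - b 0%N), 0%N | exists (u 0%N + b 0%N) => _ [j _ <-]].
have H1 : u k - b k <= sup [set u j - b j | j in [set: nat]].
  by apply: ub_le_sup; [exact: hs.2 | exists k].
have H2 : sup [set u j - b j | j in [set: nat]] <= u k + b k.
  by apply: ge_sup; [exact: hs.1 | move=> _ [j _ <-]].
by rewrite ler_norml; apply/andP; split; lra.
Qed.

Section one_chart.
Context (n : nat) (U : set X) (phi : X -> 'cV[R]_n).
Hypothesis chart : is_chart mu U phi.

(** [ms_lim] makes [h] indistinguishable from [H k] at distances above [r' k], while [ms_good]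
    describes [H k] at distances below [r k]. Convergence takes place on [W]: the whole space for
    truncated distances, [K] for the alternating series. *)
Record multiscale (kap : R) (K : set X) (Z : set X) (W : set X)
    (H : nat -> X -> R) (h : X -> R) (r' r : nat -> R) : Prop := Multiscale {
  ms_r : forall k, 0 < r' k < r k ;
  ms_r_eps : forall k, r k <= eps_ k ;
  ms_lim : forall k y, W y -> `|h y - H k y| <= eps_ k * r' k ;
  ms_good : forall k x, K x -> ~ Z x -> good_scale phi kap (H k) (eps_ k) (r' k) (r k) x
}.

(* Each modification is so small that it is invisible on the range of scales
   already fixed for the previous functions. *)
Lemma multiscale_exists kap (K : set (borel X)) (W : set X)
    (Inv : nat -> (X -> R) -> Prop) (Rel : nat -> (X -> R) -> (X -> R) -> Prop)
    (H0 : X -> R) (d : R) : 0 < kap ->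
  measurable K -> (mu K < +oo)%E -> K `<=` U -> (forall x, K x -> indepK kap phi x) ->
  (forall k H, Inv k H -> lipschitz_fun H) -> Inv 0%N H0 ->
  (forall k H eta, 0 < eta -> Inv k H -> exists H', [/\ Inv k.+1 H', Rel k H H' &
     forall y, W y -> `|H' y - H y| <= eta]) -> 0 < d ->
  exists (H : nat -> X -> R) h r' r, exists Z : set (borel X),
    [/\ H 0%N = H0, forall k, Inv k (H k) /\ Rel k (H k) (H k.+1),
      measurable Z /\ (mu Z <= d%:E)%E & multiscale kap K Z W H h r' r].
Proof.
move=> k0 mK Kfin KU KI Ilip I0 Istep d0.
pose state := (nat * (X -> R) * (R * R) * set (borel X))%type.
pose idx (s : state) := s.1.1.1. pose fn (s : state) := s.1.1.2.
pose ro' (s : state) := s.1.2.1. pose ro (s : state) := s.1.2.2.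
pose zs (s : state) := s.2.
pose ok (s : state) := [/\ Inv (idx s) (fn s), 0 < ro' s < ro s, ro s <= eps_ (idx s),
  measurable (zs s) /\ (mu (zs s) <= (d / (2 ^ (idx s).+1)%:R)%:E)%E &
  forall x, K x -> ~ zs s x -> good_scale phi kap (fn s) (eps_ (idx s)) (ro' s) (ro s) x].
(* The guard [ok s] gives every state a successor, as dependent choice requires. *)
pose next (s s' : state) := ok s -> [/\ ok s', idx s' = (idx s).+1,
  Rel (idx s) (fn s) (fn s'), ro s' <= ro' s &
  forall y, W y -> `|fn s' y - fn s y| <= eps_ (idx s) * ro' s / 2].
have dk k : 0 < d / (2 ^ k.+1)%:R by rewrite divr_gt0// ltr0n expn_gt0.
have ex k H rho0 : 0 < rho0 -> Inv k H -> exists s, [/\ ok s, idx s = k, fn s = H & ro s <= rho0].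
  move=> rho0_gt0 Ik.
  have m0 : 0 < Num.min rho0 (eps_ k) by rewrite lt_min rho0_gt0 eps_gt0.
  have [rho [rho' [Z [rr rle mZ Zd HZ]]]] :=
    good_scale_exists chart k0 mK Kfin KU KI (Ilip _ _ Ik) (eps_gt0 k) (dk k) m0.
  move: rle; rewrite le_min => /andP[r1 r2].
  exists (k, H, (rho', rho), Z); split=> //; split=> //; split=> //; exact: ltW.
have step (s : state) : {s' | next s s'}.
  apply: cid; have [oks|noks] := pselect (ok s); last by exists s => /noks.
  have [Is /andP[r0 _] _ _ _] := oks.
  (* Half of the radius [b k] of the nested intervals used below. *)
  have e0 : 0 < eps_ (idx s) * ro' s / 2 by rewrite !divr_gt0// mulr_gt0// eps_gt0.
  have [H' [I' Rl' cl]] := Istep _ _ _ e0 Is.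
  have [s' [ok' is' fs' rs']] := ex _ _ _ r0 I'.
  by exists s' => _; split=> //; rewrite fs'.
have [s0 [ok0 is0 fs0 _]] := ex _ _ _ ltr01 I0.
have [f [f0 fS]] := dependent_choice step s0.
have okf k : ok (f k).
  by elim: k => [|k IH]; [rewrite f0|have [] := fS k IH].
have idf k : idx (f k) = k.
  by elim: k => [|k IH]; [rewrite f0|have [_ -> _ _ _] := fS k (okf k); rewrite IH].
pose b k := eps_ k * ro' (f k).
have b_ge0 k : 0 <= b k.
  by have [_ /andP[/ltW r0 _] _ _ _] := okf k; rewrite mulr_ge0// ltW// eps_gt0.
have bS k : b k.+1 <= b k / 2.
  (* Separation of scales: the outer radius of stage [k.+1] was chosen at most the inner radius of
     stage [k]. *)
  have [_ _ _ rr _] := fS k (okf k); have [_ /andP[r0 rr'] _ _ _] := okf k.+1.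
  rewrite /b epsS mulrAC ler_pM2r// ler_wpM2l//; first by rewrite ltW// eps_gt0.
  by rewrite (le_trans (ltW rr')).
exists (fun k => fn (f k)), (fun y => sup [set fn (f j) y - b j | j in [set: nat]]),
  (fun k => ro' (f k)), (fun k => ro (f k)), (\bigcup_k zs (f k)); split.
- by rewrite f0.
- by move=> k; have [I1 _ _ _ _] := okf k; have [_ _ Rl _ _] := fS k (okf k); rewrite idf in I1 Rl.
- have mz k : measurable (zs (f k)) by have [_ _ _ [? _] _] := okf k.
  split; first exact: bigcupT_measurable.
  apply: measure_bigcup_small => //; first exact: ltW.
  by move=> k; have [_ _ _ [_ +] _] := okf k; rewrite idf.
split.
- by move=> k; have [_ ? _ _ _] := okf k.
- by move=> k; have [_ _ + _ _] := okf k; rewrite idf.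
- move=> k y Wy; apply: (nested_limit b_ge0 bS) => j.
  by have [_ _ _ _ /(_ y Wy)] := fS j (okf j); rewrite idf.
- move=> k x Kx nZ; have [_ _ _ _ /(_ x Kx)] := okf k; rewrite idf; apply.
  by move=> Zx; apply: nZ; exists k.
Qed.

(** The holes of [T] near [x] are small compared with their distance to [x]. *)
Definition nonporous (T : set X) (x : X) : Prop :=
  forall e, 0 < e -> exists2 rho, 0 < rho &
    forall y, mdist x y < rho -> exists2 z, T z & mdist y z <= e * mdist x y.

(** Let [c] be the affine approximation of [H k] at scale [r k]; it is close to [b k]. If [c - beta]
    were large, it would be visible at a distance between [r' k] and [r k / 2], hence also at a
    nearby point of [T]. But there [h] is within [eps_ k * r' k] of [H k], and its increment from
    [x] is almost that of [lincomb beta phi]. *)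
Lemma multiscale_differentials kap K Z W H h r' r T x beta (b : nat -> 'rV[R]_n) :
  0 < kap -> multiscale kap K Z W H h r' r ->
  K x -> ~ Z x -> T `<=` W -> T x -> indepK kap phi x -> nonporous T x ->
  (forall e, 0 < e -> exists2 rho, 0 < rho & forall z, T z -> mdist x z < rho ->
     `|h z - h x - (lincomb beta phi z - lincomb beta phi x)| <= e * mdist x z) ->
  (forall k, flat_at (fun y => H k y - lincomb (b k) phi y) x) ->
  forall e, 0 < e -> exists k0, forall k, (k0 <= k)%N -> `|b k - beta| <= e.
Proof.
move=> k0 [Hr Hre Hlim Hgood] Kx nZx TW Tx Ix npor hdiff Hdiff e e0.
have [L L0 phiL] := chart_lipschitz chart.
(* [25 = 24 + 1]: [24 * e1 / kap] bounds [c - beta], and [e1 / kap] bounds [b k - c]. *)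
set e1 := e * kap / 25; have e1_gt0 : 0 < e1 by rewrite divr_gt0// mulr_gt0.
(* The bound [1] gives [mdist x z <= 2 * mdist x y]; with [kap / (4 * L)], moving [y] to [z] loses
   at most half of the detected slope [kap / 2]. *)
pose th := Num.min 1 (kap / (4 * L)).
have th0 : 0 < th by rewrite lt_min ltr01 divr_gt0// mulr_gt0.
have [rho1 rho1_gt0 H1] := npor _ th0; have [rho2 rho2_gt0 H2] := hdiff _ e1_gt0.
have [k1 k1P] := @eps_small (Num.min e1 (Num.min rho1 rho2)) ltac:(by rewrite !lt_min e1_gt0 rho1_gt0).
exists k1 => k k1k; move: (k1P k k1k); rewrite !le_min => /and3P[ee er1 er2].
have [[c Hc] det] := Hgood k x Kx nZx.
have /andP[r0 rr] := Hr k; have rpos := lt_trans r0 rr.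
have ek := eps_gt0 k.
have bc : `|b k - c| <= e1 / kap.
  rewrite ler_pdivlMr// mulrC (le_trans _ ee)//.
  exact: indepK_uniq (ltW ek) rpos Ix (Hdiff k) Hc.
suff cb : `|c - beta| <= 24 * e1 / kap.
  have -> : b k - beta = (b k - c) + (c - beta) by rewrite addrA subrK.
  rewrite (le_trans (ler_normD _ _))// (le_trans (lerD bc cb))//.
  have : e1 / kap = e / 25 by rewrite /e1; field; rewrite gt_eqF.
  by rewrite -mulrA => ->; lra.
have [->|] := eqVneq (c - beta) 0; first by rewrite normr0 !mulr_ge0// ?invr_ge0 ltW.
set w := c - beta => wN0.
have [y [y1 y2 y3]] := det _ wN0.
have d0 : 0 < mdist x y by exact: lt_trans y1.
have rk := Hre k.
have xy1 : mdist x y < rho1 by lra.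
have [z Tz yz] := H1 y xy1.
have th1 : th <= 1 by rewrite ge_min lexx.
have yz1 : mdist y z <= mdist x y by rewrite (le_trans yz)// ler_piMl// ltW.
have xz : mdist x z <= 2 * mdist x y by have := metric_triangle x y z; lra.
have xzr : mdist x z < r k by lra.
have A1 := Hc z xzr.
have xzr2 : mdist x z < rho2 by lra.
have A2 := H2 z Tz xzr2.
have A3 := Hlim k z (TW _ Tz).
have A4 := Hlim k x (TW _ Tx).
have A5 := phiL w y z; rewrite pairingBr -!/(lincomb _ _ _) in A5.
have A6 : L * `|w| * mdist y z <= kap / 4 * `|w| * mdist x y.
  rewrite [L * _]mulrC [_ / _ * `|w|]mulrC -!mulrA ler_wpM2l//.
  rewrite (le_trans (ler_wpM2l (ltW L0) yz))// mulrA !mulrA ler_wpM2r ?(ltW d0)//.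
  rewrite mulrC -ler_pdivlMr// (_ : kap / 4 / L = kap / (4 * L)) ?ge_min ?lexx ?orbT//.
  by rewrite invfM mulrA.
have E := lincombB c beta phi z x; rewrite -/w in E.
have A7 : eps_ k * r' k <= eps_ k * mdist x y by rewrite ler_wpM2l ?ltW.
have A8 : eps_ k * mdist x z <= eps_ k * (2 * mdist x y) by rewrite ler_wpM2l// ltW.
have A9 : e1 * mdist x z <= e1 * (2 * mdist x y) by rewrite ler_wpM2l// ltW.
have A10 : eps_ k * mdist x y <= e1 * mdist x y by rewrite ler_wpM2r// ltW.
(* [6 = 2 + 2 + 1 + 1]: the affine errors of [H k] and of [h] at [z], which is at distance at most
   [2 * mdist x y], and the distance from [h] to [H k] at [z] and at [x]. *)
have A11 : `|lincomb w phi z - lincomb w phi x| <= 6 * e1 * mdist x y.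
  move: A1 A2 A3 A4; rewrite E.
  set c1 := lincomb c phi z; set c2 := lincomb c phi x.
  set b1 := lincomb beta phi z; set b2 := lincomb beta phi x.
  rewrite !ler_norml => /andP[? ?] /andP[? ?] /andP[? ?] /andP[? ?].
  by apply/andP; split; lra.
have A12 : kap / 4 * `|w| * mdist x y <= 6 * e1 * mdist x y.
  move: A11 A5 y3; set c1 := lincomb w phi z; set c2 := lincomb w phi x.
  set c3 := lincomb w phi y => A11 A5 y3.
  have : `|c3 - c2| <= `|c1 - c2| + `|c1 - c3|.
    by rewrite [X in _ <= _ + X]distrC (_ : c3 - c2 = (c1 - c2) + (c3 - c1)) ?ler_normD//; ring.
  lra.
move: A12; rewrite ler_pM2r// => A12.
rewrite ler_pdivlMr//; lra.
Qed.

End one_chart.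
End multiscale.

(** * Non-porosity and the locality of differentials *)

Section density.
Context {R : realType} {X : completePMetricType R}.

Lemma open_mball (x : X) (e : R) : open [set y | mdist y x < e].
Proof. by apply: open_lt_fun; [exact: mdist_continuous | move=> ?; exact: cvg_cst]. Qed.

Lemma dense_near (D : set X) x (e : R) : dense D -> 0 < e ->
  exists2 y, D y & mdist y x < e.
Proof.
move=> dD e0; have [|y [xy Dy]] := dD [set y | mdist y x < e] _ (open_mball x e).
  by exists x; rewrite /= mdistxx.
by exists y.
Qed.

Lemma countable_dense_range (D : set X) : countable D -> dense D ->
  exists u : nat -> X, D = range u.
Proof.
move=> cD dD; have [x0 Dx0 _] := dense_near point dD ltr01.
have /pcard_surjP[g gD] := cD.
exists (fun k => if pselect (D (g k)) then g k else x0).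
apply/seteqP; split=> [x Dx|_ [k _ <-]]; last by case: pselect.
by have [k _ gk] := gD _ Dx; exists k => //; rewrite gk; case: pselect.
Qed.

Section locality.
Variable mu : {measure set (borel X) -> \bar R}.
Hypotheses (X_separable : separable X) (mu_lf : locally_finite mu).

(** Balls of radii [1 / (j + 1)] around a countable dense set, those of infinite measure being
    discarded; local finiteness leaves enough of them. *)
Lemma finite_cover : exists O : nat -> set X,
  [/\ forall k, open (O k), forall k, (mu (O k) < +oo)%E & forall x, exists k, O k x].
Proof.
have [D cD dD] := X_separable; have [u Du] := countable_dense_range cD dD.
pose B (i j : nat) := [set y : X | mdist y (u i) < j.+1%:R^-1].
pose O k := if (unpickle k : option (nat * nat)) is Some (i, j) then
  (if (mu (B i j) < +oo)%E then B i j else set0) else set0.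
exists O; split=> [k|k|x]; rewrite /O.
- case: unpickle => [[i j]|]; last exact: open0.
  by case: ifP => _; [exact: open_mball | exact: open0].
- case: unpickle => [[i j]|]; last by rewrite measure0 ltry.
  by case: ifP => // _; rewrite measure0 ltry.
have [V [oV Vx] Vfin] := mu_lf x.
have /nbhs_ballP[e /= e0 eV] : nbhs x V by exact: open_nbhs_nbhs.
have e20 : 0 < e / 2 by rewrite divr_gt0.
have [j je] := inv_nat_lt e20.
have [y Dy yx] : exists2 y, D y & mdist y x < j.+1%:R^-1 by apply: dense_near; rewrite ?invr_gt0.
move: Dy; rewrite Du => -[i _ uy]; exists (pickle (i, j)); rewrite pickleK.
have BV : B i j `<=` V.
  move=> z; rewrite /B/= uy => zy; apply: eV; rewrite ballEmdist/= metric_sym.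
  by have := metric_triangle z y x; move: zy yx je; move: (_^-1) => t; lra.
rewrite ifT; first by rewrite /B/= uy metric_sym.
rewrite (le_lt_trans _ Vfin)// le_measure// inE; apply: open_borel => //.
exact: open_mball.
Qed.

Section one_chart.
Context (n : nat) (U : set X) (phi : X -> 'cV[R]_n).
Hypothesis chart : is_chart mu U phi.

(** Up to a null set, [U] is a countable union of sets of finite measure with a uniform independence
    constant. On each of them, exceptional sets of measure at most [1 / (j + 1)] intersect in a null
    set. *)
Lemma chart_ae (P : X -> Prop) :
  (forall (K : set (borel X)) kap d, 0 < kap -> measurable K -> (mu K < +oo)%E ->
     K `<=` U -> (forall x, K x -> indepK kap phi x) -> 0 < d ->
     exists Z : set (borel X), [/\ measurable Z, (mu Z <= d%:E)%E &
       \forall x \ae mu, K x -> ~ Z x -> P x]) ->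
  \forall x \ae mu, U x -> P x.
Proof.
move=> H; have [L L0 phiL] := chart_lipschitz chart.
have mU : measurable (U : set (borel X)) by case: chart => _ [].
have [ O [oO Ofin Ocov]] := finite_cover.
pose K (mk : nat * nat) : set (borel X) := U `&` indep_set phi mk.1.+1%:R^-1 `&` O mk.2.
have mK mk : measurable (K mk).
  by apply: measurableI; [apply: measurableI => //; exact: measurable_indep_set phiL | exact: open_borel].
have Kfin mk : (mu (K mk) < +oo)%E.
  rewrite (le_lt_trans _ (Ofin mk.2))// le_measure// ?inE//; first exact: open_borel.
  by move=> x [].
have aeK mk : \forall x \ae mu, K mk x -> P x.
  have k0 : 0 < (mk.1.+1%:R^-1 : R) by rewrite invr_gt0.
  have HZ (j : nat) : exists Z : set (borel X), [/\ measurable Z, (mu Z <= j.+1%:R^-1%:E)%E &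
       \forall x \ae mu, K mk x -> ~ Z x -> P x].
    apply: (H (K mk) _ _ k0 (mK mk) (Kfin mk)).
    - by move=> x [[Ux _] _].
    - by move=> x [[_ Ix] _]; exact: indep_set_indepK k0 L0 phiL Ix.
    - by rewrite invr_gt0.
  have [Z ZP] := choice HZ.
  have mI : measurable (\bigcap_j Z j) by apply: bigcapT_measurable => j; have [] := ZP j.
  have I0 : mu (\bigcap_j Z j) = 0%E.
    apply/eqP; rewrite eq_le measure_ge0 andbT; apply/lee_addgt0Pr => e e0; rewrite add0e.
    have [j je] := inv_nat_lt e0; have [mZ Zj _] := ZP j.
    rewrite (le_trans _ (le_trans Zj _)) ?lee_fin ?(ltW je)//.
    by rewrite le_measure ?inE// => x; exact.
  have A1 : \forall x \ae mu, ~ (\bigcap_j Z j) x.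
    by exists (\bigcap_j Z j); split=> // x /= /contrapT.
  have A2 : \forall x \ae mu, forall j, K mk x -> ~ Z j x -> P x.
    by apply: ae_all => j; have [] := ZP j.
  apply: ae_S2 A1 A2 => x nI HP Kx; apply: contrapT => nP; apply: nI => j _.
  by apply: contrapT => /(HP j Kx).
have H2 := ae_all aeK.
apply: ae_S2 H2 (ae_indep chart) => x HKx Ix Ux.
have [m Im] := indep_indep_set (Ix Ux); have [k Ok] := Ocov x.
exact: (HKx (m, k)).
Qed.

Definition dist_set (S : set X) (x : X) : R := inf [set mdist x z | z in S].

Lemma dist_set_has_inf (S : set X) x : S !=set0 -> has_inf [set mdist x z | z in S].
Proof.
move=> [z Sz]; split; first by exists (mdist x z), z.
by exists 0 => _ [w _ <-]; exact: mdist_ge0.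
Qed.

Lemma dist_set_ge0 (S : set X) x : S !=set0 -> 0 <= dist_set S x.
Proof.
by move=> /(dist_set_has_inf x)[S0 _]; apply: lb_le_inf => // _ [w _ <-]; exact: mdist_ge0.
Qed.

Lemma dist_set_le (S : set X) x z : S z -> dist_set S x <= mdist x z.
Proof.
move=> Sz; apply: ge_inf; last by exists z.
by apply: (dist_set_has_inf x _).2; exists z.
Qed.

Lemma dist_set0 (S : set X) x : S x -> dist_set S x = 0.
Proof.
move=> Sx; apply/eqP; rewrite eq_le dist_set_ge0 ?andbT; last by exists x.
by rewrite -(mdistxx x) dist_set_le.
Qed.

Lemma dist_set_lipschitz (S : set X) : S !=set0 -> lipschitz_with 1 (dist_set S).
Proof.
move=> S0 x y; rewrite mul1r.
have H a b : dist_set S a <= dist_set S b + mdist a b.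
  apply/ler_addgt0Pr => e e0.
  have [_ [z Sz <-] ze] := inf_adherent e0 (dist_set_has_inf b S0).
  rewrite (le_trans (dist_set_le a Sz))// (le_trans (metric_triangle a b z))//.
  by rewrite -/(dist_set S b) in ze; lra.
have := H x y; have := H y x; rewrite [mdist y x]metric_sym ler_norml => *.
by apply/andP; split; lra.
Qed.

Lemma lipschitz_with_max (f g : X -> R) k : lipschitz_with k f -> lipschitz_with k g ->
  lipschitz_with k (fun x => Num.max (f x) (g x)).
Proof.
move=> fk gk x y; have := fk x y; have := gk x y; rewrite !ler_norml.
by case: (leP (f x) (g x)); case: (leP (f y) (g y)) => ? ? /andP[? ?] /andP[? ?];
  apply/andP; split; lra.
Qed.

Lemma lipschitz_with_min (f g : X -> R) k : lipschitz_with k f -> lipschitz_with k g ->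
  lipschitz_with k (fun x => Num.min (f x) (g x)).
Proof.
move=> fk gk x y; have := fk x y; have := gk x y; rewrite !ler_norml.
by case: (leP (f x) (g x)); case: (leP (f y) (g y)) => ? ? /andP[? ?] /andP[? ?];
  apply/andP; split; lra.
Qed.

Lemma lipschitz_with_cst (c : R) k : 0 <= k -> lipschitz_with k (fun _ : X => c).
Proof. by move=> k0 x y; rewrite subrr normr0 mulr_ge0 ?mdist_ge0. Qed.

Lemma lipschitz_withD_cst (f : X -> R) c k : lipschitz_with k f ->
  lipschitz_with k (fun x => f x + c).
Proof. by move=> fk x y; rewrite opprD addrACA subrr addr0; exact: fk. Qed.

(** Near [x] the distance from [y] to [S] is small compared with [mdist x y], so a near-minimizer of
    it is the required point. *)
Lemma flat_dist_nonporous (S : set X) x : S x -> flat_at (dist_set S) x -> nonporous S x.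
Proof.
move=> Sx fS e e0; have e20 : 0 < e / 2 by rewrite divr_gt0.
have [r r0 Hr] := fS _ e20; exists r => // y xy.
have [yx|] := eqVneq (mdist x y) 0.
  by exists x => //; rewrite metric_sym yx mulr0.
rewrite neq_lt ltNge mdist_ge0/= => d0.
have S0 : S !=set0 by exists x.
have [_ [z Sz <-] ze] := inf_adherent (mulr_gt0 e20 d0) (dist_set_has_inf y S0).
exists z => //; move: (Hr y xy); rewrite (dist_set0 Sx) subr0.
rewrite -/(dist_set S y) in ze; have := ler_norm (dist_set S y); lra.
Qed.

(* Truncating the distance to [S] at smaller and smaller heights makes it
   alternate, near [S], between itself and zero, so a Lipschitz limit could only
   be differentiable where the differential of the distance vanishes. *)
Lemma ae_nonporous (S : set X) : \forall x \ae mu, U x -> S x -> nonporous S x.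
Proof.
have [S0|S0] := pselect (S !=set0); last first.
  by apply: aeW => x _ Sx; exfalso; apply: S0; exists x.
have [L L0 phiL] := chart_lipschitz chart.
pose dS := dist_set S.
have dS_lip : lipschitz_fun dS by exists 1; exact: dist_set_lipschitz.
apply: chart_ae => K kap d k0 mK Kfin KU KI d0.
(* The profile is prescribed only in a neighbourhood of [S], which may shrink with [k]. *)
pose Inv (k : nat) (H : X -> R) := [/\ forall x, 0 <= H x, lipschitz_with 1 H &
  exists2 eta, 0 < eta & forall y, dS y < eta -> H y = if odd k then dS y else 0].
have Istep k H eta : 0 < eta -> Inv k H -> exists H', [/\ Inv k.+1 H', True &
    forall y, setT y -> `|H' y - H y| <= eta].
  move=> eta0 [H0 H1 [eta' eta'0 H2]].
  have m0 : 0 < Num.min eta eta' by rewrite lt_min eta0.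
  (* For odd [k], lowering by [eta] and cutting at 0 erases the distance near [S]; for even [k] it
     is restored up to height [eta]. Either way the change is at most [eta]. *)
  have [ok|ok] := boolP (odd k).
    exists (fun y => Num.max (H y - eta) 0); split=> // [|y _].
      split; first by move=> x; rewrite le_max lexx orbT.
        by apply: lipschitz_with_max; [exact: lipschitz_withD_cst|exact: lipschitz_with_cst].
      exists (Num.min eta eta') => // y; rewrite lt_min => /andP[y1 y2].
      by rewrite (H2 y y2) /= ok/= max_r//; lra.
    by have := H0 y; rewrite ler_norml => Hy; case: (leP (H y - eta) 0) => ?; apply/andP; split; lra.
  exists (fun y => Num.max (H y) (Num.min (dS y) eta)); split=> // [|y _].
    split; first by move=> x; rewrite le_max H0.
      apply: lipschitz_with_max => //; apply: lipschitz_with_min.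
        exact: dist_set_lipschitz.
      exact: lipschitz_with_cst.
    exists (Num.min eta eta') => // y; rewrite lt_min => /andP[y1 y2].
    rewrite (H2 y y2) /= (negbTE ok) (min_l (ltW y1)) max_r//.
    exact: dist_set_ge0.
  have Hy := H0 y; have Sy := dist_set_ge0 y S0; rewrite -/(dS y) in Sy.
  rewrite ler_norml; case: (leP (dS y) eta) => ?.
    by case: (leP (H y) (dS y)) => ?; apply/andP; split; lra.
  by case: (leP (H y) eta) => ?; apply/andP; split; lra.
have Ilip k H : Inv k H -> lipschitz_fun H by move=> [_ H1 _]; exists 1.
have I0 : Inv 0%N (fun=> 0).
  by split=> //; [exact: lipschitz_with_cst | exists 1].
have [H [h [r' [r [Z [_ HI [mZ Zd] ms]]]]]] :=
  multiscale_exists chart (W := setT) (Inv := Inv) (Rel := fun _ _ _ => True)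
    k0 mK Kfin KU KI Ilip I0 Istep d0.
exists Z; split=> //.
have h_lip : lipschitz_fun h.
  exists 1 => x y; rewrite mul1r; apply/ler_addgt0Pr => e e0.
  have e20 : 0 < e / 2 by rewrite divr_gt0.
  have [k /(_ k (leqnn k)) ke] := eps_small e20.
  have b1 : eps_ k * r' k <= eps_ k :> R.
    have /andP[_ /ltW rr] := ms_r ms k.
    rewrite ger_pMr ?eps_gt0// (le_trans rr)// (le_trans (ms_r_eps ms k))//.
    exact: eps_le1.
  have := ms_lim ms k (y := x) I; have := ms_lim ms k (y := y) I.
  have [[_ /(_ x y) + _] _] := HI k; rewrite mul1r.
  rewrite !ler_norml => /andP[? ?] /andP[? ?] /andP[? ?].
  by apply/andP; split; lra.
apply: ae_S2 (ae_diff_at chart h_lip) (ae_diff_at chart dS_lip) => x Dh DdS Kx nZ Sx.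
have Ux := KU _ Kx; have {Dh}[_ Dh] := Dh Ux; have {DdS}[_ DdS] := DdS Ux.
apply: flat_dist_nonporous => //; rewrite -/dS.
set b := partials phi dS x in DdS *.
(* The differentials of the [H k] at a point of [S]; both of their values must be arbitrarily close
   to the differential of [h], which forces [b = 0]. *)
pose bk (k : nat) := if odd k then b else 0.
have Hk k : flat_at (fun y => H k y - lincomb (bk k) phi y) x.
  have [[_ _ [eta eta0 HE]] _] := HI k.
  suff [g gH gf] : exists2 g : X -> R, flat_at (fun y => g y - lincomb (bk k) phi y) x &
      forall y, dS y < eta -> H k y = g y.
    move=> e e0; have [s s0 Hs] := gH _ e0; exists (Num.min s eta); first by rewrite lt_min s0.
    move=> y; rewrite lt_min => /andP[xs xe].
    rewrite !gf; first exact: Hs.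
    - by rewrite /dS dist_set0.
    - by rewrite (le_lt_trans (dist_set_le y Sx))// metric_sym.
  rewrite /bk; exists (fun y => if odd k then dS y else 0) => //.
  case: (odd k); first exact: DdS.
  by have := flat_cst 0 x; congr (flat_at _ x); apply/funext => y; rewrite /lincomb pairing0l subrr.
have conv := multiscale_differentials chart (T := setT) k0 ms Kx nZ (@subset_refl _ _) I (KI _ Kx).
have b0 : b = 0.
  apply/eqP; rewrite -normr_eq0 eq_le normr_ge0 andbT; apply/ler_addgt0Pr => e e0; rewrite add0r.
  have e20 : 0 < e / 2 by rewrite divr_gt0.
  have [|||k1 Hk1] := conv (partials phi h x) bk _ _ _ _ e20.
  - by move=> e' e'0; exists 1 => // y _; exists y => //; rewrite mdistxx mulr_ge0 ?mdist_ge0// ltW.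
  - move=> e' e'0; have [s s0 Hs] := Dh _ e'0; exists s => // z _ xz.
    by apply: le_trans (Hs z xz); rewrite le_eqVlt; apply/orP; left; apply/eqP; congr `|_|; ring.
  - exact: Hk.
  have := Hk1 k1.*2 _; have := Hk1 k1.*2.+1 _; rewrite /bk /= odd_double/=.
  have -> : (k1 <= k1.*2)%N by rewrite -addnn leq_addr.
  have -> : (k1 <= k1.*2.+1)%N by rewrite -addnn (leq_trans (leq_addr k1 _)).
  move=> /(_ isT) B1 /(_ isT); rewrite sub0r normrN => B2.
  rewrite -[b](subrK (partials phi h x)) (le_trans (ler_normD _ _))//; lra.
move: DdS; rewrite /diff_at -/b b0; congr (flat_at _ x); apply/funext => y.
by rewrite /lincomb pairing0l subr0.
Qed.

(** A nearby [y] is replaced by a point of [S] at distance at most [th * mdist x y]; the Lipschitz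
    bound pays for the move and the assumption on [S] for the rest. *)
Lemma nonporous_flat (S : set X) g x : lipschitz_fun g -> nonporous S x ->
  (forall e, 0 < e -> exists2 rho, 0 < rho &
     forall z, S z -> mdist x z < rho -> `|g z - g x| <= e * mdist x z) ->
  flat_at g x.
Proof.
move=> [k gk] npor gS e e0.
have L0 : 0 < `|k| + 1 by rewrite ltr_wpDl.
pose th := Num.min 1 (e / 2 / (`|k| + 1)).
have th0 : 0 < th by rewrite lt_min ltr01 !divr_gt0.
have e40 : 0 < e / 4 by rewrite divr_gt0.
have [r1 r10 H1] := npor _ th0; have [r2 r20 H2] := gS _ e40.
exists (Num.min r1 (r2 / 2)); first by rewrite lt_min r10 divr_gt0.
move=> y; rewrite lt_min => /andP[y1 y2].
have [z Sz yz] := H1 y y1.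
have d0 := mdist_ge0 x y.
have yz1 : mdist y z <= mdist x y.
  by rewrite (le_trans yz)// ler_piMl// ge_min lexx.
have yz2 : (`|k| + 1) * mdist y z <= e / 2 * mdist x y.
  rewrite (le_trans (ler_wpM2l (ltW L0) yz))// mulrA ler_wpM2r//.
  by rewrite mulrC -ler_pdivlMr// ge_min lexx orbT.
have xz : mdist x z <= 2 * mdist x y by have := metric_triangle x y z; lra.
have xz2 : mdist x z < r2 by lra.
have A := H2 z Sz xz2.
have B : `|g y - g z| <= (`|k| + 1) * mdist y z.
  by rewrite (le_trans (gk y z))// ler_wpM2r ?mdist_ge0//; have := ler_norm k; lra.
have C : e / 4 * mdist x z <= e / 4 * (2 * mdist x y) by rewrite ler_wpM2l// ltW.
have -> : g y - g x = (g y - g z) + (g z - g x) by ring.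
by rewrite (le_trans (ler_normD _ _))//; lra.
Qed.

(** The difference vanishes on [S], so it is flat at points of non-porosity. This is the locality of
    differentials on arbitrary sets. *)
Lemma ae_eq_on_flat (S : set X) f g : lipschitz_fun f -> lipschitz_fun g ->
  (forall x, S x -> f x = g x) ->
  \forall x \ae mu, U x -> S x -> flat_at (fun y => f y - g y) x.
Proof.
move=> lf lg fg; apply: ae_S (ae_nonporous S) => x npor Ux Sx.
apply: (nonporous_flat (lipschitz_funB lf lg) (npor Ux Sx)) => e e0.
exists 1 => // z Sz _; rewrite !fg// !subrr normr0 mulr_ge0 ?mdist_ge0//.
exact: ltW.
Qed.

End one_chart.
End locality.
End density.

(** * Approximation by functions of bounded slope *)

Section approximation.
Context {R : realType} {X : completePMetricType R}.

(* The argument behind Mazur's lemma; [q] is the limit, as [th] tends to 0, of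
   the infimum of [Q] over [C th]. *)
Lemma near_minimizers (T : Type) (C : R -> set T) (Q : T -> R) (dst : T -> T -> R) (B : R) :
  (forall th th', th <= th' -> C th `<=` C th') ->
  (forall th, 0 < th -> C th !=set0) ->
  (forall th e, C th e -> 0 <= Q e <= B) ->
  (forall th e e', C th e -> C th e' -> exists2 m, C th m & Q m + dst e e' <= (Q e + Q e') / 2) ->
  exists q : R, forall eps, 0 < eps ->
    (forall th, 0 < th -> exists2 e, C th e & Q e <= q + eps) /\
    exists2 th, 0 < th & forall e e', C th e -> C th e' -> Q e <= q + eps ->
      Q e' <= q + eps -> dst e e' <= 2 * eps.
Proof.
move=> Cmono C0 Q0 Qmid.
pose lb := [set c | exists2 th, 0 < th & forall e, C th e -> c <= Q e].
have lb_sup : has_sup lb.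
  split; first by exists 0, 1 => // e /Q0/andP[].
  exists B => c [th th0 Hc]; have [e Ce] := C0 _ th0.
  by rewrite (le_trans (Hc _ Ce))//; have /andP[] := Q0 _ _ Ce.
exists (sup lb) => eps eps0; split.
  move=> th th0; apply: contrapT => H.
  have : lb (sup lb + eps).
    exists th => // e Ce; rewrite leNgt; apply/negP => Qe; apply: H.
    by exists e => //; exact: ltW.
  by move=> /(ub_le_sup lb_sup.2); lra.
have [c [th th0 Hc] cs] := sup_adherent eps0 lb_sup.
(* At the midpoint [Q] is at least [c], which exceeds [sup lb - eps]; this leaves less than
   [2 * eps] for [dst e e']. *)
exists th => // e e' Ce Ce' Qe Qe'; have [m Cm] := Qmid _ _ _ Ce Ce'.
by have := Hc _ Cm; lra.
Qed.

Section one_chart.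
Variable mu : {measure set (borel X) -> \bar R}.
Hypotheses (X_separable : separable X) (mu_lf : locally_finite mu).
Context (n : nat) (U : set X) (phi : X -> 'cV[R]_n).
Hypothesis chart : is_chart mu U phi.

(** A half-space condition on differentials. The class is stable under averages, by linearity, and
    under minima, by locality: the former serves the convexity argument, the latter the
    approximation by envelopes of distance functions. *)
Definition slope_class (K : set X) (v : 'cV[R]_n) (s : R) (e : X -> R) : Prop :=
  lipschitz_with 1 e /\ \forall x \ae mu, K x -> pairing (partials phi e x) v <= s.

(** Where [e <= e'] and where [e' <= e] the minimum equals one of the two functions, and locality
    gives it the differential of that function. *)
Lemma slope_class_min K v s e e' : K `<=` U ->
  slope_class K v s e -> slope_class K v s e' ->
  slope_class K v s (fun x => Num.min (e x) (e' x)).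
Proof.
move=> KU [e1 es] [e1' es']; split; first exact: lipschitz_with_min.
have lm : lipschitz_fun (fun x => Num.min (e x) (e' x)) by exists 1; exact: lipschitz_with_min.
have le : lipschitz_fun e by exists 1.
have le' : lipschitz_fun e' by exists 1.
have H1 := ae_eq_on_flat X_separable mu_lf chart (S := [set x | e x <= e' x]) lm le
  (fun x H => min_l H).
have H2 := ae_eq_on_flat X_separable mu_lf chart (S := [set x | e' x <= e x]) lm le'
  (fun x H => min_r H).
have H3 : \forall x \ae mu, K x -> [/\ indep phi x, diff_at phi e x & diff_at phi e' x].
  apply: ae_S2 (ae_diff_at chart le) (ae_diff_at chart le') => x D D' /KU Ux.
  by have [? ?] := D Ux; have [? ?] := D' Ux.
have H4 : \forall x \ae mu, K x -> pairing (partials phi e x) v <= s /\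
    pairing (partials phi e' x) v <= s.
  by apply: ae_S2 es es' => x H H' Kx; split; [exact: H|exact: H'].
have H12 : \forall x \ae mu, K x ->
  (e x <= e' x -> flat_at (fun y => Num.min (e y) (e' y) - e y) x) /\
  (e' x <= e x -> flat_at (fun y => Num.min (e y) (e' y) - e' y) x).
  by apply: ae_S2 H1 H2 => x A A' /KU Ux; split=> ?; [exact: A|exact: A'].
apply: ae_S3 H12 H3 H4 => x A B C Kx.
have [A1 A2] := A Kx; have [I D D'] := B Kx; have [C1 C2] := C Kx.
have [ee|/ltW ee] := leP (e x) (e' x).
  by have [_ ->] := partials_flatB I D (A1 ee).
by have [_ ->] := partials_flatB I D' (A2 ee).
Qed.

Lemma slope_class_mid K v s e e' : K `<=` U ->
  slope_class K v s e -> slope_class K v s e' ->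
  slope_class K v s (fun x => 2^-1 * e x + 2^-1 * e' x) /\
  \forall x \ae mu, K x -> partials phi (fun x => 2^-1 * e x + 2^-1 * e' x) x =
    2^-1 *: (partials phi e x + partials phi e' x).
Proof.
move=> KU [e1 es] [e1' es'].
have le : lipschitz_fun e by exists 1.
have le' : lipschitz_fun e' by exists 1.
have H : \forall x \ae mu, K x -> partials phi (fun x => 2^-1 * e x + 2^-1 * e' x) x =
    2^-1 *: (partials phi e x + partials phi e' x).
  apply: ae_S2 (ae_diff_at chart le) (ae_diff_at chart le') => x D D' /KU Ux.
  have [I {}D] := D Ux; have [_ {}D'] := D' Ux.
  have [D1 E1] := partialsZ 2^-1 I D; have [D2 E2] := partialsZ 2^-1 I D'.
  by have [_ ->] := partialsD I D1 D2; rewrite E1 E2 scalerDr.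
split=> //; split.
  move=> x y; have := e1 x y; have := e1' x y; rewrite !ler_norml => /andP[? ?] /andP[? ?].
  by apply/andP; split; lra.
apply: ae_S3 H es es' => x E A B Kx.
by rewrite (E Kx) pairingZl pairingDl; have := A Kx; have := B Kx; lra.
Qed.

Lemma slope_class_dist K v s y c : K `<=` U ->
  (\forall x \ae mu, K x -> pairing (partials phi (dist_to y) x) v <= s) ->
  slope_class K v s (fun x => mdist x y + c).
Proof.
move=> KU H; split; first by apply: lipschitz_withD_cst; exact: mdist_lipschitz.
have ld : lipschitz_fun (dist_to y : X -> R) by exists 1; exact: mdist_lipschitz.
apply: ae_S2 H (ae_diff_at chart ld) => x A D Kx; have [I {}D] := D (KU _ Kx).
have [|_ ->] := partials_flatB (g := fun x => mdist x y + c) I D; last exact: A.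
by have := flat_cst c x; congr (flat_at _ x); apply/funext => z; rewrite /dist_to addrC addKr.
Qed.

(* A function that is 1-Lipschitz on K is there the lower envelope of
   translates of distance functions. *)
Lemma slope_class_dense K v s (D : set X) f eta : compact K -> K `<=` U ->
  countable D -> dense D ->
  (forall y, D y -> \forall x \ae mu, K x -> pairing (partials phi (dist_to y) x) v <= s) ->
  (forall x y, K x -> K y -> `|f x - f y| <= mdist x y) -> 0 < eta ->
  exists2 e, slope_class K v s e & forall x, K x -> `|e x - f x| <= eta.
Proof.
move=> cK KU cD dD Hs Kf eta0; have [u Du] := countable_dense_range cD dD.
have Hu i : \forall x \ae mu, K x -> pairing (partials phi (dist_to (u i)) x) v <= s.
  by apply: Hs; rewrite Du; exists i.
have [[x0 Kx0]|K0] := pselect (K !=set0); last first.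
  exists (fun x => mdist x (u 0%N) + 0); first exact: slope_class_dist.
  by move=> x Kx; exfalso; apply: K0; exists x.
(* The least constant that lifts the distance function above [f] on [K]. Since [f] is 1-Lipschitz on
   [K], the lifted function is within [eta] of [f] near [u i]. *)
pose c i := sup [set f x - mdist x (u i) | x in K].
have c_sup i : has_sup [set f x - mdist x (u i) | x in K].
  split; first by exists (f x0 - mdist x0 (u i)), x0.
  exists (f x0 + mdist x0 (u i)) => _ [x Kx <-].
  have := Kf _ _ Kx Kx0; have := metric_triangle x x0 (u i).
  have := metric_triangle x0 x (u i); have := metric_triangle x (u i) x0.
  rewrite [mdist (u i) x0]metric_sym [mdist x0 x]metric_sym ler_norml.
  by move=> ? ? ? /andP[? ?]; lra.
have c_ge i x : K x -> f x <= mdist x (u i) + c i.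
  move=> Kx; have : f x - mdist x (u i) <= c i by apply: ub_le_sup; [exact: (c_sup i).2|exists x].
  by lra.
have c_le i x : K x -> mdist x (u i) < eta / 2 -> mdist x (u i) + c i <= f x + eta.
  move=> Kx xu; have : c i <= f x + mdist x (u i).
    apply: ge_sup; first exact: (c_sup i).1.
    move=> _ [y Ky <-]; have := Kf _ _ Ky Kx; have := metric_triangle y (u i) x.
    by rewrite [mdist (u i) x]metric_sym ler_norml => ? /andP[? ?]; lra.
  by lra.
(* Each further minimum stays above [f] and becomes accurate near one more centre; compactness then
   calls for finitely many centres. *)
have fin (l : seq nat) : exists e, [/\ slope_class K v s e, forall x, K x -> f x <= e x &
    forall i, i \in l -> forall x, K x -> mdist x (u i) < eta / 2 -> e x <= f x + eta].
  elim: l => [|i l [e [e1 e2 e3]]].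
    exists (fun x => mdist x (u 0%N) + c 0%N); split=> //; first exact: slope_class_dist.
    by move=> x; exact: c_ge.
  exists (fun x => Num.min (mdist x (u i) + c i) (e x)); split.
  - by apply: slope_class_min => //; exact: slope_class_dist.
  - by move=> x Kx; rewrite le_min c_ge// e2.
  - move=> j; rewrite inE => /orP[/eqP ->|jl] x Kx xu.
      by rewrite ge_min c_le.
    by rewrite ge_min (e3 j jl x Kx xu) orbT.
have cov : K `<=` \bigcup_(i in [set: nat]) [set y | mdist y (u i) < eta / 2].
  move=> x Kx; have e20 : 0 < eta / 2 by rewrite divr_gt0.
  have [y] := dense_near x dD e20; rewrite Du => -[i _ <-] ux.
  by exists i => //=; rewrite metric_sym.
move: cK; rewrite compact_cover => /(_ _ _ _ (fun i _ => open_mball (u i) (eta / 2)) cov)[D' _ D'cov].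
have [e [e1 e2 e3]] := fin (finmap.enum_fset D').
exists e => // x Kx; have [i /= iD' xi] := D'cov _ Kx.
have H1 := e3 i iD' x Kx xi; have H2 := e2 x Kx.
by rewrite ler_norml; apply/andP; split; lra.
Qed.

End one_chart.
End approximation.

(** * The energy of a field of covectors *)

Section energy.
Context {R : realType} {X : completePMetricType R}.
Variable mu : {measure set (borel X) -> \bar R}.
Context (n : nat) (K : set (borel X)).
Hypothesis mK : measurable K.
Implicit Types w : borel X -> 'rV[R]_n.

Definition coord_measurable w := forall i, measurable_fun setT (fun x => w x 0 i).

(** Euclidean, because the parallelogram law fails for the maximum norm of matrices. *)
Definition sqnorm (a : 'rV[R]_n) : R := \sum_i a 0 i ^+ 2.

Definition energy w : \bar R := (\int[mu]_(x in K) (sqnorm (w x))%:E)%E.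

Lemma sqnorm_ge0 a : 0 <= sqnorm a.
Proof. by rewrite sumr_ge0// => i _; rewrite sqr_ge0. Qed.

Lemma sqnorm_le a : sqnorm a <= n%:R * `|a| ^+ 2.
Proof.
have -> : n%:R * `|a| ^+ 2 = \sum_(i < n) `|a| ^+ 2 by rewrite sumr_const card_ord mulr_natl.
by apply: ler_sum => i _; rewrite -real_normK ?num_real// ler_sqr ?nnegrE// mx_norm_coord.
Qed.

Lemma norm_le_sqnorm a : `|a| ^+ 2 <= sqnorm a.
Proof.
rewrite -[leRHS]sqr_sqrtr ?sqnorm_ge0// ler_sqr ?nnegrE ?sqrtr_ge0//.
apply: mx_norm_leP; first exact: sqrtr_ge0.
move=> j i; rewrite ord1 -(ler_sqr) ?nnegrE ?sqrtr_ge0// sqr_sqrtr ?sqnorm_ge0//.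
rewrite real_normK ?num_real// /sqnorm (bigD1 i)//= lerDl.
by rewrite sumr_ge0// => k _; rewrite sqr_ge0.
Qed.

Lemma measurable_sqnorm w : coord_measurable w ->
  measurable_fun K (fun x => (sqnorm (w x))%:E).
Proof.
move=> mw; apply/measurable_EFinP; apply: measurable_sum => i.
by apply: measurable_funX; apply: measurable_funTS; exact: mw.
Qed.

Lemma energy_ge0 w : (0 <= energy w)%E.
Proof. by apply: integral_ge0 => x _; rewrite lee_fin sqnorm_ge0. Qed.

Lemma energy_le w B : 0 <= B -> coord_measurable w ->
  (\forall x \ae mu, K x -> `|w x| <= B) -> (energy w <= (n%:R * B ^+ 2)%:E * mu K)%E.
Proof.
move=> B0 mw wB; rewrite -integral_cst//.
apply: ae_ge0_le_integral => //.
- by move=> x _; rewrite lee_fin sqnorm_ge0.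
- exact: measurable_sqnorm.
- by move=> x _; rewrite lee_fin mulr_ge0// sqr_ge0.
apply: ae_S wB => x wB Kx; rewrite lee_fin (le_trans (sqnorm_le _))//.
by rewrite ler_wpM2l// ler_sqr ?nnegrE// wB.
Qed.

Lemma energy_ae w w' : coord_measurable w -> coord_measurable w' ->
  (\forall x \ae mu, K x -> w x = w' x) -> energy w = energy w'.
Proof.
move=> mw mw' ww; apply: ae_eq_integral => //; [exact: measurable_sqnorm|exact: measurable_sqnorm|].
by apply: ae_S ww => x E Kx; rewrite E.
Qed.

Lemma coord_measurable_lin w w' (c c' : R) : coord_measurable w -> coord_measurable w' ->
  coord_measurable (fun x => c *: w x + c' *: w' x).
Proof.
move=> mw mw' i; have -> : (fun x => (c *: w x + c' *: w' x) 0 i) =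
    (fun x => c * w x 0 i + c' * w' x 0 i) by apply/funext => x; rewrite !mxE.
apply: measurable_funD; apply: measurable_funM => //; exact: mw || exact: mw'.
Qed.

(** The energy of the half-difference measures the convexity defect at the midpoint, as
    [near_minimizers] requires. *)
Lemma energy_parallelogram w w' : coord_measurable w -> coord_measurable w' ->
  (2%:E * (energy (fun x => (2^-1 *: w x + 2^-1 *: w' x)%R)
   + energy (fun x => (2^-1 *: w x + (- 2^-1) *: w' x)%R)) = energy w + energy w')%E.
Proof.
move=> mw mw'; rewrite /energy.
rewrite -!ge0_integralD//; first last.
all: try by move=> x _; rewrite lee_fin sqnorm_ge0.
all: try by apply: measurable_sqnorm => //; exact: coord_measurable_lin.
rewrite -ge0_integralZl//; first last.
- by move=> x _; rewrite -EFinD lee_fin addr_ge0// sqnorm_ge0.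
- apply: emeasurable_funD; apply: measurable_sqnorm; exact: coord_measurable_lin.
apply: eq_integral => x _; rewrite -!EFinD -EFinM; congr (_%:E).
rewrite /sqnorm -!big_split/= mulr_sumr; apply: eq_bigr => i _.
by rewrite !mxE; field.
Qed.

(** Chebyshev's inequality: a small energy means uniformly small rows outside a small set. *)
Lemma energy_markov w (t : R) : 0 < t -> coord_measurable w ->
  exists B : set (borel X), [/\ measurable B, (((t ^+ 2)%:E * mu B) <= energy w)%E &
    forall x, K x -> ~ B x -> `|w x| <= t].
Proof.
move=> t0 mw; have mq := measurable_sqnorm mw.
exists (K `&` [set x | ((t ^+ 2)%:E <= `|(sqnorm (w x))%:E|)%E]); split.
- apply: emeasurable_fun_c_infty => //; first exact: measurableT_comp.
- rewrite (le_trans (le_integral_abse mu mK mq _))//; first by rewrite exprn_gt0.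
  by rewrite le_eqVlt; apply/orP; left; apply/eqP; apply: eq_integral => x _; rewrite gee0_abs// lee_fin sqnorm_ge0.
move=> x Kx nB; rewrite leNgt; apply/negP => wt; apply: nB; split=> //=.
rewrite lee_fin ger0_norm ?sqnorm_ge0// (le_trans _ (norm_le_sqnorm _))//.
by rewrite ler_sqr ?nnegrE// ltW.
Qed.

End energy.

(** * Nested classes with nearby differentials *)

Section mazur.
Context {R : realType} {X : completePMetricType R}.

Lemma decreasing_minorant (u : nat -> R) : (forall k, 0 < u k) ->
  exists2 v : nat -> R, forall k, 0 < v k & forall k, v k <= u k /\ v k.+1 <= v k.
Proof.
move=> u0; pose v := fix v k : R := if k is k'.+1 then Num.min (v k') (u k) else u 0%N.
exists v; first by elim=> [|k IH] //=; rewrite lt_min; apply/andP.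
by case=> [|k]; split=> //=; rewrite ge_min lexx ?orbT.
Qed.

Variable mu : {measure set (borel X) -> \bar R}.
Context (n : nat) (U : set X) (phi : X -> 'cV[R]_n).
Hypothesis chart : is_chart mu U phi.

(** [E k] consists of near-minimizers of the energy among the members of the class that are close to
    [f] on [K]. Nestedness makes members chosen at successive stages comparable, and since each
    [E k] comes arbitrarily close to [f], the scale construction can pick its functions once the
    required precision is known. *)
Lemma slope_class_mazur kap (K : set (borel X)) v s f (tau : nat -> R) : 0 < kap ->
  measurable K -> (mu K < +oo)%E -> K `<=` U -> (forall x, K x -> indepK kap phi x) ->
  (forall eta, 0 < eta -> exists2 e, slope_class mu phi K v s e &
     forall x, K x -> `|e x - f x| <= eta) ->
  (forall k, 0 < tau k) ->
  exists E : nat -> set (X -> R),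
    [/\ forall k, E k.+1 `<=` E k, forall k e, E k e -> slope_class mu phi K v s e,
     forall k eta, 0 < eta -> exists2 e, E k e & forall x, K x -> `|e x - f x| <= eta &
     forall k e e', E k e -> E k e' -> exists B : set (borel X), [/\ measurable B,
       (mu B <= (tau k)%:E)%E & \forall x \ae mu, K x -> ~ B x ->
         `|partials phi e x - partials phi e' x| <= eps_ k]].
Proof.
move=> k0 mK Kfin KU KI dense_f tau0.
(* [dd e] is a measurable representative of the differential of [e]; energies are computed from
   it. *)
have /choice[dd ddP] : forall e : X -> R, exists D : X -> 'rV[R]_n,
    lipschitz_with 1 e -> coord_measurable D /\
    \forall x \ae mu, K x -> partials phi e x = D x /\ `|D x| <= kap^-1.
  move=> e; have [e1|] := pselect (lipschitz_with 1 e); last by exists (fun=> 0).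
  have le : lipschitz_fun e by exists 1.
  have [D mD HD] := measurable_partials chart le.
  exists D => _; split=> //; apply: ae_S HD => x H Kx.
  have [I Dx E] := H (KU _ Kx); split=> //; rewrite -E -[leRHS]mul1r ler_pdivlMr// mulrC.
  by apply: (partials_le ler01 ltr01 (KI _ Kx) Dx); exact: locLip_lipschitz.
pose C th := [set e | slope_class mu phi K v s e /\ forall x, K x -> `|e x - f x| <= th].
pose Q e := fine (energy mu K (dd e)).
pose dst e e' := fine (energy mu K (fun x => 2^-1 *: dd e x + (- 2^-1) *: dd e' x)).
have kv0 : 0 <= kap^-1 by rewrite invr_ge0 ltW.
have en_fin (w : borel X -> 'rV[R]_n) : coord_measurable w -> (\forall x \ae mu, K x -> `|w x| <= kap^-1) ->
    (energy mu K w < +oo)%E.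
  move=> mw wB; rewrite (le_lt_trans (energy_le mK kv0 mw wB))//.
  by rewrite lte_mul_pinfty// lee_fin mulr_ge0// sqr_ge0.
have ddB e : lipschitz_with 1 e -> \forall x \ae mu, K x -> `|dd e x| <= kap^-1.
  by move=> e1; have [_] := ddP _ e1; apply: ae_S => x H Kx; have [] := H Kx.
have ddm e : lipschitz_with 1 e -> coord_measurable (dd e) by move=> /ddP[].
have linB c e e' : `|c| = 2^-1 -> lipschitz_with 1 e -> lipschitz_with 1 e' ->
    \forall x \ae mu, K x -> `|2^-1 *: dd e x + c *: dd e' x| <= kap^-1.
  move=> c2 e1 e1'; apply: ae_S2 (ddB _ e1) (ddB _ e1') => x A B Kx.
  rewrite (le_trans (ler_normD _ _))// !normrZ c2 ger0_norm ?invr_ge0//.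
  by have := A Kx; have := B Kx; lra.
have Qmid th e e' : C th e -> C th e' -> exists2 m, C th m & Q m + dst e e' <= (Q e + Q e') / 2.
  move=> [se fe] [se' fe'].
  have [sm Em] := slope_class_mid chart KU se se'.
  exists (fun x => 2^-1 * e x + 2^-1 * e' x).
    split=> // x Kx; have := fe x Kx; have := fe' x Kx; rewrite !ler_norml => /andP[? ?] /andP[? ?].
    by apply/andP; split; lra.
  have [e1 _] := se; have [e1' _] := se'; have [m1 _] := sm.
  have Qm : Q (fun x => 2^-1 * e x + 2^-1 * e' x) =
      fine (energy mu K (fun x => 2^-1 *: dd e x + 2^-1 *: dd e' x)).
    congr fine; apply: energy_ae => //; [exact: ddm|exact: coord_measurable_lin (ddm _ e1) (ddm _ e1')|].
    have [_ A] := ddP _ e1; have [_ A'] := ddP _ e1'; have [_ Am] := ddP _ m1.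
    have A2 : \forall x \ae mu, K x -> partials phi e x = dd e x /\ partials phi e' x = dd e' x.
      by apply: ae_S2 A A' => x B B' Kx; have [-> _] := B Kx; have [-> _] := B' Kx.
    apply: ae_S3 A2 Am Em => x B Bm M Kx.
    have [E1 E2] := B Kx; have [E3 _] := Bm Kx.
    by rewrite -E3 (M Kx) E1 E2 scalerDr.
  have := energy_parallelogram mu mK (ddm _ e1) (ddm _ e1').
  have f1 := en_fin _ (ddm _ e1) (ddB _ e1).
  have f2 := en_fin _ (ddm _ e1') (ddB _ e1').
  have n2 : `|2^-1| = 2^-1 :> R by rewrite ger0_norm// invr_ge0.
  have n2' : `|- 2^-1| = 2^-1 :> R by rewrite normrN.
  have f3 := en_fin _ (coord_measurable_lin 2^-1 2^-1 (ddm _ e1) (ddm _ e1')) (linB _ _ _ n2 e1 e1').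
  have f4 := en_fin _ (coord_measurable_lin 2^-1 (- 2^-1) (ddm _ e1) (ddm _ e1')) (linB _ _ _ n2' e1 e1').
  rewrite Qm /Q /dst.
  have fE (w : borel X -> 'rV[R]_n) : (energy mu K w < +oo)%E -> energy mu K w = (fine (energy mu K w))%:E.
    by move=> h; rewrite fineK// ge0_fin_numE// energy_ge0.
  rewrite (fE _ f1) (fE _ f2) (fE _ f3) (fE _ f4) -!EFinD -EFinM => -[] /=.
  by set t1 := fine _; set t2 := fine _; set t3 := fine _; set t4 := fine _ => ?; lra.
have Q0 th e : C th e -> 0 <= Q e <= fine ((n%:R * kap^-1 ^+ 2)%:E * mu K)%E.
  move=> [[e1 _] _]; rewrite /Q fine_ge0 ?energy_ge0//=.
  have fin1 : ((n%:R * kap^-1 ^+ 2)%:E * mu K < +oo)%E.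
    by rewrite lte_mul_pinfty// lee_fin mulr_ge0// sqr_ge0.
  have le1 := energy_le mK kv0 (ddm _ e1) (ddB _ e1).
  apply: fine_le le1.
    by rewrite ge0_fin_numE ?energy_ge0//; exact: en_fin (ddm _ e1) (ddB _ e1).
  by rewrite ge0_fin_numE// mule_ge0// lee_fin mulr_ge0// sqr_ge0.
have Cmono th th' : th <= th' -> C th `<=` C th'.
  by move=> tt e [se fe]; split=> // x Kx; rewrite (le_trans (fe x Kx)).
have C0 th : 0 < th -> C th !=set0 by move=> /dense_f[e se fe]; exists e.
have [q qP] := near_minimizers Cmono C0 Q0 Qmid.
(* Chebyshev's inequality at height [eps_ k / 2], for a half-difference of energy at most
   [2 * ep k], leaves a set of measure at most [8 * ep k / eps_ k ^+ 2], hence at most [tau k]. *)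
have ep0 k : 0 < tau k * eps_ k ^+ 2 / 8.
  by rewrite divr_gt0// mulr_gt0// exprn_gt0// eps_gt0.
have [ep ep_gt0 epP] := decreasing_minorant ep0.
have /choice[th thP] : forall k, exists th, 0 < th /\ forall e e', C th e -> C th e' ->
    Q e <= q + ep k -> Q e' <= q + ep k -> dst e e' <= 2 * ep k.
  by move=> k; have [_ [th ? ?]] := qP _ (ep_gt0 k); exists th.
have th_gt0 k : 0 < th k by have [] := thP k.
have [t t0 tP] := decreasing_minorant th_gt0.
exists (fun k => [set e | C (t k) e /\ Q e <= q + ep k]); split.
- move=> k e [Ce Qe]; split; first by apply: Cmono Ce; have [] := tP k.
  by rewrite (le_trans Qe)// lerD2l; have [] := epP k.
- by move=> k e [[]].
- move=> k eta eta0.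
  have m0 : 0 < Num.min eta (t k) by rewrite lt_min eta0 t0.
  have [/(_ _ m0)[e Ce Qe] _] := qP _ (ep_gt0 k).
  exists e; last by move=> x Kx; have [_ /(_ x Kx)] := Ce; rewrite le_min => /andP[].
  by split=> //; apply: Cmono Ce; rewrite ge_min lexx orbT.
- move=> k e e' [Ce Qe] [Ce' Qe'].
  have [_ H] := thP k; have [tt _] := tP k.
  have {H} dd2 := H _ _ (Cmono _ _ tt _ Ce) (Cmono _ _ tt _ Ce') Qe Qe'.
  have [[e1 _] _] := Ce; have [[e1' _] _] := Ce'.
  have n2' : `|- 2^-1| = 2^-1 :> R by rewrite normrN ger0_norm// invr_ge0.
  have mw := coord_measurable_lin 2^-1 (- 2^-1) (ddm _ e1) (ddm _ e1').
  have e20 : 0 < eps_ k / 2 :> R by rewrite divr_gt0// eps_gt0.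
  have [B [mB Bmu HB]] := energy_markov mu mK e20 mw.
  exists B; split=> //.
    have f4 := en_fin _ mw (linB _ _ _ n2' e1 e1').
    have E4 : energy mu K (fun x => 2^-1 *: dd e x + (- 2^-1) *: dd e' x) = (dst e e')%:E.
      by rewrite /dst fineK// ge0_fin_numE// energy_ge0.
    rewrite E4 in Bmu.
    have p2 : 0 < (eps_ k / 2) ^+ 2 :> R by rewrite exprn_gt0.
    rewrite -(lee_pmul2l _ (x := ((eps_ k / 2) ^+ 2)%:E))//.
    rewrite (le_trans Bmu)// -EFinM lee_fin (le_trans dd2)//.
    have [ek _] := epP k; rewrite (_ : _ * tau k = 2 * (tau k * eps_ k ^+ 2 / 8)); last by field.
    by rewrite ler_wpM2l.
  have [_ A] := ddP _ e1; have [_ A'] := ddP _ e1'.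
  apply: ae_S2 A A' => x D D' Kx nB; have [-> _] := D Kx; have [-> _] := D' Kx.
  have := HB x Kx nB; rewrite scaleNr -scalerBr normrZ ger0_norm ?invr_ge0//; lra.
Qed.

End mazur.

(** * The alternating series and the slope of an approximated function *)

Section slope_bound.
Context {R : realType} {X : completePMetricType R}.

(** The extension is the infimum of the cones of slope [C] with vertices on the graph over [T]. It
    serves to differentiate a limit known to be Lipschitz only on [T]. *)
Lemma mcshane (T : set X) (h : X -> R) C : 0 <= C ->
  (forall x y, T x -> T y -> `|h x - h y| <= C * mdist x y) ->
  exists2 g, lipschitz_fun g & forall x, T x -> g x = h x.
Proof.
move=> C0 hT; have [[x0 Tx0]|T0] := pselect (T !=set0); last first.
  exists (fun=> 0); first by exists 0; exact: lipschitz_with_cst.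
  by move=> x Tx; exfalso; apply: T0; exists x.
pose S y := [set h x + C * mdist y x | x in T].
have tri (a b x : X) : C * mdist a x <= C * mdist a b + C * mdist b x.
  by rewrite -mulrDr ler_wpM2l// metric_triangle.
have S_inf y : has_inf (S y).
  split; first by exists (h x0 + C * mdist y x0), x0.
  exists (h x0 - C * mdist y x0) => _ [x Tx <-].
  have := hT _ _ Tx0 Tx; have := tri x0 y x; rewrite [mdist x0 y]metric_sym ler_norml.
  by move=> ? /andP[? ?]; lra.
exists (fun y => inf (S y)).
  exists C => y z.
  have H u w : inf (S u) <= inf (S w) + C * mdist u w.
    apply/ler_addgt0Pr => e e0; have [_ [x Tx <-] xe] := inf_adherent e0 (S_inf w).
    have : inf (S u) <= h x + C * mdist u x by apply: ge_inf; [exact: (S_inf u).2|exists x].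
    by have := tri u w x; lra.
  have := H y z; have := H z y; rewrite [mdist z y]metric_sym ler_norml => ? ?.
  by apply/andP; split; lra.
move=> x Tx; apply/eqP; rewrite eq_le; apply/andP; split.
  by apply: ge_inf; [exact: (S_inf x).2|exists x => //; rewrite mdistxx mulr0 addr0].
apply: lb_le_inf; first exact: (S_inf x).1.
move=> _ [y Ty <-]; have := hT _ _ Tx Ty; rewrite ler_norml => /andP[? ?]; lra.
Qed.

Variable mu : {measure set (borel X) -> \bar R}.
Hypotheses (X_separable : separable X) (mu_lf : locally_finite mu).
Context (n : nat) (U : set X) (phi : X -> 'cV[R]_n).
Hypothesis chart : is_chart mu U phi.

(* If [f] had a slope larger than that of all the functions [e k] approximating
   it, the series of terms [(-1) ^ k (e k - f)] would converge to a Lipschitz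
   function whose differential alternates between distant values along the
   scales. *)
Lemma slope_bound kap (K : set (borel X)) (a : 'rV[R]_n) v s (D : set X) : 0 < kap ->
  measurable K -> (mu K < +oo)%E -> K `<=` U -> (forall x, K x -> indepK kap phi x) ->
  compact (K : set X) -> countable D -> dense D ->
  (forall y, D y -> \forall x \ae mu, K x -> pairing (partials phi (dist_to y) x) v <= s) ->
  (forall x y, K x -> K y -> `|lincomb a phi x - lincomb a phi y| <= mdist x y) ->
  s < pairing a v -> mu K = 0%E.
Proof.
move=> k0 mK Kfin KU KI cK cD dD Hs; set f := lincomb a phi => f1 sav.
have [L L0 phiL] := chart_lipschitz chart.
apply: contrapT => /eqP muK0.
have muK_gt0 : (0 < mu K)%E by rewrite lt0e muK0 measure_ge0.
have muKE : mu K = (fine (mu K))%:E by rewrite fineK// ge0_fin_numE.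
set m := fine (mu K) in muKE.
have m0 : 0 < m by rewrite -lte_fin -muKE.
(* Two exceptional sets of measure at most [m / 4] cannot cover [K], even up to a null set. *)
set d := m / 4; have d0 : 0 < d by rewrite divr_gt0.
have tau0 k : 0 < d / (2 ^ k.+1)%:R by rewrite divr_gt0// ltr0n expn_gt0.
have [|E [Edec Ecl Edense EB]] := slope_class_mazur chart (v := v) (s := s) (f := f)
    k0 mK Kfin KU KI _ tau0.
  by move=> eta eta0; exact: (slope_class_dense X_separable mu_lf chart cK KU cD dD Hs f1 eta0).
have lf : lipschitz_fun f by exact: lipschitz_fun_lincomb phiL.
have Elip k e : E k e -> lipschitz_fun e by move=> /Ecl[e1 _]; exists 1.
pose Rel (k : nat) (H H' : X -> R) := exists2 e, E k e & H' = fun y => H y + (-1) ^+ k * (e y - f y).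
have Istep (k : nat) (H : X -> R) eta : 0 < eta -> lipschitz_fun H -> exists H', [/\ lipschitz_fun H', Rel k H H' &
     forall y, K y -> `|H' y - H y| <= eta].
  move=> eta0 lH; have [e Ee ef] := Edense k _ eta0.
  exists (fun y => H y + (-1) ^+ k * (e y - f y)); split.
  - apply: lipschitz_funD => //; apply: lipschitz_funZ; apply: lipschitz_funB => //.
    exact: Elip Ee.
  - by exists e.
  - by move=> y Ky; rewrite addrAC subrr add0r normrM normrX normrN1 expr1n mul1r ef.
have I0 : lipschitz_fun (fun _ : X => 0 : R) by exists 0; exact: lipschitz_with_cst.
have [H [h [r' [r [Z [HE0 HI [mZ Zd] ms]]]]]] :=
  multiscale_exists chart (W := K) (Inv := fun _ H => lipschitz_fun H) (Rel := Rel)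
    k0 mK Kfin KU KI (fun _ _ => id) I0 Istep d0.
have /choice[e eP] : forall k, exists e, E k e /\ H k.+1 = fun y => H k y + (-1) ^+ k * (e y - f y).
  by move=> k; have [_ [e]] := HI k; exists e.
have /choice[B BP] : forall k, exists B : set (borel X), [/\ measurable B,
       (mu B <= (d / (2 ^ k.+1)%:R)%:E)%E & \forall x \ae mu, K x -> ~ B x ->
         `|partials phi (e k) x - partials phi (e k.+1) x| <= eps_ k].
  by move=> k; apply: EB; [have [] := eP k|apply: Edec; have [] := eP k.+1].
have mB k : measurable (B k) by have [] := BP k.
have mBU : measurable (\bigcup_k B k) by exact: bigcupT_measurable.
have BU : (mu (\bigcup_k B k) <= d%:E)%E.
  by apply: measure_bigcup_small => //; [exact: ltW|move=> k; have [] := BP k].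
pose p k x := partials phi (e k) x.
pose T : set X := [set x | [/\ K x, ~ Z x & forall k,
  [/\ diff_at phi (e k) x, `|p k x - p k.+1 x| <= eps_ k & pairing (p k x) v <= s]]].
have e_lip1 k : lipschitz_with 1 (e k) by have [/Ecl[]] := eP k.
have HT : \forall x \ae mu, K x -> ~ Z x -> ~ (\bigcup_k B k) x -> T x.
  have H1 : \forall x \ae mu, forall k, K x -> ~ B k x ->
      [/\ diff_at phi (e k) x, `|p k x - p k.+1 x| <= eps_ k & pairing (p k x) v <= s].
    apply: ae_all => k; have [_ _ A1] := BP k; have [/Ecl[_ A2] _] := eP k.
    have le : lipschitz_fun (e k) by exists 1.
    apply: ae_S3 A1 A2 (ae_diff_at chart le) => x C1 C2 C3 Kx nB.
    by have [_ ?] := C3 (KU _ Kx); split=> //; [exact: C1|exact: C2].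
  apply: ae_S H1 => x C Kx nZ nB; split=> // k; apply: C => // Bk.
  by apply: nB; exists k.
(* The differential at [x] of the partial sum [H k]. *)
pose b x := fix b k : 'rV[R]_n := if k is k'.+1 then b k' + (-1) ^+ k' *: (p k' x - a) else 0.
have HTflat x k : T x -> flat_at (fun y => H k y - lincomb (b x k) phi y) x.
  move=> [Kx _ Tx]; elim: k => [|k IH].
    have := flat_cst 0 x; congr (flat_at _ x); apply/funext => y.
    by rewrite HE0 /lincomb pairing0l subrr.
  have [De _ _] := Tx k; have [_ ->] := eP k.
  have := flatD IH (flatZ ((-1) ^+ k) De); congr (flat_at _ x); apply/funext => y /=.
  by rewrite /lincomb pairingDl pairingZl pairingBl /f /lincomb -/(p k x); ring.
have p_le x k : T x -> `|p k x| <= kap^-1.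
  move=> [Kx _ Tx]; have [De _ _] := Tx k.
  rewrite -[leRHS]mul1r ler_pdivlMr// mulrC.
  by apply: (partials_le ler01 ltr01 (KI _ Kx) De); exact: locLip_lipschitz.
(* Consecutive terms almost cancel. Passing from an odd [k] to [k.+1] adds an error of at most
   [eps_ k.-1], which is the increment of [4 * (1 - eps_ k)]. *)
have b_alt x k : T x -> `|b x k - (if odd k then p k.-1 x - a else 0)| <= 4 * (1 - eps_ k).
  move=> Tx; elim: k => [|k IH].
    by rewrite /= subr0 normr0 mulr_ge0// subr_ge0 eps_le1.
  move: IH; rewrite /= -signr_odd; have := epsS k (R := R); have := eps_gt0 (R := R) k.
  have [ok|ok] := boolP (odd k) => /= ek eS.
    rewrite expr1 scaleN1r subr0 => IH.
    have [_ _ /(_ k.-1)[_ + _]] := Tx; rewrite prednK ?odd_gt0// => pp.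
    have epp : eps_ k.-1 = 2 * eps_ k :> R.
      by rewrite -{2}(prednK (odd_gt0 ok)) epsS; field.
    have -> : b x k - (p k x - a) = (b x k - (p k.-1 x - a)) + (p k.-1 x - p k x).
      by rewrite !opprB; apply/rowP => i; rewrite !mxE; ring.
    rewrite (le_trans (ler_normD _ _))//; move: pp IH; rewrite epp eS.
    by set t1 := `|_|; set t2 := `|_|; lra.
  by rewrite expr0 scale1r addrK subr0 => IH; rewrite (le_trans IH)//; lra.
pose M := 4 + (kap^-1 + `|a|).
have b_le x k : T x -> `|b x k| <= M.
  move=> Tx; have H1 := b_alt x k Tx; have ek := eps_gt0 (R := R) k.
  have ka : 0 <= kap^-1 + `|a| by rewrite addr_ge0// invr_ge0 ltW.
  rewrite -[b x k](subrK (if odd k then p k.-1 x - a else 0)).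
  rewrite (le_trans (ler_normD _ _))// lerD//; first by lra.
  case: (odd k); last by rewrite normr0.
  by rewrite (le_trans (ler_normB _ _))// lerD2r p_le.
(* [5 = 1 + 1 + 2 + 1]: the tail of the series at [x] and at [y], the term of index [k], and the
   affine error of [H k]. The other summand bounds the slope of its affine approximation. *)
pose C := L * (M + kap^-1) + 5.
have kv0 : 0 < kap^-1 by rewrite invr_gt0.
have M0 : 0 <= M by rewrite addr_ge0// addr_ge0// ltW.
have C0 : 0 <= L * (M + kap^-1) by rewrite mulr_ge0 ?addr_ge0// ltW.
have hT x y : T x -> T y -> `|h x - h y| <= C * mdist x y.
  move=> Tx Ty; have [Kx nZx _] := Tx; have [Ky _ _] := Ty.
  have [xy0|] := eqVneq (mdist x y) 0.
    by rewrite (mdist_positivity _ _ xy0) subrr normr0 mdistxx mulr0.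
  rewrite neq_lt ltNge mdist_ge0/=; set t := mdist x y => t0.
  have lim k : r k <= t -> (forall z, K z -> `|h z - H k z| <= t).
    move=> rt z Kz; rewrite (le_trans (ms_lim ms k Kz))//.
    have /andP[r'0 rr] := ms_r ms k.
    by rewrite (le_trans _ rt)// (le_trans _ (ltW rr))// ger_pMl// eps_le1.
  have ex : exists k, r k <= t.
    have [k /(_ k (leqnn k)) kt] := eps_small t0; exists k.
    by rewrite (le_trans (ms_r_eps ms k)).
  have Ct : L * (M + kap^-1) * t + 5 * t = C * t by rewrite /C [RHS]mulrDl.
  (* The first level whose outer radius is at most [t]. One level earlier the partial sum is still
     almost affine at distance [t]; the next term is 2-Lipschitz on [K], and the tail after it is at
     most [t]. *)
  case: (ex_minnP ex) => -[|k] rk kmin.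
    have := lim _ rk x Kx; have := lim _ rk y Ky; rewrite HE0 -Ct !subr0.
    have : 0 <= L * (M + kap^-1) * t by rewrite mulr_ge0// ltW.
    rewrite !ler_norml => ? /andP[? ?] /andP[? ?].
    by apply/andP; split; lra.
  have tk : t < r k.
    by rewrite ltNge; apply/negP => /kmin; rewrite ltnn.
  have [[c Hc] _] := ms_good ms k Kx nZx.
  have ek := eps_gt0 (R := R) k; have ek1 := eps_le1 (R := R) k.
  have rk0 : 0 < r k by exact: lt_trans tk.
  have bc := indepK_uniq (ltW ek) rk0 (KI _ Kx) (HTflat x k Tx) Hc.
  have bc' : `|b x k - c| <= kap^-1.
    by rewrite -[leRHS]mul1r ler_pdivlMr// mulrC (le_trans bc).
  have c_le : `|c| <= M + kap^-1.
    rewrite -[c](subKr (b x k)) (le_trans (ler_normB _ _))// lerD//.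
    exact: b_le.
  have cxy : `|lincomb c phi y - lincomb c phi x| <= L * (M + kap^-1) * t.
    rewrite /lincomb -pairingBr (le_trans (phiL _ _ _))//.
    by rewrite ler_wpM2r ?(ltW t0)// ler_wpM2l// ltW.
  have Hxy := Hc y tk.
  have eps_t : eps_ k * t <= t by rewrite ler_piMl// ltW.
  rewrite -/t in Hxy.
  have exy := e_lip1 k x y; rewrite mul1r -/t in exy.
  have fxy := f1 x y Kx Ky; rewrite -/t in fxy.
  have hx := lim _ rk x Kx; have hy := lim _ rk y Ky.
  have [_ HS] := eP k; rewrite HS in hx hy.
  have sg : `|(-1) ^+ k * (e k x - f x) - (-1) ^+ k * (e k y - f y)| <= 2 * t.
    rewrite -mulrBr normrM normrX normrN1 expr1n mul1r.
    have -> : e k x - f x - (e k y - f y) = (e k x - e k y) - (f x - f y) by ring.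
    by rewrite (le_trans (ler_normB _ _))//; lra.
  rewrite -Ct; move: hx hy sg cxy Hxy exy fxy.
  set u1 := (-1) ^+ k * _; set u2 := (-1) ^+ k * _.
  rewrite !ler_norml => /andP[? ?] /andP[? ?] /andP[? ?] /andP[? ?] /andP[? ?] /andP[? ?] /andP[? ?].
  by apply/andP; split; lra.
have Cge0 : 0 <= C by rewrite addr_ge0.
have [g lg gT] := mcshane Cge0 hT.
have Hae : \forall x \ae mu, K x -> ~ Z x -> ~ (\bigcup_k B k) x -> False.
  apply: ae_S3 HT (ae_nonporous X_separable mu_lf chart T) (ae_diff_at chart lg).
  move=> x A1 A2 A3 Kx nZ nB; have Tx := A1 Kx nZ nB; have npor := A2 (KU _ Kx) Tx.
  have [_ Dg] := A3 (KU _ Kx).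
  have TK : T `<=` K by move=> y [].
  (* Two consecutive partial sums have differentials within [ep] of that of [g], so [p k0' x] is
     within [2 * ep] of [a], and its pairing with [v] falls short of that of [a] by at most half of
     the gap. *)
  set ep := (pairing a v - s) / (4 * (n%:R * `|v| + 1)).
  have nv0 : 0 < n%:R * `|v| + 1 by rewrite ltr_wpDl.
  have ep0 : 0 < ep by rewrite divr_gt0 ?subr_gt0// mulr_gt0.
  have [||k0' conv] := multiscale_differentials chart k0 ms Kx nZ TK Tx (KI _ Kx) npor
    (beta := partials phi g x) (b := b x) _ _ ep0.
  - move=> e' e'0; have [q q0 Hq] := Dg _ e'0; exists q => // z Tz xz.
    apply: le_trans (Hq z xz); rewrite -(gT z Tz) -(gT x Tx).
    by rewrite le_eqVlt; apply/orP; left; apply/eqP; congr `|_|; ring.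
  - by move=> k; exact: HTflat.
  have c1 := conv k0' (leqnn _); have c2 := conv k0'.+1 (leqnSn _).
  have pa : `|p k0' x - a| <= 2 * ep.
    have -> : `|p k0' x - a| = `|b x k0'.+1 - b x k0'|.
      by rewrite /= addrAC subrr add0r normrZ normrX normrN1 expr1n mul1r.
    have -> : b x k0'.+1 - b x k0' = (b x k0'.+1 - partials phi g x) - (b x k0' - partials phi g x).
      by rewrite opprB addrA subrK.
    by rewrite (le_trans (ler_normB _ _))//; lra.
  have [_ _ /(_ k0')[_ _ ps]] := Tx.
  have H1 := pairing_le (p k0' x - a) v; rewrite pairingBl in H1.
  have H2 : n%:R * `|p k0' x - a| * `|v| <= (n%:R * `|v| + 1) * (2 * ep).
    rewrite mulrAC (@le_trans _ _ (n%:R * `|v| * (2 * ep)))//.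
      by rewrite ler_wpM2l// mulr_ge0.
    by rewrite ler_wpM2r ?lerDl// mulr_ge0// ltW.
  have H3 : (n%:R * `|v| + 1) * (2 * ep) = (pairing a v - s) / 2.
    by rewrite /ep; field; rewrite gt_eqF.
  move: H1; rewrite ler_norml => /andP[H1 _]; lra.
have mZB : measurable (Z `|` \bigcup_k B k) by exact: measurableU.
have mKZ : measurable (K `\` (Z `|` \bigcup_k B k)) by exact: measurableD.
have K0 : (mu (K `\` (Z `|` \bigcup_k B k)) = 0)%E.
  apply: measure_negligible => //.
  apply: negligibleS Hae => x [Kx nZB] /= A; apply: A => //.
    by move=> Zx; apply: nZB; left.
  by move=> Bx; apply: nZB; right.
have : (mu K <= (2 * d)%:E)%E.
  have sub : K `<=` (K `\` (Z `|` \bigcup_k B k)) `|` (Z `|` \bigcup_k B k).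
    by move=> x Kx; have [?|?] := pselect ((Z `|` \bigcup_k B k) x); [right|left].
  have A1 : (mu K <= mu ((K `\` (Z `|` \bigcup_k B k)) `|` (Z `|` \bigcup_k B k)))%E.
    by apply: le_measure; rewrite ?inE//; exact: measurableU.
  have A2 : (mu ((K `\` (Z `|` \bigcup_k B k)) `|` (Z `|` \bigcup_k B k)) <=
      mu (K `\` (Z `|` \bigcup_k B k)) + mu (Z `|` \bigcup_k B k))%E := measureU2 mu mKZ mZB.
  rewrite K0 add0e in A2.
  have A3 : (mu (Z `|` \bigcup_k B k) <= mu Z + mu (\bigcup_k B k))%E := measureU2 mu mZ mBU.
  apply: (le_trans A1); apply: (le_trans A2); apply: (le_trans A3).
  by rewrite mulr_natl mulr2n EFinD leeD.
by rewrite muKE lee_fin /d; lra.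
Qed.

End slope_bound.

(** * Distance functions and the dual norm in one chart *)

Section duality.
Context {R : realType} {X : completePMetricType R}.

Definition sup_pairing n (S : set 'rV[R]_n) (v : 'cV[R]_n) : \bar R :=
  ereal_sup [set `|pairing a v|%:E | a in S].

Lemma sup_pairing_seminorm n (S : set 'rV[R]_n) B : S !=set0 ->
  (forall a, S a -> `|a| <= B) -> is_seminorm (sup_pairing S).
Proof.
move=> [a0 Sa0] SB.
have ge a v : S a -> (`|pairing a v|%:E <= sup_pairing S v)%E.
  by move=> Sa; apply: ereal_sup_ubound; exists a.
have le v c : (forall a, S a -> `|pairing a v| <= c) -> (sup_pairing S v <= c%:E)%E.
  by move=> H; apply: ge_ereal_sup => _ [a Sa <-]; rewrite lee_fin H.
have fin v : (0 <= sup_pairing S v < +oo)%E.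
  apply/andP; split.
    by apply: le_trans (ge a0 v Sa0); rewrite lee_fin.
  rewrite (@le_lt_trans _ _ (n%:R * B * `|v|)%:E) ?ltry// le// => a Sa.
  by rewrite (le_trans (pairing_le _ _))// ler_wpM2r// ler_wpM2l// SB.
have fE v : sup_pairing S v = (fine (sup_pairing S v))%:E.
  by have /andP[? ?] := fin v; rewrite fineK// ge0_fin_numE.
have ger a v : S a -> `|pairing a v| <= fine (sup_pairing S v).
  by move=> /(ge _ v); rewrite fE lee_fin.
have leZ c v : (sup_pairing S (c *: v) <= `|c|%:E * sup_pairing S v)%E.
  rewrite [in leRHS]fE -EFinM; apply: le => a Sa.
  by rewrite pairingZr normrM ler_wpM2l// ger.
split=> //.
- move=> c v; apply/eqP; rewrite eq_le leZ/=.
  have [->|c0] := eqVneq c 0.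
    by rewrite normr0 mul0e; have /andP[] := fin (0 *: v).
  have := leZ c^-1 (c *: v); rewrite scalerA mulVf// scale1r normfV.
  rewrite [in leRHS]fE [in leLHS]fE -EFinM lee_fin ler_pdivlMl ?normr_gt0// => H.
  by rewrite fE -EFinM [leRHS]fE lee_fin.
- move=> v w; rewrite [sup_pairing S v]fE [sup_pairing S w]fE -EFinD; apply: le => a Sa.
  by rewrite pairingDr (le_trans (ler_normD _ _))// lerD// ger.
Qed.

(** The flat remainder only raises the local Lipschitz constant to [1 + e], for every positive [e].
    This gives the easy inequality between the seminorms. *)
Lemma Lip_differential_le1 n (phi : X -> 'cV[R]_n) f x :
  lipschitz_with 1 f -> diff_at phi f x ->
  (Lip (lincomb (partials phi f x) phi) x <= 1)%E.
Proof.
move=> f1 D; apply/lee_addgt0Pr => e e0; rewrite -EFinD.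
have [r r0 Hr] := D _ e0.
apply: (locLip_Lip _ r0); first by rewrite addr_ge0// ltW.
move=> y xy; have := Hr y xy; have := f1 y x; rewrite mul1r metric_sym.
set u := lincomb _ _ y; set v := lincomb _ _ x; rewrite !ler_norml => /andP[? ?] /andP[? ?].
by rewrite mulrDl mul1r; apply/andP; split; lra.
Qed.

(** Independence bounds the unit ball of covectors, so the supremum is finite; the Lipschitz bound
    on [phi] puts multiples of the coordinate covectors into the ball, so the supremum separates
    vectors. *)
Lemma dual_norm_is_norm n L kap (phi : X -> 'cV[R]_n) x : 0 < L -> 0 < kap ->
  map_lipschitz L phi -> indepK kap phi x ->
  is_norm (sup_pairing [set a | (Lip (lincomb a phi) x <= 1)%E]).
Proof.
move=> L0 k0 phiL I; set S := [set a | _].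
have SB a : S a -> `|a| <= kap^-1.
  move=> Sa; have := le_trans (indepK_Lip a I) Sa.
  by rewrite lee_fin mulrC -ler_pdivlMr// mul1r.
have SL a : L * `|a| <= 1 -> S a.
  move=> aL; apply: (@locLip_Lip _ _ _ _ 1) => // y xy.
  by rewrite /lincomb -pairingBr (le_trans (phiL _ _ _))// ler_wpM2r// mdist_ge0.
have S0 : S 0 by apply: SL; rewrite normr0 mulr0.
split; first by apply: sup_pairing_seminorm SB; exists 0.
move=> v v0; apply/colP => i; rewrite mxE; apply/eqP.
have Sd : S (L^-1 *: delta_mx 0 i).
  apply: SL; rewrite normrZ gtr0_norm ?invr_gt0// mulrA mulfV ?gt_eqF// mul1r.
  apply: mx_norm_leP => // j k; rewrite mxE.
  by case: (_ && _); rewrite ?normr1 ?normr0.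
have : (`|pairing (L^-1 *: delta_mx 0 i) v|%:E <= sup_pairing S v)%E.
  by apply: ereal_sup_ubound; exists (L^-1 *: delta_mx 0 i).
rewrite v0 lee_fin pairingZl pairing_delta normr_le0 mulf_eq0 invr_eq0.
by rewrite gt_eqF.
Qed.

Variable mu : {measure set (borel X) -> \bar R}.
Hypotheses (X_separable : separable X) (mu_radon : radon mu).
Context (n : nat) (U : set X) (phi : X -> 'cV[R]_n).
Hypothesis chart : is_chart mu U phi.

Lemma compact_borel (K : set X) : compact K -> measurable (K : set (borel X)).
Proof. by move=> cK; apply: closed_borel; apply: compact_closed => //; exact: metric_hausdorff. Qed.

(** Inner regularity on pieces of finite measure. Compactness is what the approximation by finite
    envelopes relies on. *)
Lemma null_of_compacts (E : set (borel X)) : measurable E ->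
  (forall K : set X, compact K -> K `<=` E -> (mu K < +oo)%E -> mu K = 0%E) ->
  mu.-negligible E.
Proof.
have [mu_lf mu_cir] := mu_radon => mE HE.
have [ O [oO Ofin Ocov]] := finite_cover X_separable mu_lf.
have mEO k : measurable (E `&` O k) by apply: measurableI => //; exact: open_borel.
have EO k : mu.-negligible (E `&` O k).
  apply/negligibleP => //; apply: (etrans (mu_cir _ (mEO k))).
  apply/eqP; rewrite eq_le; apply/andP; split.
    apply: ge_ereal_sup => _ [K [cK KE] <-].
    rewrite HE// => [x /KE[]//|].
    rewrite (le_lt_trans _ (Ofin k))// le_measure ?inE//; first exact: compact_borel.
      exact: open_borel.
    by move=> x /KE[].
  apply: ereal_sup_ubound; exists set0; last by rewrite measure0.
  by split; [exact: compact0|exact: sub0set].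
have := negligible_bigcup EO; apply: negligibleS => x Ex.
by have [k Ok] := Ocov x; exists k.
Qed.

Section dense_set.
Context (D : set X).
Hypotheses (cD : countable D) (dD : dense D).

Lemma ae_dist_differentiable :
  \forall x \ae mu, U x -> indep phi x /\ forall y, D y -> diff_at phi (dist_to y) x.
Proof.
have [u Du] := countable_dense_range cD dD.
have H : \forall x \ae mu, forall i, U x -> indep phi x /\ diff_at phi (dist_to (u i)) x.
  by apply: ae_all => i; apply: ae_diff_at => //; exists 1; exact: mdist_lipschitz.
apply: ae_S H => x H Ux; split; first by have [] := H 0%N Ux.
by move=> y; rewrite Du => -[i _ <-]; have [] := H i Ux.
Qed.

(** [slope_bound] treats one covector, one vector and one threshold at a time; rational data leave
    only countably many null sets [E]. *)
Lemma ae_slope_bound : \forall x \ae mu, U x ->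
  forall (q : 'rV[rat]_n) (w : 'cV[rat]_n) (s : rat) r,
  (forall y, D y -> pairing (partials phi (dist_to y) x) (map_mx ratr w) <= ratr s) ->
  0 < r -> locLip (lincomb (map_mx ratr q) phi) 1 r x ->
  pairing (map_mx ratr q) (map_mx ratr w) <= ratr s :> R.
Proof.
have [mu_lf _] := mu_radon.
have [L L0 phiL] := chart_lipschitz chart.
have mU : measurable (U : set (borel X)) by case: chart => _ [].
have [u Du] := countable_dense_range cD dD.
have lu i : lipschitz_fun (dist_to (u i) : X -> R) by exists 1; exact: mdist_lipschitz.
have /choice[dd ddP] : forall i, exists dd : X -> 'rV[R]_n,
    (forall j, measurable_fun setT (fun x : borel X => dd x 0 j)) /\
    \forall x \ae mu, U x -> [/\ indep phi x, diff_at phi (dist_to (u i)) x &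
       partials phi (dist_to (u i)) x = dd x].
  by move=> i; have [dd ? ?] := measurable_partials chart (lu i); exists dd.
(* Two points of the ball around [u i] are at distance less than [1 / (j + 1)], so on [E] the local
   bound makes the combination 1-Lipschitz, as [slope_bound] demands. *)
pose E (m : nat) (q : 'rV[rat]_n) (w : 'cV[rat]_n) (s : rat) (j i : nat) : set (borel X) :=
  U `&` indep_set phi m.+1%:R^-1 `&`
  [set x | locLip (lincomb (map_mx ratr q) phi) 1 j.+1%:R^-1 x] `&`
  [set x | mdist x (u i) < j.+1%:R^-1 / 2] `&`
  [set x | forall k, pairing (dd k x) (map_mx ratr w) <= ratr s].
have mE m q w s j i : measurable (E m q w s j i).
  apply: measurableI; first apply: measurableI; first apply: measurableI; first apply: measurableI => //.
  - exact: measurable_indep_set phiL.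
  - by apply: closed_borel; apply: closed_locLip; exact: lipschitz_fun_lincomb phiL.
  - by apply: open_borel; exact: open_mball.
  apply: borel_all => k.
  have mp : measurable_fun setT (fun x : borel X => pairing (dd k x) (map_mx ratr w)).
    apply: measurable_sum => l; apply: measurable_funM => //.
    by have [+ _] := ddP k.
  have := mp measurableT _ (measurable_itv `]-oo, (ratr s : R)]).
  rewrite setTI; congr measurable; apply/seteqP; split=> x /=; by rewrite in_itv.
have E0 m q w s j i : ratr s < pairing (map_mx ratr q) (map_mx ratr w) :> R ->
    mu.-negligible (E m q w s j i).
  move=> sqw; apply: null_of_compacts => // K cK KE Kfin.
  have k0 : 0 < (m.+1%:R^-1 : R) by rewrite invr_gt0.
  have KU : K `<=` U by move=> x /KE[[[[]]]].
  apply: (slope_bound X_separable mu_lf chart (kap := m.+1%:R^-1) (a := map_mx ratr q)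
    (v := map_mx ratr w) (s := ratr s) (D := D)) => //.
  - exact: compact_borel.
  - by move=> x /KE[[[[_ Ix] _] _] _]; exact: indep_set_indepK k0 L0 phiL Ix.
  - move=> y; rewrite Du => -[k _ <-]; have [_ A] := ddP k.
    by apply: ae_S A => x A Kx; have [_ _ ->] := A (KU _ Kx); have [_] := KE _ Kx.
  - move=> x y /KE[[[_ Hx] xi] _] /KE[[[_ _] yi] _].
    rewrite distrC -[leRHS]mul1r; apply: Hx.
    have := metric_triangle x (u i) y; rewrite [mdist (u i) y]metric_sym.
    by move: xi yi => /=; move: (_^-1) => t; lra.
have H1 : \forall x \ae mu, forall k, U x -> partials phi (dist_to (u k)) x = dd k x.
  by apply: ae_all => k; have [_] := ddP k; apply: ae_S => x A Ux; have [_ _] := A Ux.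
have H2 : \forall x \ae mu, forall (m : nat) (q : 'rV[rat]_n) (w : 'cV[rat]_n) (s : rat) (j i : nat),
    ratr s < pairing (map_mx ratr q) (map_mx ratr w) :> R -> ~ E m q w s j i x.
  apply: ae_all => m; apply: ae_all => q; apply: ae_all => w; apply: ae_all => s.
  apply: ae_all => j; apply: ae_all => i.
  have [bt|bf] := boolP (ratr s < pairing (map_mx ratr q) (map_mx ratr w) :> R).
    apply: negligibleS (E0 m q w s j i bt) => x nE.
    by apply: contrapT => nEx; apply: nE.
  by apply: aeW => x.
apply: ae_S3 H1 H2 (ae_indep chart) => x A1 A2 A3 Ux q w s r Hs r0 Hr.
rewrite leNgt; apply/negP => sqw.
have [m Im] := indep_indep_set (A3 Ux).
have [j jr] := inv_nat_lt r0.
have j20 : 0 < (j.+1%:R^-1 / 2 : R) by rewrite divr_gt0// invr_gt0.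
have [y Dy yx] := dense_near x dD j20; move: Dy; rewrite Du => -[i _ ui].
apply: (A2 m q w s j i sqw); split; first split; first split; first by split.
- by apply: locLip_le Hr => //; exact: ltW.
- by rewrite /= ui metric_sym.
- by move=> k /=; rewrite -A1//; apply: Hs; rewrite Du; exists k.
Qed.

(** A violation with real data has a gap [g], which leaves room for rational approximations. The
    covector is also shrunk by the factor [1 - t], because the bound on [Lip] gives only local
    Lipschitz constants [1 + t]. *)
Lemma ae_dual_le : \forall x \ae mu, U x -> forall a v,
  (Lip (lincomb a phi) x <= 1)%E ->
  (`|pairing a v|%:E <= ereal_sup [set `|pairing (partials phi (dist_to y) x) v|%:E | y in D])%E.
Proof.
have [L L0 phiL] := chart_lipschitz chart.
apply: ae_S2 ae_dist_differentiable ae_slope_bound => x A1 A2 Ux a v aL.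
have [[kap k0 I] Dd] := A1 Ux; have {A1} {}A2 := A2 Ux.
wlog av : v / pairing a v = `|pairing a v| => [W|].
  have [p0|p0] := leP 0 (pairing a v); first by apply: W; rewrite ger0_norm.
  have := W (- v); rewrite pairingNr normrN => /(_ (esym (ltr0_norm p0))).
  congr (_ <= ereal_sup _)%E; apply/seteqP; split=> _ [y Dy <-]; exists y => //;
    by rewrite pairingNr normrN.
rewrite -av leNgt; apply/negP => Hlt.
set N1 := ereal_sup _ in Hlt.
have [y0 Dy0 _] := dense_near point dD ltr01.
have N1_ge0 : (0 <= N1)%E.
  by apply: le_ereal_sup_tmp; exists `|pairing (partials phi (dist_to y0) x) v|%:E; [exists y0|rewrite lee_fin].
have N1E : N1 = (fine N1)%:E by rewrite fineK// ge0_fin_numE// (lt_trans Hlt)// ltry.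
set N := fine N1 in N1E; rewrite N1E lte_fin in Hlt.
have N0 : 0 <= N by rewrite -lee_fin -N1E.
have NP y : D y -> `|pairing (partials phi (dist_to y) x) v| <= N.
  by move=> Dy; rewrite -lee_fin -N1E; apply: ereal_sup_ubound; exists y.
set g := pairing a v - N; have g0 : 0 < g by rewrite subr_gt0.
(* Shrinking by [1 - t] then costs at most [g / 2] in the pairing. *)
pose t := g / (2 * (pairing a v + 1)).
have pav : 0 < pairing a v by lra.
have t0 : 0 < t by rewrite divr_gt0// mulr_gt0// addr_gt0.
have t1 : t <= 1 by rewrite ler_pdivrMr ?mulr_gt0 ?addr_gt0// /g; lra.
have tav : t * pairing a v <= g / 2.
  rewrite /t mulrAC ler_pdivrMr ?mulr_gt0 ?addr_gt0//.
  have -> : g / 2 * (2 * (pairing a v + 1)) = g * pairing a v + g by field.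
  by lra.
have kv0 : 0 < kap^-1 by rewrite invr_gt0.
(* [A] dominates the coefficients of three rounding errors, each of which becomes at most [g / 16].
   The bound [t ^+ 2 / L] in [th] is what the identity [(1 - t) * (1 + t) + t ^+ 2 = 1] leaves for
   rounding the covector. *)
pose A := n%:R * (`|v| + `|a| + 1 + kap^-1) + 1.
have A0 : 0 < A by rewrite ltr_wpDl// mulr_ge0// addr_ge0 ?addr_ge0// ltW.
pose th := Num.min 1 (Num.min (t ^+ 2 / L) (g / 16 / A)).
have th0 : 0 < th by rewrite !lt_min ltr01 !divr_gt0// exprn_gt0.
have th1 : th <= 1 by rewrite ge_min lexx.
have thL : L * th <= t ^+ 2.
  by rewrite mulrC -ler_pdivlMr// /th !ge_min lexx orbT.
have thA : th * A <= g / 16 by rewrite -ler_pdivlMr// /th !ge_min lexx !orbT.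
have [q qa] := rat_row_dense ((1 - t) *: a) th0.
have [w wv] := rat_col_dense v th0.
set b : 'rV[R]_n := map_mx ratr q in qa; set z : 'cV[R]_n := map_mx ratr w in wv.
have nA c : 0 <= c -> c <= `|v| + `|a| + 1 + kap^-1 -> n%:R * c * th <= g / 16.
  move=> c0 cA; rewrite (le_trans _ thA)// mulrC ler_wpM2l ?(ltW th0)//.
  by rewrite /A ler_wpDr// ler_wpM2l.
have [v0 a0] := (normr_ge0 v, normr_ge0 a).
have nb : `|b| <= `|a| + 1.
  rewrite -[b](subKr ((1 - t) *: a)) (le_trans (ler_normB _ _))// lerD//; last exact: le_trans th1.
  by rewrite normrZ ger0_norm ?subr_ge0// ler_piMl//; lra.
have e1 : `|pairing b v - (1 - t) * pairing a v| <= g / 16.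
  rewrite -pairingZl -pairingBl (le_trans (pairing_le _ _))// distrC.
  have m1 : 0 <= n%:R * `|v| by rewrite mulr_ge0.
  rewrite mulrAC (le_trans (ler_wpM2l m1 qa))//.
  by apply: nA => //; lra.
have e2 : `|pairing b z - pairing b v| <= g / 16.
  rewrite -pairingBr (le_trans (pairing_le _ _))// distrC.
  have m1 : 0 <= n%:R * `|b| by rewrite mulr_ge0.
  rewrite (le_trans (ler_wpM2l m1 wv))//.
  by apply: le_trans (nA (`|a| + 1) _ _); rewrite ?ler_wpM2r ?ler_wpM2l ?(ltW th0)//; lra.
have e3 y : D y -> pairing (partials phi (dist_to y) x) z <= N + g / 16.
  move=> Dy; set c := partials _ _ _.
  have cB : `|c| <= kap^-1.
    rewrite -[leRHS]mul1r ler_pdivlMr// mulrC.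
    apply: (partials_le ler01 ltr01 I (Dd _ Dy)); apply: locLip_lipschitz.
    exact: mdist_lipschitz.
  have := NP y Dy; rewrite -/c ler_norml => /andP[_ cv].
  have : `|pairing c z - pairing c v| <= g / 16.
    rewrite -pairingBr (le_trans (pairing_le _ _))// distrC.
    have m1 : 0 <= n%:R * `|c| by rewrite mulr_ge0.
    rewrite (le_trans (ler_wpM2l m1 wv))//.
    by apply: le_trans (nA kap^-1 _ _); rewrite ?ler_wpM2r ?ler_wpM2l ?(ltW th0) ?(ltW kv0)//; lra.
  by rewrite ler_norml => /andP[_]; lra.
have lt_s : N + g / 16 < N + g / 8 by lra.
have [s] := rat_in_itvoo lt_s; rewrite in_itv/= => /andP[s1 s2].
have [|r r0 Hr] := @Lip_lt _ _ (lincomb a phi) (1 + t) x.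
  by rewrite (le_lt_trans aL)// lte_fin ltrDl.
have Hb : locLip (lincomb b phi) 1 r x.
  move=> y xy.
  have -> : lincomb b phi y - lincomb b phi x =
    (1 - t) * (lincomb a phi y - lincomb a phi x) -
    (lincomb ((1 - t) *: a - b) phi y - lincomb ((1 - t) *: a - b) phi x).
    by rewrite lincombB /lincomb !pairingZl; ring.
  rewrite (le_trans (ler_normB _ _))// normrM ger0_norm ?subr_ge0//.
  have B1 : (1 - t) * `|lincomb a phi y - lincomb a phi x| <= (1 - t) * ((1 + t) * mdist x y).
    by rewrite ler_wpM2l ?subr_ge0// Hr.
  have B2 : `|lincomb ((1 - t) *: a - b) phi y - lincomb ((1 - t) *: a - b) phi x| <= t ^+ 2 * mdist x y.
    rewrite /lincomb -pairingBr (le_trans (phiL _ _ _))// ler_wpM2r ?mdist_ge0//.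
    by rewrite (le_trans (ler_wpM2l (ltW L0) qa)).
  have B3 : (1 - t) * ((1 + t) * mdist x y) + t ^+ 2 * mdist x y = 1 * mdist x y by ring.
  by rewrite -B3 lerD.
have := A2 q w s r (fun y Dy => le_trans (e3 y Dy) (ltW s1)) r0 Hb.
rewrite -/b -/z => bz.
move: e1 e2; rewrite !ler_norml => /andP[? ?] /andP[? ?].
have : g = pairing a v - N by [].
have : (1 - t) * pairing a v = pairing a v - t * pairing a v by ring.
lra.
Qed.

End dense_set.
End duality.

(** * Seminorms on the tangent bundle and essential suprema *)

Section bundle.
Context {R : realType} {X : completePMetricType R}.

Lemma seminorm_le n (p : 'cV[R]_n -> \bar R) : is_seminorm p ->
  exists2 P : R, 0 <= P & forall w, (p w <= (P * `|w|)%:E)%E.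
Proof.
move=> [pfin pZ pD].
have pE v : p v = (fine (p v))%:E.
  by have /andP[? ?] := pfin v; rewrite fineK// ge0_fin_numE.
have p0 v : 0 <= fine (p v) by rewrite fine_ge0//; have /andP[] := pfin v.
exists (\sum_j fine (p (delta_mx j 0))); first by rewrite sumr_ge0.
move=> w.
have H (s : seq 'I_n) : (p (\sum_(j <- s) w j 0 *: delta_mx j 0)%R <=
    (\sum_(j <- s) fine (p (delta_mx j 0%R)) * `|w|)%R%:E)%E.
  elim: s => [|j s IH].
    by rewrite !big_nil -(scale0r 0) pZ normr0 mul0e.
  rewrite !big_cons EFinD (le_trans (pD _ _))// leeD// pZ pE -EFinM lee_fin mulrC.
  by rewrite ler_wpM2l// mx_norm_coord.
have := H (index_enum _); rewrite -mulr_suml; congr (p _ <= _)%E.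
by rewrite [RHS]matrix_sum_delta; apply: eq_bigr => j _; rewrite big_ord1.
Qed.

(* Rational vectors suffice to compare a linear form with a generalized
   seminorm, since a finite seminorm is Lipschitz. *)
Lemma pairing_le_generalized n (p : 'cV[R]_n -> \bar R) (a : 'rV[R]_n) :
  is_generalized_seminorm p ->
  (forall q : 'cV[rat]_n, (`|pairing a (map_mx ratr q)|%:E <= p (map_mx ratr q))%E) ->
  forall v, (`|pairing a v|%:E <= p v)%E.
Proof.
move=> [sp|[p0 pinf]] Hq v; last first.
  have [->|/pinf->] := eqVneq v 0; last by rewrite leey.
  by rewrite p0 -(scale0r 0) pairingZr mul0r normr0.
have [P P0 pP] := seminorm_le sp; have [pfin _ pD] := sp.
have pE w : p w = (fine (p w))%:E.
  by have /andP[? ?] := pfin w; rewrite fineK// ge0_fin_numE.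
rewrite pE lee_fin; apply/ler_addgt0Pr => e e0.
pose M := P + n%:R * `|a| + 1.
have M0 : 0 < M by rewrite ltr_wpDl// addr_ge0// mulr_ge0.
have [q qv] := rat_col_dense v (divr_gt0 e0 M0).
set z : 'cV[R]_n := map_mx ratr q in qv.
have H1 : `|pairing a z| <= fine (p z) by rewrite -lee_fin -pE Hq.
have H2 : fine (p z) <= fine (p v) + P * `|v - z|.
  rewrite -lee_fin EFinD -!pE -[z in leLHS](addrNK v) addrC (le_trans (pD _ _))// leeD//.
  by rewrite distrC.
have H3 : `|pairing a v| <= `|pairing a z| + n%:R * `|a| * `|v - z|.
  rewrite -[v in leLHS](subrK z) addrC pairingDr (le_trans (ler_normD _ _))// lerD2l.
  exact: pairing_le.
have H4 : (P + n%:R * `|a| + 1) * `|v - z| <= e by rewrite mulrC -ler_pdivlMr.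
by have := normr_ge0 (v - z); lra.
Qed.

Variables (mu : {measure set (borel X) -> \bar R}) (A : chart_family X).
Hypotheses (X_separable : separable X) (mu_radon : radon mu) (A_atlas : is_atlas mu A).

Let chart (al : chart_idx A) : is_chart mu (chart_dom al) (chart_map al).
Proof. by case: A_atlas => H _; exact: H. Qed.

Let coord_lipschitz (al : chart_idx A) i : lipschitz_fun (fun y => chart_map al y i 0).
Proof. by case: (chart al). Qed.

Lemma ae_diff_coord (al be : chart_idx A) : \forall x \ae mu, chart_dom al x ->
  indep (chart_map al) x /\ forall i, diff_at (chart_map al) (fun y => chart_map be y i 0) x.
Proof.
have H : \forall x \ae mu, forall i, chart_dom al x ->
    diff_at (chart_map al) (fun y => chart_map be y i 0) x.
  apply: ae_all => i; have Hi := ae_diff_at (chart al) (coord_lipschitz i).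
  by apply: ae_S Hi => x Di Ux; have [] := Di Ux.
by apply: ae_S2 (ae_indep (chart al)) H => x I D Ux; split=> [|i]; [exact: I|exact: D].
Qed.

Lemma ae_chain f (al be : chart_idx A) : lipschitz_fun f ->
  \forall x \ae mu, chart_dom al x -> chart_dom be x ->
    partials (chart_map al) f x = partials (chart_map be) f x *m transition al be x.
Proof.
move=> lf; have [L L0 psiL] := chart_lipschitz (chart be).
apply: ae_S2 (ae_diff_coord al be) (ae_diff_at (chart be) lf) => x D1 D2 Ua Ub.
have [I {}D1] := D1 Ua; have [_ {}D2] := D2 Ub.
by have [_ ->] := partials_chain psiL I D1 D2.
Qed.

Lemma ae_cocycle (al be ga : chart_idx A) : \forall x \ae mu,
  chart_dom al x -> chart_dom be x ->
  transition al ga x = transition be ga x *m transition al be x.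
Proof.
have H : \forall x \ae mu, forall i, chart_dom al x -> chart_dom be x ->
    partials (chart_map al) (fun y => chart_map ga y i 0) x =
    partials (chart_map be) (fun y => chart_map ga y i 0) x *m transition al be x.
  by apply: ae_all => i; exact: ae_chain (coord_lipschitz i).
apply: ae_S H => x H Ua Ub; apply/matrixP => i j.
rewrite mxE H// !mxE; apply: eq_bigr => k _; by rewrite !mxE.
Qed.

Lemma ae_transition_id (al : chart_idx A) : \forall x \ae mu, chart_dom al x ->
  transition al al x = 1%:M.
Proof.
apply: ae_S (ae_indep (chart al)) => x I Ua; apply/matrixP => i j.
have E : (fun y => chart_map al y i 0) = lincomb (delta_mx 0 i) (chart_map al).
  by apply/funext => y; rewrite /lincomb pairing_delta.
rewrite mxE E; have [_ ->] := partials_lincomb (delta_mx 0 i) (I Ua).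
by rewrite !mxE eqxx/= eq_sym.
Qed.

(** Domination is stated through sections, so a comparison at a given vector needs a section through
    it. Compatibility between charts is the cocycle identity. *)
Definition constant_section (al : chart_idx A) (v : 'cV[R]_(chart_dim al)) : TX_field A :=
  fun be x => if x \in chart_dom al then transition al be x *m v else 0.

Lemma measurable_constant_section (al : chart_idx A) v :
  measurable_section mu (constant_section (al := al) v).
Proof.
have mU : measurable (chart_dom al : set (borel X)) by case: (chart al) => _ [].
split=> [be i|be ga]; last first.
  apply: ae_S (ae_cocycle al be ga) => x E Ub _; rewrite /constant_section.
  case: ifPn => [/set_mem Ua|_]; last by rewrite mulmx0.
  by rewrite E// mulmxA.
have [D mD HD] := measurable_partials (chart al) (coord_lipschitz i).
exists (fun x => \1_(chart_dom al) x * pairing (D x) v).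
  apply: measurable_funM; first exact: measurable_indic.
  apply: measurable_sum => k; apply: measurable_funM => //.
  by apply: measurable_funTS; exact: mD.
apply: ae_S HD => x HD Ub; rewrite /constant_section indicE.
case: ifPn => [/set_mem Ua|_]; last by rewrite mxE mul0r.
have [_ _ <-] := HD Ua; rewrite mul1r mxE /pairing.
by apply: eq_bigr => k _; rewrite mxE.
Qed.

Section dense_set.
Context (D : set X).
Hypotheses (cD : countable D) (dD : dense D).
Local Notation N1 := (dense_distance_seminorm A D).
Local Notation N4 := (dual_Lip_norm A).

(** Distance functions are 1-Lipschitz, so their differentials lie in the unit ball of [Lip_norm];
    the converse inequality is [ae_dual_le]. *)
Lemma ae_dense_eq_dual (al : chart_idx A) : \forall x \ae mu, chart_dom al x ->
  N1 al x = N4 al x /\ is_norm (N4 al x).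
Proof.
have [L L0 phiL] := chart_lipschitz (chart al).
apply: ae_S2 (ae_dist_differentiable (chart al) cD dD)
  (ae_dual_le X_separable mu_radon (chart al) cD dD) => x H1 H2 Ux.
have [[kap k0 I] Dd] := H1 Ux; split; last exact: dual_norm_is_norm L0 k0 phiL I.
apply/funext => v; apply/eqP; rewrite eq_le; apply/andP; split.
  apply: ge_ereal_sup => _ [y Dy <-]; apply: ereal_sup_ubound.
  exists (partials (chart_map al) (dist_to y) x) => //=.
  by apply: Lip_differential_le1; [exact: mdist_lipschitz|exact: Dd].
by apply: ge_ereal_sup => _ [a aL <-]; exact: H2.
Qed.

Lemma ae_differential_le f (al : chart_idx A) : lipschitz_with 1 f ->
  \forall x \ae mu, chart_dom al x -> forall v, (abs_differential f x v <= N1 al x v)%E.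
Proof.
move=> f1; have lf : lipschitz_fun f by exists 1.
apply: ae_S2 (ae_diff_at (chart al) lf) (ae_dense_eq_dual al) => x Df E Ux v.
have [_ {}Df] := Df Ux; have [-> _] := E Ux.
apply: ereal_sup_ubound; exists (partials (chart_map al) f x) => //=.
exact: Lip_differential_le1.
Qed.

Lemma dense_measurable_seminorm : measurable_generalized_seminorm mu N1.
Proof.
have [u Du] := countable_dense_range cD dD.
have lu i : lipschitz_fun (dist_to (u i) : X -> R) by exists 1; exact: mdist_lipschitz.
split.
- move=> al; apply: ae_S (ae_dense_eq_dual al) => x E Ux.
  by have [-> [? _]] := E Ux; left.
- move=> al be.
  have H : \forall x \ae mu, forall i, chart_dom al x -> chart_dom be x ->
      partials (chart_map al) (dist_to (u i)) x =
      partials (chart_map be) (dist_to (u i)) x *m transition al be x.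
    by apply: ae_all => i; exact: ae_chain.
  apply: ae_S H => x H Ua Ub v; congr ereal_sup.
  apply/seteqP; split=> _ [y Dy <-]; exists y => //; move: Dy; rewrite Du => -[i _ <-];
    by rewrite /abs_differential /differential H// pairing_mulmx.
- move=> s [ms _] al.
  have mU : measurable (chart_dom al : set (borel X)) by case: (chart al) => _ [].
  have /choice[dd ddP] : forall i, exists dd : X -> 'rV[R]_(chart_dim al),
      (forall j, measurable_fun setT (fun x : borel X => dd x 0 j)) /\
      \forall x \ae mu, chart_dom al x -> partials (chart_map al) (dist_to (u i)) x = dd x.
    move=> i; have [dd md Hd] := measurable_partials (chart al) (lu i); exists dd; split=> //.
    by apply: ae_S Hd => x Hd Ux; have [_ _] := Hd Ux.
  have /choice[g gP] : forall j, exists g : borel X -> R,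
      measurable_fun (chart_dom al : set (borel X)) g /\
      \forall x \ae mu, chart_dom al x -> s al x j 0 = g x.
    by move=> j; have [g ? ?] := ms al j; exists g.
  pose F i (x : borel X) : \bar R := `|\sum_j dd i x 0 j * g j x|%:E.
  (* From index 0, [esups] is the supremum over the whole enumeration of [D]. *)
  exists (fun x => esups (F ^~ x) 0%N).
    apply: measurable_fun_esups => i; apply/measurable_EFinP.
    apply: measurableT_comp => //; apply: measurable_sum => j; apply: measurable_funM.
      by apply: measurable_funTS; have [+ _] := ddP i.
    by have [] := gP j.
  have H1 : \forall x \ae mu, forall i, chart_dom al x ->
      partials (chart_map al) (dist_to (u i)) x = dd i x.
    by apply: ae_all => i; have [] := ddP i.
  have H2 : \forall x \ae mu, forall j, chart_dom al x -> s al x j 0 = g j x.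
    by apply: ae_all => j; have [] := gP j.
  apply: ae_S2 H1 H2 => x E1 E2 Ux.
  have EF i : F i x = abs_differential (dist_to (u i)) x (s al x).
    rewrite /F /abs_differential /differential E1// /pairing; congr (`|_|%:E).
    by apply: eq_bigr => j _; rewrite E2.
  congr ereal_sup; apply/seteqP; split=> [_ [y Dy <-]|_ [i _ <-]].
    by move: Dy; rewrite Du => -[i _ <-]; exists i => //; rewrite EF.
  by exists (u i); [rewrite Du; exists i|rewrite -EF].
Qed.

(** Domination holds along each section off a null set of its own. Constant sections with rational
    coefficients are countable in number, and [pairing_le_generalized] passes to all vectors of the
    fibre. *)
Lemma dense_minimal (F : set (TX_fun A)) N' :
  (forall y, D y -> F (abs_differential (dist_to y))) ->
  measurable_generalized_seminorm mu N' -> dominates mu F N' ->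
  forall al, \forall x \ae mu, chart_dom al x -> forall v, (N1 al x v <= N' al x v)%E.
Proof.
move=> FD [N'gen _ _] dom al; have [u Du] := countable_dense_range cD dD.
have H : \forall x \ae mu, forall i (q : 'cV[rat]_(chart_dim al)), chart_dom al x ->
    (abs_differential (dist_to (u i)) x (constant_section (map_mx ratr q) al x) <=
     N' al x (constant_section (map_mx ratr q) al x))%E.
  apply: ae_all => i; apply: ae_all => q; apply: dom.
    by apply: FD; rewrite Du; exists i.
  exact: measurable_constant_section.
apply: ae_S3 H (N'gen al) (ae_transition_id al) => x H G T Ux v.
apply: ge_ereal_sup => _ [y + <-]; rewrite Du => -[i _ <-].
apply: pairing_le_generalized; first exact: G.
by move=> q; have := H i q Ux; rewrite /constant_section mem_set// (T Ux) mul1mx.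
Qed.

(** One argument for both families: they lie between the distance functions of [D], which force
    minimality, and the 1-Lipschitz functions, which are dominated. *)
Lemma dense_essential_supremum (F : set (TX_fun A)) :
  (forall y, D y -> F (abs_differential (dist_to y))) ->
  (forall M, F M -> exists2 f, lipschitz_with 1 f & M = abs_differential f) ->
  is_essential_supremum mu F N1.
Proof.
move=> FD Flip; split; first exact: dense_measurable_seminorm.
  move=> M /Flip[f f1 ->] s ms al.
  by apply: ae_S (ae_differential_le al f1) => x H Ux; exact: H.
by move=> N' mN' dN'; exact: dense_minimal FD mN' dN'.
Qed.

Lemma dense_distance_essential_supremum :
  is_essential_supremum mu (distance_seminorms A) N1.
Proof.
apply: dense_essential_supremum => [y _|_ [y _ <-]]; first by exists y.
by exists (dist_to y) => //; exact: mdist_lipschitz.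
Qed.

Lemma dense_lipschitz1_essential_supremum :
  is_essential_supremum mu (lipschitz1_seminorms A) N1.
Proof.
apply: dense_essential_supremum => [y _|_ [f f1 <-]]; last by exists f.
by exists (dist_to y) => //; exact: mdist_lipschitz.
Qed.

End dense_set.

Lemma essential_supremum_uniq (F : set (TX_fun A)) N N' :
  is_essential_supremum mu F N -> is_essential_supremum mu F N' ->
  forall al, \forall x \ae mu, chart_dom al x -> N al x = N' al x.
Proof.
move=> [m1 d1 min1] [m2 d2 min2] al.
apply: ae_S2 (min1 _ m2 d2 al) (min2 _ m1 d1 al) => x H1 H2 Ux.
by apply/funext => v; apply/eqP; rewrite eq_le H1// H2.
Qed.

End bundle.

Theorem theorem1p6 (R : realType) (X : completePMetricType R)
    (mu : {measure set (borel X) -> \bar R}) (A : chart_family X)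
    (X_separable : separable X) (mu_radon : radon mu)
    (A_atlas : is_atlas mu A) (A_compatible : compatible_atlas A)
    (D : set X) (D_countable : countable D) (D_dense : dense D) :
  [/\ exists N2 : TX_fun A,
        is_essential_supremum mu (distance_seminorms A) N2,
      exists N3 : TX_fun A,
        is_essential_supremum mu (lipschitz1_seminorms A) N3,
      forall N2 N3 : TX_fun A,
        is_essential_supremum mu (distance_seminorms A) N2 ->
        is_essential_supremum mu (lipschitz1_seminorms A) N3 ->
        let N1 := dense_distance_seminorm A D in
        let N4 := dual_Lip_norm A in
        forall al : chart_idx A, \forall x \ae mu, chart_dom al x ->
          (forall v : 'cV[R]_(chart_dim al),
             [/\ N1 al x v = N2 al x v,
                 N2 al x v = N3 al x v &
                 N3 al x v = N4 al x v]) /\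
          [/\ is_norm (N1 al x), is_norm (N2 al x),
              is_norm (N3 al x) & is_norm (N4 al x)] &
      forall D' : set X, countable D' -> dense D' ->
        forall al : chart_idx A, \forall x \ae mu, chart_dom al x ->
          forall v : 'cV[R]_(chart_dim al),
            dense_distance_seminorm A D al x v =
            dense_distance_seminorm A D' al x v].

Proof.
have sup2 := dense_distance_essential_supremum X_separable mu_radon A_atlas.
have sup3 := dense_lipschitz1_essential_supremum X_separable mu_radon A_atlas.
have eq4 := ae_dense_eq_dual X_separable mu_radon A_atlas.
split.
- by exists (dense_distance_seminorm A D); exact: sup2.
- by exists (dense_distance_seminorm A D); exact: sup3.
- move=> N2 N3 N2sup N3sup N1 N4 al.
  apply: ae_S3 (eq4 D D_countable D_dense al)
    (essential_supremum_uniq N2sup (sup2 D D_countable D_dense) al)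
    (essential_supremum_uniq N3sup (sup3 D D_countable D_dense) al) => x E4 E2 E3 Ux.
  have [{}E4 norm4] := E4 Ux; rewrite (E2 Ux) (E3 Ux) /N1 E4.
  by split.
- move=> D' D'_countable D'_dense al.
  apply: ae_S2 (eq4 D D_countable D_dense al) (eq4 D' D'_countable D'_dense al) => x E E' Ux v.
  by have [-> _] := E Ux; have [-> _] := E' Ux.
Qed.
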